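(* Let $d\ge3$ and let $\mathbb P$ be a probability measure on $(\Omega,\mathcal F)$, $\Omega=(0,\infty)^{\mathbb B^d}$, such that: (i) (stationarity) $\mathbb P\circ\tau_x^{-1}=\mathbb P$ for all $x\in\mathbb Z^d$; (ii) (ergodicity) $\mathbb P[A]\in\{0,1\}$ for every $A\in\mathcal F$ with $\tau_x(A)=A$ for all $x\in\mathbb Z^d$; (iii) (moment condition) there exist $p,q\in(1,\infty]$ with $\frac1p+\frac1q<\frac2{d-1}$ such that $\mathbb E[\omega(\mathrm e)^p]<\infty$ and $\mathbb E[\omega(\mathrm e)^{-q}]<\infty$ for every $\mathrm e\in\mathbb B^d$. Let $\chi=(\chi_1,\dots,\chi_d):\Omega\times\mathbb Z^d\to\mathbb R^d$ be the corrector, i.e. $\chi_j$ is the orthogonal projection in $L^2_{\rm cov}$ of the position field $\Pi_j$ onto $L^2_{\rm pot}$. Then for every $L\in\mathbb N$ and every $j\in\{1,\dots,d\}$, $$\lim_{n\to\infty}\frac1n\max_{x\in B(Ln)}|\chi_j(\omega,x)|=0\qquad\mathbb P\text{-a.s.}$$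
   Context: $\mathbb N=\{1,2,\dots\}$; $\mathbb B^d:=\{\{x,y\}:x,y\in\mathbb Z^d,|x-y|=1\}$; $\Omega:=(0,\infty)^{\mathbb B^d}$ with $\mathcal F:=\mathcal B((0,\infty))^{\otimes\mathbb B^d}$. One writes $\omega(x,y)=\omega(y,x):=\omega(\{x,y\})$ if $\{x,y\}\in\mathbb B^d$ and $0$ otherwise. $\mathbb E$ is expectation with respect to $\mathbb P$. Shifts: $\tau_x\omega(\cdot):=\omega(\cdot+x)$, where $\{y,z\}+x:=\{y+x,z+x\}$. $B(n):=([-n,n]\cap\mathbb Z)^d$. Conventions: $1/\infty=0$; for $p=\infty$ (resp. $q=\infty$) the moment condition means $\mathbb P$-essential boundedness of $\omega(\mathrm e)$ (resp. $\omega(\mathrm e)^{-1}$). Corrector. A random field $\Psi:\Omega\times\mathbb Z^d\to\mathbb R$ satisfies the cocycle property if for $\mathbb P$-a.e. $\omega$, $\Psi(\tau_x\omega,y-x)=\Psi(\omega,y)-\Psi(\omega,x)$ for all $x,y\in\mathbb Z^d$. $L^2_{\rm cov}$ is the Hilbert space of random fields $\Psi$ with the cocycle property and $\|\Psi\|_{L^2_{\rm cov}}^2:=\mathbb E\big[\sum_{x\in\mathbb Z^d}\omega(0,x)\Psi(\omega,x)^2\big]<\infty$ (with the associated inner product). A function $\phi:\Omega\to\mathbb R$ is local if it depends on $\omega$ only through its values at finitely many bonds; its horizontal derivative is $D\phi(\omega,x):=\phi(\tau_x\omega)-\phi(\omega)$, $x\in\mathbb Z^d$. $L^2_{\rm pot}$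 is the closure in $L^2_{\rm cov}$ of the set of those $D\phi$, $\phi$ local (measurable), that lie in $L^2_{\rm cov}$, and $L^2_{\rm sol}$ is the orthogonal complement of $L^2_{\rm pot}$ in $L^2_{\rm cov}$. The position field is $\Pi(\omega,x)=x$ with components $\Pi_j(\omega,x)=x\cdot e_j$; $\Pi_j\in L^2_{\rm cov}$. The fields $\chi_j\in L^2_{\rm pot}$ and $\Phi_j\in L^2_{\rm sol}$ are defined by the orthogonal decomposition $\Pi_j=\chi_j+\Phi_j\in L^2_{\rm pot}\oplus L^2_{\rm sol}$. *)

(* Defs.v *)
From HB Require Import structures.
From mathcomp Require Import all_boot all_order all_algebra finmap.
From mathcomp Require Import all_classical all_reals all_analysis.

Set Implicit Arguments.
Unset Strict Implicit.
Unset Printing Implicit Defensive.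

Import Order.TTheory GRing.Theory Num.Theory.
Import numFieldTopology.Exports numFieldNormedType.Exports.

Local Open Scope classical_set_scope.
Local Open Scope ring_scope.

Notation lattice d := ('rV[int]_d).

(* For integer points |x - y| = 1 holds iff |x - y|^2 = 1, so that the
   Euclidean norm can be kept inside int. *)
Definition nearest_neighbours (d : nat) (x y : lattice d) : bool :=
  \sum_(i < d) ((x - y) 0 i) ^+ 2 == 1.

Definition is_bond (d : nat) (e : {fset lattice d}) : bool :=
  `[< exists x y : lattice d, nearest_neighbours x y /\ e = [fset x; y]%fset >].

Notation bond d := {e : {fset lattice d} | is_bond e}.

Lemma is_bond_shift (d : nat) (x : lattice d) (e : bond d) :
  is_bond [fset (z + x)%R | z in val e]%fset.
Proof.
case: e => e /= /asboolP[y [z [yz ->]]]; apply/asboolP.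
exists (y + x), (z + x); split.
  by rewrite /nearest_neighbours opprD addrACA subrr addr0.
apply/fsetP => u; rewrite !inE; apply/imfsetP/orP => /= [[v]|].
  by rewrite !inE => /orP[]/eqP -> ->; [left|right].
by case=> /eqP ->; [exists y|exists z]; rewrite ?inE ?eqxx ?orbT.
Qed.

Definition bond_shift (d : nat) (x : lattice d) (e : bond d) : bond d :=
  Sub _ (is_bond_shift x e).

Definition conductance_fun (d : nat) (R : realType) := bond d -> {posnum R}.

HB.instance Definition _ (d : nat) (R : realType) :=
  Choice.on (conductance_fun d R).
HB.instance Definition _ (d : nat) (R : realType) :=
  isPointed.Build (conductance_fun d R) (fun=> 1%:pos).

(* Borel subsets of (0, oo) are the traces of Borel subsets B of R. *)
Definition coordinate_events (d : nat) (R : realType) :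
    set (set (conductance_fun d R)) :=
  [set A | exists (e : bond d) (B : set R),
     measurable B /\ A = [set w | B (w e)%:num]].

(* Omega, equipped with the product sigma-algebra F. *)
Notation env d R := (g_sigma_algebraType (@coordinate_events d R)).

Section random_conductances.
Context {d : nat} {R : realType}.

Definition conductance (w : env d R) (x y : lattice d) : R :=
  if insub [fset x; y]%fset is Some e then (w (e : bond d))%:num else 0.

Definition tau (x : lattice d) (w : env d R) : env d R :=
  fun e => w (bond_shift x e).

Implicit Type P : probability (env d R) R.

Definition stationary P : Prop :=
  forall (x : lattice d) (A : set (env d R)), measurable A ->
    P (tau x @^-1` A) = P A.

Definition ergodic P : Prop :=
  forall A : set (env d R), measurable A ->
    (forall x : lattice d, tau x @` A = A) -> P A = 0%E \/ P A = 1%E.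

(* E[X^p] < oo for finite p; P-essential boundedness for p = oo. *)
Definition has_moment P (p : \bar R) (X : env d R -> R) : Prop :=
  match p with
  | r%:E => ('E_P[fun w => (X w `^ r)%R] < +oo)%E
  | +oo%E => exists M : R, {ae P, forall w, `|X w| <= M}
  | -oo%E => False
  end.

Definition moment_condition P (p q : \bar R) : Prop :=
  forall e : bond d,
    has_moment P p (fun w => (w e)%:num) /\
    has_moment P q (fun w => ((w e)%:num)^-1).

Definition rfield := env d R -> lattice d -> R.

Implicit Types Psi Phi : rfield.

Definition cocycle P Psi : Prop :=
  {ae P, forall w, forall x y : lattice d,
     Psi (tau x w) (y - x) = Psi w y - Psi w x}.

(* The sums over the lattice below are finite, since conductance w 0 x vanishes
   unless x is one of the 2d neighbours of 0. *)
Definition cov_sqnorm P Psi : \bar R :=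
  ('E_P[fun w =>
     (\sum_(x \in [set: lattice d]) conductance w 0 x * Psi w x ^+ 2)%R])%E.

(* Finite on L2cov, where the integrand is integrable by Cauchy-Schwarz. *)
Definition cov_inner P Psi Phi : \bar R :=
  ('E_P[fun w =>
     (\sum_(x \in [set: lattice d]) conductance w 0 x * Psi w x * Phi w x)%R])%E.

(* Elements of L2cov are represented by actual fields, not by classes. *)
Definition L2cov P Psi : Prop :=
  [/\ forall x : lattice d, measurable_fun setT (Psi ^~ x),
      cocycle P Psi & (cov_sqnorm P Psi < +oo)%E].

Definition is_local (phi : env d R -> R) : Prop :=
  exists s : seq (bond d), forall w w' : env d R,
    {in s, w =1 w'} -> phi w = phi w'.

Definition hderiv (phi : env d R -> R) : rfield :=
  fun w x => phi (tau x w) - phi w.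

(* Closure of local gradients for the L2cov norm. *)
Definition L2pot P Psi : Prop :=
  L2cov P Psi /\
  forall eps : R, 0 < eps ->
    exists phi : env d R -> R,
      [/\ measurable_fun setT phi, is_local phi, L2cov P (hderiv phi)
        & (cov_sqnorm P (fun w x => (Psi w x - hderiv phi w x)%R)
             < (eps ^+ 2)%:E)%E].

Definition L2sol P Psi : Prop :=
  L2cov P Psi /\
  forall Phi : rfield, L2pot P Phi -> cov_inner P Psi Phi = 0%E.

Definition position (j : 'I_d) : rfield := fun _ x => (x 0 j)%:~R.

Definition is_corrector P (chi : env d R -> lattice d -> 'rV[R]_d) : Prop :=
  forall j : 'I_d,
    L2pot P (fun w x => chi w x 0 j) /\
    L2sol P (fun w x => position j w x - chi w x 0 j).

End random_conductances.

Definition box (d n : nat) : set (lattice d) :=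
  [set x | forall i : 'I_d, `|x 0 i| <= n%:Z].

(* Main.v *)
(* The function Phi_j(w, x) = x_j - chi_j(w, x) is a.s. harmonic for the random conductances.
   A De Giorgi iteration bounds a harmonic function u on a box of side r by a multiple of r
   as soon as u is O(r) in L^s average and the p-th moments of the conductances, the
   (-q)-th moments and the energy density of u are bounded in average.  The cut-offs are
   radial and decrease only across good spheres, so that Sobolev's inequality is needed
   only in dimension d-1; this is where 1/p + 1/q < 2/(d-1) enters.

   These averages are controlled by the ergodic theorem, with constants that are the same for
   all boxes of side r = eps n centred in a box of side L n.  Approximating chi_j by
   gradients of bounded functions shows that chi_j - c_n is o(n) in L^s average on the
   large box, so Phi_j - x_j(centre) + c_n is O(r) in average on each small box.  Hence
   |chi_j - c_n| <= K eps n on the large box, with K independent of eps; the value at the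
   origin, chi_j(0) = 0, bounds c_n, and eps is arbitrary. *)
Require Import Defs.
From HB Require Import structures.
From mathcomp Require Import all_boot all_order all_algebra finmap.
From mathcomp Require Import all_classical all_reals all_analysis measurable_realfun.
From mathcomp Require Import ring lra zify.

Set Implicit Arguments.
Unset Strict Implicit.
Unset Printing Implicit Defensive.

Import Order.TTheory GRing.Theory Num.Theory.
Import numFieldTopology.Exports numFieldNormedType.Exports.

Local Open Scope classical_set_scope.
Local Open Scope ring_scope.

(** * Inequalities for finite sums and real powers *)

(** One slack carries all exponents. With 1/s = 1/2 + 1/(2q) + ep and 1/t = (1 - 1/p)/2, the
    assumption on p and q leaves room for an ep > 0 that keeps the embedding of W^{1,s} into L^t on
    spheres, which have dimension d-1, subcritical. Then th = s ep is the power of the size of {u >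
    k} gained from Hölder's inequality, and it makes the iteration superlinear. On the lattice the
    iteration stops after n steps, when the remaining energy is of order one instead of r^d.

    A maximal inequality takes the place of pointwise convergence of averages: only upper bounds by
    a fixed multiple of an expectation occur, and smallness is obtained by making the expectation
    small beforehand. The obstacle is uniformity. The constants have to be the same for all windows
    centred at z 2^i, whatever z, whereas comparison with a ball around the origin loses a power of
    |z|. The scales are therefore thinned out, with a gap that depends on z, until the covering
    constant no longer depends on z. *)

Section finite_sums.
Context {R : realType} {T : eqType}.
Implicit Types (s : seq T) (f g : T -> R).

Lemma sum_ge0 s f : (forall x, 0 <= f x) -> 0 <= \sum_(x <- s) f x.
Proof. by move=> f0; apply: sumr_ge0. Qed.

Lemma sum_sub s1 s2 f : uniq s1 -> {subset s1 <= s2} ->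
  (forall x, x \in s2 -> 0 <= f x) -> \sum_(x <- s1) f x <= \sum_(x <- s2) f x.
Proof.
move=> u1 s12 f0.
pose s2' := undup s2.
have -> : \sum_(x <- s1) f x = \sum_(x <- s2' | x \in s1) f x.
  rewrite -[RHS]big_filter; apply: perm_big; apply: uniq_perm => //.
    by rewrite filter_uniq // undup_uniq.
  by move=> x; rewrite mem_filter mem_undup; case: (boolP (x \in s1)) => //= /s12 ->.
apply: (@le_trans _ _ (\sum_(x <- s2') f x)).
  rewrite [leRHS](bigID (mem s1)) /= lerDl big_seq_cond.
  by apply: sumr_ge0 => x /andP[]; rewrite mem_undup => /f0.
rewrite /s2' => {s12 s2'}; elim: s2 f0 => //= a l IH f0.
have {}IH := IH (fun x h => f0 x (mem_behead (s := a :: l) h)).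
case: ifP => _; rewrite !big_cons ?lerD2l //.
by apply: (le_trans IH); rewrite lerDr f0 ?mem_head.
Qed.

Lemma sum_supp_eq (V : nmodType) s1 s2 (f : T -> V) : uniq s1 -> uniq s2 ->
  (forall x, f x != 0 -> (x \in s1) && (x \in s2)) ->
  \sum_(x <- s1) f x = \sum_(x <- s2) f x.
Proof.
move=> u1 u2 h.
have E s : \sum_(x <- s) f x = \sum_(x <- s | f x != 0) f x.
  by rewrite [LHS](bigID (fun x => f x != 0)) /= [X in _ + X]big1 ?addr0 // => x /negbNE/eqP.
rewrite (E s1) (E s2) -[LHS]big_filter -[RHS]big_filter; apply: perm_big.
apply: uniq_perm; rewrite ?filter_uniq // => x.
by rewrite !mem_filter; case: eqVneq => //= /h /andP[-> ->].
Qed.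

Lemma sum_const s (c : R) : \sum_(x <- s) c = (size s)%:R * c.
Proof. by rewrite big_const_seq iter_addr_0 count_predT mulr_natl. Qed.

Lemma weighted_AMGM (a b al : R) : 0 <= a -> 0 <= b -> 0 < al < 1 ->
  a `^ al * b `^ (1 - al) <= al * a + (1 - al) * b.
Proof.
move=> a0 b0 /andP[al0 al1].
have := @conjugate_powR R (a `^ al) (b `^ (1 - al)) al^-1 (1 - al)^-1 (powR_ge0 _ _) (powR_ge0 _ _).
have n1 : al != 0 by lra.
have n2 : 1 - al != 0 by lra.
rewrite !invr_gt0 !invrK -!powRrM !divff // !powRr1 // => h.
rewrite [al * a]mulrC [(1 - al) * b]mulrC; apply: h => //; lra.
Qed.

(** After division by the two sums this is weighted AM-GM term by term. If one of the sums is zero,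
    all products vanish because both exponents are positive. *)
Lemma hoelder_sum s f g (al : R) : 0 < al < 1 ->
  (forall x, 0 <= f x) -> (forall x, 0 <= g x) ->
  \sum_(x <- s) f x `^ al * g x `^ (1 - al) <=
  (\sum_(x <- s) f x) `^ al * (\sum_(x <- s) g x) `^ (1 - al).
Proof.
move=> al01 f0 g0; have [al0 al1] := andP al01.
set A := \sum_(x <- s) f x; set B := \sum_(x <- s) g x.
have zero (h : T -> R) (be : R) : 0 < be -> (forall x, 0 <= h x) -> \sum_(x <- s) h x = 0 ->
    forall x, x \in s -> h x `^ be = 0.
  move=> be0 h0 hs x xs; apply/eqP; rewrite powR_eq0 (gt_eqF be0) andbT.
  rewrite eq_le h0 andbT -hs (big_rem x) //= lerDl. exact: sum_ge0.
have [A0|A0] := eqVneq A 0.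
  rewrite big_seq big1 ?mulr_ge0 ?powR_ge0 // => x xs.
  by rewrite (zero f al) // mul0r.
have [B0|B0] := eqVneq B 0.
  rewrite big_seq big1 ?mulr_ge0 ?powR_ge0 // => x xs.
  by rewrite (zero g (1 - al)) ?mulr0 //; lra.
have Ap : 0 < A by rewrite lt_def A0 sum_ge0.
have Bp : 0 < B by rewrite lt_def B0 sum_ge0.
have P : 0 < A `^ al * B `^ (1 - al) by rewrite mulr_gt0 ?powR_gt0.
rewrite -[leRHS]mul1r -(ler_pdivrMr _ _ P) mulr_suml.
have : forall x, f x `^ al * g x `^ (1 - al) / (A `^ al * B `^ (1 - al)) <=
   al * (f x / A) + (1 - al) * (g x / B).
  move=> x; have := @weighted_AMGM (f x / A) (g x / B) al.
  rewrite !powRM ?invr_ge0 ?(ltW Ap) ?(ltW Bp) // => h.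
  apply: le_trans (h _ _ al01); rewrite ?divr_ge0 ?(ltW Ap) ?(ltW Bp) //.
  have inv (y be : R) : 0 < y -> y^-1 `^ be = (y `^ be)^-1.
    by move=> y0; rewrite -powR_inv1 ?ltW // -powRrM mulrC powRrM powR_inv1 ?powR_ge0.
  by rewrite !inv // invfM mulrACA.
move=> h; apply: le_trans (ler_sum _ (fun x _ => h x)) _.
rewrite big_split /= -!mulr_sumr -!mulr_suml !divff //; lra.
Qed.

(** Hölder's inequality for f^be against the constant 1, with weight 1 / be. *)
Lemma jensen_sum s f (be : R) : 1 <= be -> (forall x, 0 <= f x) ->
  (\sum_(x <- s) f x) `^ be <= (size s)%:R `^ (be - 1) * \sum_(x <- s) f x `^ be.
Proof.
move=> be1 f0.
have [->|ben] := eqVneq be 1.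
  rewrite subrr powRr0 mul1r powRr1 ?sum_ge0 //.
  by under [leRHS]eq_bigr do rewrite powRr1 //.
have be1' : 1 < be by rewrite lt_neqAle eq_sym ben.
have be0 : 0 < be by lra.
have hal : 0 < be^-1 < 1 by rewrite invr_gt0 be0 invf_lt1.
have := @hoelder_sum s (fun x => f x `^ be) (fun=> 1) be^-1 hal (fun x => powR_ge0 _ _) (fun=> ler01).
under eq_bigr do rewrite -powRrM mulfV ?(gt_eqF be0) // powRr1 // powR1 mulr1.
rewrite sum_const mulr1 => h.
have := ge0_ler_powR (ltW be0) _ _ h.
rewrite !nnegrE sum_ge0 // mulr_ge0 ?powR_ge0 // => /(_ isT isT).
rewrite powRM ?powR_ge0 // -!powRrM mulVf ?(gt_eqF be0) // powRr1 ?sum_ge0 // => [|x]; last exact: powR_ge0.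
rewrite mulrBl mul1r mulVf ?(gt_eqF be0) // mulrC //.
Qed.

End finite_sums.

Section powR_facts.
Context {R : realType}.

Lemma powRr_le (x y be : R) : 0 <= x -> x <= y -> 0 <= be -> x `^ be <= y `^ be.
Proof.
move=> x0 xy be0; apply: ge0_ler_powR => //; rewrite nnegrE //; exact: le_trans xy.
Qed.

Lemma powRX (x be : R) n : 0 <= x -> (x ^+ n) `^ be = (x `^ be) ^+ n.
Proof.
by move=> x0; elim: n => [|n IH]; rewrite ?expr0 ?powR1 // !exprS powRM ?exprn_ge0 // IH.
Qed.

Lemma powRK (x be : R) : 0 <= x -> be != 0 -> (x `^ be) `^ be^-1 = x.
Proof. by move=> x0 b0; rewrite -powRrM divff // powRr1. Qed.

Lemma powRVK (x be : R) : 0 <= x -> be != 0 -> (x `^ be^-1) `^ be = x.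
Proof. by move=> x0 b0; rewrite -powRrM mulVf // powRr1. Qed.

(** Write x^be = x x^(be - 1) and use monotonicity of the second factor. It serves to add the
    energies of two halves of a box without loss in the constant. *)
Lemma powR_superadd (x y be : R) : 1 <= be -> 0 <= x -> 0 <= y ->
  x `^ be + y `^ be <= (x + y) `^ be.
Proof.
move=> be1 x0 y0.
have be0 : 0 < be by lra.
have xy0 : 0 <= x + y by rewrite addr_ge0.
rewrite -!(mulr_powRB1 _ be0) // mulrDl.
by apply: lerD; apply: ler_wpM2l => //; apply: powRr_le => //; lra.
Qed.

Lemma powRD_le (x y be : R) : 0 <= be -> 0 <= x -> 0 <= y ->
  (x + y) `^ be <= 2 `^ be * (x `^ be + y `^ be).
Proof.
move=> be0 x0 y0.
wlog xy : x y x0 y0 / x <= y.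
  move=> h; have [/h|/ltW/h] := leP x y; first exact.
  by rewrite addrC [y `^ _ + _]addrC; apply.
apply: (@le_trans _ _ ((2 * y) `^ be)).
  apply: powRr_le => //; lra.
by rewrite powRM ?ler0n // ler_wpM2l ?powR_ge0 // lerDr powR_ge0.
Qed.

(** Split one factor of (f + g)^t = (f + g) (f + g)^(t - 1), apply Hölder to both parts, and divide
    by S^(1 - 1/t), which requires S to be nonzero. *)
Lemma minkowski_sum (T : eqType) (s : seq T) (f g : T -> R) (t : R) : 1 < t ->
  (forall x, 0 <= f x) -> (forall x, 0 <= g x) ->
  (\sum_(x <- s) (f x + g x) `^ t) `^ t^-1 <=
  (\sum_(x <- s) f x `^ t) `^ t^-1 + (\sum_(x <- s) g x `^ t) `^ t^-1.
Proof.
move=> t1 f0 g0.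
have t0 : 0 < t by lra.
have tn : t != 0 by lra.
set S := \sum_(x <- s) _; set A := (\sum_(x <- s) f x `^ t) `^ _; set B := (X in _ <= _ + X).
have S0 : 0 <= S by apply: sum_ge0 => x; exact: powR_ge0.
have [->|Sn] := eqVneq S 0.
  by rewrite powR0 ?invr_eq0 // addr_ge0 ?powR_ge0.
have Sp : 0 < S by rewrite lt_def Sn.
have hal : 0 < t^-1 < 1 by rewrite invr_gt0 t0 invf_lt1.
have key (h : T -> R) : (forall x, 0 <= h x) ->
    \sum_(x <- s) h x * (f x + g x) `^ (t - 1) <=
    (\sum_(x <- s) h x `^ t) `^ t^-1 * S `^ (1 - t^-1).
  move=> h0.
  have := @hoelder_sum R T s (fun x => h x `^ t) (fun x => (f x + g x) `^ t) _ hal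
    (fun x => powR_ge0 _ _) (fun x => powR_ge0 _ _).
  apply: le_trans; apply: ler_sum => x _.
  by rewrite powRK // -[leRHS]/(_ * _ `^ _) -powRrM mulrBr mulr1 mulfV.
have : S <= (A + B) * S `^ (1 - t^-1).
  rewrite mulrDl; apply: le_trans (lerD (key f f0) (key g g0)).
  rewrite -big_split /=; apply: ler_sum => x _.
  by rewrite -mulrDl mulr_powRB1 // addr_ge0.
have -> : S `^ (1 - t^-1) = S / S `^ t^-1.
  by rewrite powRB ?Sn ?implybT // powRr1.
by rewrite mulrA ler_pdivlMr ?powR_gt0 // [leRHS]mulrC ler_pM2l.
Qed.

Lemma powR_le_inv (x y be : R) : 0 <= x -> 0 <= y -> 0 < be -> x `^ be <= y -> x <= y `^ be^-1.
Proof.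
move=> x0 y0 be0 h; rewrite -[leLHS](@powRK x be) ?gt_eqF //.
by apply: powRr_le; rewrite ?powR_ge0 // invr_ge0 ltW.
Qed.

Lemma powR_inv_le (x y be : R) : 0 <= x -> 0 <= y -> 0 < be -> x `^ be^-1 <= y -> x <= y `^ be.
Proof.
move=> x0 y0 be0 h; rewrite -[leLHS](@powRVK x be) ?gt_eqF //.
by apply: powRr_le; rewrite ?powR_ge0 // ltW.
Qed.

End powR_facts.

Lemma eq_le_refl (disp : Order.disp_t) (T : porderType disp) (x y : T) : x = y -> (x <= y)%O.
Proof. by move=> ->. Qed.

(** * Sobolev inequalities on dyadic boxes and on spheres *)

Section rectangles.
Context {d : nat}.
Implicit Types (a x y : lattice d) (l : 'I_d -> nat).

Definition unitv (i : 'I_d) : lattice d := delta_mx 0 i.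

Lemma unitvE (i j : 'I_d) : unitv i 0 j = (i == j)%:R.
Proof. by rewrite mxE eqxx eq_sym. Qed.

Lemma latticeD x y i : (x + y) 0 i = x 0 i + y 0 i.
Proof. by rewrite mxE. Qed.

Lemma latticeB x y i : (x - y) 0 i = x 0 i - y 0 i.
Proof. by rewrite !mxE. Qed.

Lemma latticeP x y : (forall i, x 0 i = y 0 i) -> x = y.
Proof. by move=> h; apply/rowP. Qed.

(** Boxes are duplicate-free lists because the lattice is not a finite type. They are half-open, so
    that two adjacent translates glue to a box with one side doubled; side 1 makes a box flat in
    that direction. *)
Definition rect a l : seq (lattice d) :=
  [seq a + \row_i (nat_of_ord (f i))%:Z | f : {dffun forall i, 'I_(l i)}].

Lemma mem_rect a l x :
  (x \in rect a l) = [forall i, (a 0 i <= x 0 i) && (x 0 i < a 0 i + (l i)%:Z)].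
Proof.
apply/idP/idP => [/mapP[f _ ->]|/forallP h].
  apply/forallP => i.
  by rewrite !mxE; case: (f i) => k /= hk; lia.
have H (i : 'I_d) : (absz (x 0 i - a 0 i)%R < l i)%N by have := h i; lia.
apply/mapP; exists [ffun i => Ordinal (H i)]; first by rewrite mem_enum.
by apply: latticeP => i; rewrite !mxE ffunE /=; have := h i; lia.
Qed.

Lemma mem_rectP a l x :
  reflect (forall i, a 0 i <= x 0 i < a 0 i + (l i)%:Z) (x \in rect a l).
Proof. by rewrite mem_rect; exact: forallP. Qed.

Lemma uniq_rect a l : uniq (rect a l).
Proof.
rewrite map_inj_uniq ?enum_uniq // => f g /addrI/rowP h.
apply/ffunP => i; apply: val_inj.
by have := h i; rewrite !mxE => -[].
Qed.

Lemma size_rect a l : size (rect a l) = (\prod_i l i)%N.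
Proof.
rewrite size_map -cardE card_dep_ffun foldrE big_map big_enum /=.
by apply: eq_bigr => i _; rewrite card_ord.
Qed.

Lemma rect_translate a l y :
  perm_eq (rect (a + y) l) [seq x + y | x <- rect a l].
Proof.
have mem (x : lattice d) : (x \in rect (a + y) l) = (x \in [seq x + y | x <- rect a l]).
  apply/mem_rectP/mapP => [h|[z /mem_rectP h ->] i].
    exists (x - y); last by rewrite subrK.
    by apply/mem_rectP => i; have := h i; rewrite ?latticeB ?latticeD; lia.
  by have := h i; rewrite ?latticeB ?latticeD; lia.
apply: uniq_perm => //; first exact: uniq_rect.
by rewrite map_inj_uniq ?uniq_rect // => u v /addIr.
Qed.

End rectangles.

Section doubling.
Context {R : realType} {d : nat}.
Variables (f : lattice d -> R) (s t : R).
Hypotheses (s1 : 1 <= s) (st : s <= t) (t1 : 1 < t).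

Definition grad (i : 'I_d) (x : lattice d) : R := f (x + unitv i) - f x.

(** Each edge is counted once, at its lower end, and only if both ends lie in D; this makes the
    energy superadditive over disjoint pieces. *)
Definition edge_energy (D : seq (lattice d)) : R :=
  \sum_(x <- D) \sum_i if x + unitv i \in D then `|grad i x| `^ s else 0.

Definition mean (D : seq (lattice d)) : R := (\sum_(x <- D) f x) / (size D)%:R.

(** The Sobolev-Poincaré inequality from W^{1,s} to L^t with constant T, raised to the power t. The
    constant is explicit because it is tracked through successive doublings of the box. *)
Definition sobolev (T : R) (D : seq (lattice d)) : Prop :=
  \sum_(x <- D) `|f x - mean D| `^ t <= (T * edge_energy D `^ s^-1) `^ t.

Lemma edge_energy_term_ge0 (D : seq (lattice d)) x i :
  0 <= (if x + unitv i \in D then `|grad i x| `^ s else 0).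
Proof. by case: ifP => // _; exact: powR_ge0. Qed.

Lemma edge_energy_ge0 D : 0 <= edge_energy D.
Proof. by apply: sum_ge0 => x; apply: sumr_ge0 => i _; exact: edge_energy_term_ge0. Qed.

Lemma perm_sobolev T D D' : perm_eq D D' -> sobolev T D -> sobolev T D'.
Proof.
move=> DD'.
have E : edge_energy D' = edge_energy D.
  rewrite /edge_energy -(perm_big _ DD') /=; apply: eq_bigr => x _.
  by apply: eq_bigr => i _; rewrite (perm_mem DD').
have M : mean D' = mean D by rewrite /mean -(perm_big _ DD') /= (perm_size DD').
by rewrite /sobolev E M -(perm_big _ DD').
Qed.

Lemma edge_energy_cat D1 D2 :
  edge_energy D1 + edge_energy D2 <= edge_energy (D1 ++ D2).
Proof.
rewrite /edge_energy big_cat /=; apply: lerD; apply: ler_sum => x _;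
  apply: ler_sum => i _; rewrite mem_cat; case: ifP => /= h; rewrite ?orbT //=;
  by case: ifP => // _; exact: powR_ge0.
Qed.

Lemma telescope_powR (i : 'I_d) (h : nat) x :
  `|f (x + unitv i *+ h) - f x| `^ s <=
  h%:R `^ (s - 1) * \sum_(j < h) `|grad i (x + unitv i *+ j)| `^ s.
Proof.
have s0 : 0 <= s by move: s1; lra.
have tel : f (x + unitv i *+ h) - f x = \sum_(j < h) grad i (x + unitv i *+ j).
  elim: h => [|h IH]; first by rewrite mulr0n addr0 subrr big_ord0.
  by rewrite big_ord_recr /= -IH /grad mulrSr addrA; ring.
rewrite tel.
apply: (@le_trans _ _ ((\sum_(j < h) `|grad i (x + unitv i *+ j)|) `^ s)).
  by apply: powRr_le => //; exact: ler_norm_sum.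
have := @jensen_sum R 'I_h (index_enum 'I_h) (fun j => `|grad i (x + unitv i *+ j)|) s s1
  (fun=> normr_ge0 _).
by rewrite -[index_enum _]enumT size_enum_ord.
Qed.

(** The difference of the means is a mean of differences along parallel segments of length h. For
    each j the j-th edges of these segments are distinct edges of D, so their total is at most h
    times the energy. *)
Lemma mean_shift_le (D1 D : seq (lattice d)) (i : 'I_d) (h : nat) :
  D1 != [::] -> uniq D1 -> uniq D ->
  (forall x j, x \in D1 -> (j <= h)%N -> x + unitv i *+ j \in D) ->
  `|mean D1 - mean [seq x + unitv i *+ h | x <- D1]| <=
  (size D1)%:R `^ (- s^-1) * (h%:R * edge_energy D `^ s^-1).
Proof.
move=> D10 uD1 uD hD.
have s0 : 0 < s by move: s1; lra.
have n0 : 0 < (size D1)%:R :> R by rewrite ltr0n lt0n size_eq0.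
set n := (size D1)%:R in n0 *.
have E0 := edge_energy_ge0 D.
have -> : mean D1 - mean [seq x + unitv i *+ h | x <- D1] =
    (\sum_(x <- D1) (f x - f (x + unitv i *+ h))) / n.
  by rewrite /mean big_map size_map -mulrBl sumrB.
have K : \sum_(x <- D1) `|f (x + unitv i *+ h) - f x| `^ s <= h%:R `^ s * edge_energy D.
  apply: (@le_trans _ _ (\sum_(x <- D1) h%:R `^ (s - 1) * \sum_(j < h) `|grad i (x + unitv i *+ j)| `^ s)).
    by apply: ler_sum => x _; exact: telescope_powR.
  rewrite -mulr_sumr exchange_big /=.
  have [->|h0] := posnP h.
    by rewrite big_ord0 mulr0 mulr_ge0 ?powR_ge0.
  rewrite -(@mulr_powRB1 R h%:R s) ?ler0n // [h%:R * _]mulrC -mulrA ler_wpM2l ?powR_ge0 //.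
  apply: (@le_trans _ _ (\sum_(j < h) edge_energy D)); last first.
    by rewrite sumr_const card_ord mulr_natl.
  apply: ler_sum => j _.
  pose F y := if y + unitv i \in D then `|grad i y| `^ s else 0.
  apply: (@le_trans _ _ (\sum_(x <- D1) F (x + unitv i *+ j))).
    rewrite big_seq [leRHS]big_seq; apply: ler_sum => x xD.
    by rewrite /F -addrA -mulrSr hD.
  apply: (@le_trans _ _ (\sum_(x <- D) F x)).
    rewrite -(big_map (fun x => x + unitv i *+ j) xpredT F); apply: sum_sub.
    - by rewrite map_inj_uniq // => u v /addIr.
    - by move=> _ /mapP[x xD ->]; apply: hD => //; exact: ltnW.
    - by move=> x _; exact: edge_energy_term_ge0.
  apply: ler_sum => x _; rewrite (bigD1 i) //= lerDl.
  by apply: sumr_ge0 => k _; exact: edge_energy_term_ge0.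
rewrite normrM normfV (ger0_norm (ltW n0)) ler_pdivrMr //.
apply: (@le_trans _ _ (\sum_(x <- D1) `|f (x + unitv i *+ h) - f x|)).
  by apply: le_trans (ler_norm_sum _ _ _) _; apply: ler_sum => x _; rewrite distrC.
apply: (@le_trans _ _ ((n `^ (s - 1) * (h%:R `^ s * edge_energy D)) `^ s^-1)).
  apply: powR_le_inv => //.
  - by apply: sum_ge0.
  - by rewrite !mulr_ge0 ?powR_ge0.
  apply: le_trans (jensen_sum _ s1 _) _ => //.
  by rewrite ler_wpM2l ?powR_ge0.
have -> : n `^ (s - 1) * (h%:R `^ s * edge_energy D) = (n `^ (- s^-1) * n * h%:R) `^ s * edge_energy D.
  rewrite -[n in _ * n * _]powRr1 ?(ltW n0) // -powRD ?(gt_eqF n0) ?implybT //.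
  rewrite powRM ?powR_ge0 ?ler0n // -powRrM mulrA mulrDl mul1r mulNr mulVf ?gt_eqF //.
  by rewrite [s - 1]addrC.
rewrite powRM ?powR_ge0 // powRK ?gt_eqF //; last by rewrite !mulr_ge0 ?powR_ge0 ?ler0n ?ltW.
by rewrite [leRHS]mulrAC !mulrA.
Qed.

(** On each half f is compared with the mean of that half. The mean of the union is the midpoint of
    the two, so passing to it costs half their difference at each of the 2 n points, and
    [mean_shift_le] bounds that difference. *)
Lemma sobolev_double (T : R) (D1 : seq (lattice d)) (i : 'I_d) (h : nat) :
  let D2 := [seq x + unitv i *+ h | x <- D1] in
  let n := (size D1)%:R in
  0 <= T -> D1 != [::] -> uniq (D1 ++ D2) ->
  (forall x j, x \in D1 -> (j <= h)%N -> x + unitv i *+ j \in D1 ++ D2) ->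
  sobolev T D1 -> sobolev T D2 ->
  sobolev (T + (2 * n) `^ t^-1 * n `^ (- s^-1) * h%:R) (D1 ++ D2).
Proof.
move=> D2 n T0 D10 uD hD S1 S2.
set D := D1 ++ D2 in uD hD *.
have s0 : 0 < s by move: s1; lra.
have t0 : 0 < t by move: t1; lra.
have n0 : 0 < n by rewrite ltr0n lt0n size_eq0.
have uD1 : uniq D1 by move: uD; rewrite cat_uniq => /and3P[].
have dlt := mean_shift_le D10 uD1 uD hD; rewrite -/D2 -/n in dlt.
have E0 := edge_energy_ge0 D.
have mD : mean D = (mean D1 + mean D2) / 2.
  rewrite /mean big_cat size_cat size_map natrD -/n /=.
  by field; apply/andP; split; rewrite lt0r_neq0 ?addr_gt0.
pose m x := if x \in D1 then mean D1 else mean D2.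
pose dl := `|mean D1 - mean D2| / 2.
have dl0 : 0 <= dl by rewrite divr_ge0.
have mx x : `|m x - mean D| <= dl.
  rewrite /m mD /dl; case: ifP => _.
    by rewrite (_ : _ - _ = (mean D1 - mean D2) / 2) ?normrM ?normfV ?(ger0_norm (ler0n _ 2)) //; field.
  rewrite (_ : _ - _ = (mean D2 - mean D1) / 2); last by field.
  by rewrite normrM normfV (ger0_norm (ler0n _ 2)) distrC.
have sz : (size D)%:R = 2 * n :> R by rewrite size_cat size_map natrD -/n mulr2n mulrDl mul1r.
apply: powR_inv_le => //.
- by apply: sum_ge0 => x; exact: powR_ge0.
- by rewrite mulr_ge0 ?powR_ge0 // addr_ge0 ?mulr_ge0 ?powR_ge0 ?ler0n.
apply: (@le_trans _ _ ((\sum_(x <- D) (`|f x - m x| + dl) `^ t) `^ t^-1)).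
  apply: powRr_le; rewrite ?invr_ge0 ?(ltW t0) //.
    by apply: sum_ge0 => x; exact: powR_ge0.
  apply: ler_sum => x _; apply: powRr_le; rewrite ?(ltW t0) //.
  rewrite (_ : f x - _ = (f x - m x) + (m x - mean D)); last by ring.
  by apply: le_trans (ler_normD _ _) _; rewrite lerD2l.
apply: le_trans (@minkowski_sum R _ D (fun x => `|f x - m x|) (fun=> dl) t t1 _ _) _ => //.
rewrite mulrDl; apply: lerD.
  have -> : \sum_(x <- D) `|f x - m x| `^ t =
     \sum_(x <- D1) `|f x - mean D1| `^ t + \sum_(x <- D2) `|f x - mean D2| `^ t.
    rewrite big_cat /=; congr (_ + _); rewrite big_seq [RHS]big_seq; apply: eq_bigr => x xD.
      by rewrite /m xD.
    rewrite /m; case: ifP => // xD1; move: uD; rewrite cat_uniq => /and3P[_ /hasPn/(_ x xD)].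
    by rewrite /= xD1.
  apply: (@le_trans _ _ (((T * edge_energy D `^ s^-1) `^ t) `^ t^-1)); last first.
    by rewrite powRK ?gt_eqF // mulr_ge0 ?powR_ge0.
  apply: powRr_le; last by rewrite invr_ge0 (ltW t0).
    by apply: addr_ge0; apply: sum_ge0 => x; exact: powR_ge0.
  apply: le_trans (lerD S1 S2) _; clear S1 S2.
  rewrite !powRM ?powR_ge0 // -mulrDr ler_wpM2l ?powR_ge0 // -!powRrM.
  (* Here s <= t enters: the power t / s of the energy is superadditive, so the first term keeps the
     constant T. *)
  apply: le_trans (powR_superadd _ _ _) _; rewrite ?edge_energy_ge0 //.
    by rewrite mulrC ler_pdivlMr // mul1r.
  apply: powRr_le; rewrite ?addr_ge0 ?edge_energy_ge0 ?edge_energy_cat //.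
  by rewrite mulr_ge0 ?invr_ge0 ?ltW.
rewrite sum_const sz powRM ?mulr_ge0 ?powR_ge0 ?(ltW n0) // powRK ?gt_eqF //.
rewrite -!mulrA ler_wpM2l ?powR_ge0 //.
apply: le_trans dlt; rewrite /dl ler_pdivrMr // ler_peMr //; lra.
Qed.

End doubling.

Section dyadic_rectangles.
Context {R : realType} {d : nat}.
Implicit Types (a x y : lattice d) (l : 'I_d -> nat).

Lemma unitv_mulrn (i j : 'I_d) (h : nat) :
  (unitv i *+ h) 0 j = if i == j then h%:Z else 0.
Proof.
elim: h => [|h IH]; first by rewrite mulr0n mxE; case: ifP.
rewrite mulrSr latticeD IH unitvE; case: ifP => _ //; lia.
Qed.

Definition set_side l (i0 : 'I_d) (n : nat) : 'I_d -> nat :=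
  fun i => if i == i0 then n else l i.

Lemma perm_rect_double a l (i0 : 'I_d) :
  perm_eq (rect a l ++ [seq x + unitv i0 *+ l i0 | x <- rect a l])
          (rect a (set_side l i0 (2 * l i0))).
Proof.
have E x : (x \in [seq x + unitv i0 *+ l i0 | x <- rect a l]) =
           (x \in rect (a + unitv i0 *+ l i0) l).
  by rewrite -(perm_mem (rect_translate _ _ _)).
have inj : injective (fun x : lattice d => x + unitv i0 *+ l i0) by move=> u v /addIr.
have mem x : (x \in rect a l ++ [seq x + unitv i0 *+ l i0 | x <- rect a l]) =
    (x \in rect a (set_side l i0 (2 * l i0))).
  rewrite mem_cat E; apply/orP/mem_rectP => [[] /mem_rectP h i|h].
  - by have := h i; rewrite /set_side; case: eqP => [->|_]; lia.
  - have := h i; rewrite !latticeD unitv_mulrn /set_side eq_sym.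
    by case: eqP => [->|_]; lia.
  have [lt|ge] := ltP (x 0 i0) (a 0 i0 + (l i0)%:Z); [left|right]; apply/mem_rectP => i;
    have := h i; rewrite ?latticeD ?unitv_mulrn /set_side ?[i0 == i]eq_sym; case: eqP => [->|_]; lia.
apply: uniq_perm => //; last exact: uniq_rect.
rewrite cat_uniq uniq_rect map_inj_uniq // uniq_rect andbT /=.
apply/hasPn => x; rewrite E => /mem_rectP/(_ i0); rewrite latticeD unitv_mulrn eqxx => h1.
by apply/negP => /mem_rectP/(_ i0); lia.
Qed.

Variables (f : lattice d -> R) (s t : R).
Hypotheses (s1 : 1 <= s) (st : s <= t) (t1 : 1 < t).

Lemma sobolev_mono (T T' : R) D : 0 <= T -> T <= T' -> sobolev f s t T D -> sobolev f s t T' D.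
Proof.
move=> T0 TT' h; apply: le_trans h _; apply: powRr_le.
- by rewrite mulr_ge0 ?powR_ge0.
- by rewrite ler_wpM2r ?powR_ge0.
- by move: t1; lra.
Qed.

Lemma sobolev_rect_double (T : R) a l (i0 : 'I_d) :
  0 <= T -> (forall i, 0 < l i)%N -> (forall a, sobolev f s t T (rect a l)) ->
  sobolev f s t (T + (2 * (\prod_i l i)%:R) `^ t^-1 * (\prod_i l i)%:R `^ (- s^-1) * (l i0)%:R)
   (rect a (set_side l i0 (2 * l i0))).
Proof.
move=> T0 l0 H; apply: (perm_sobolev (perm_rect_double a l i0)).
rewrite -(size_rect a l).
have mem x : (x \in rect a l ++ [seq x + unitv i0 *+ l i0 | x <- rect a l]) =
    (x \in rect a (set_side l i0 (2 * l i0))).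
  exact: perm_mem (perm_rect_double a l i0) x.
apply: sobolev_double => //.
- by rewrite -size_eq0 size_rect -lt0n prodn_gt0.
- by rewrite (perm_uniq (perm_rect_double a l i0)) uniq_rect.
- move=> x j /mem_rectP xD jh; rewrite mem; apply/mem_rectP => i; have := xD i.
  rewrite latticeD unitv_mulrn /set_side eq_sym; case: eqP => [->|_]; lia.
- exact: perm_sobolev (rect_translate _ _ _) (H _).
Qed.

(** With #|I| = d this is a cube, with #|I| = d - 1 a cell on a face of a sphere; one proof of
    Sobolev's inequality covers both. *)
Definition dyadic_sides (I : {set 'I_d}) (k : nat) : 'I_d -> nat :=
  fun i => if i \in I then (2 ^ k)%N else 1%N.

Lemma prod_dyadic_sides I k : (\prod_i dyadic_sides I k i = 2 ^ (k * #|I|))%N.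
Proof. by rewrite -big_mkcond /= prod_nat_const expnM. Qed.

Lemma eq_rect a l l' : l =1 l' -> perm_eq (rect a l) (rect a l').
Proof.
move=> ll'; apply: uniq_perm; rewrite ?uniq_rect // => x.
by rewrite !mem_rect; apply: eq_forallb => i; rewrite ll'.
Qed.

(** The sides are doubled one after another, J being the directions already treated. With K = 2^k
    and m = #|I|, the intermediate volumes lie between K^m and (2 K)^m, so every doubling has the
    same bound on its cost. *)
Lemma sobolev_scale_up (I : {set 'I_d}) k (T : R) a : 0 <= T ->
  (forall a, sobolev f s t T (rect a (dyadic_sides I k))) ->
  sobolev f s t (T + #|I|%:R * (2 `^ ((1 + #|I|%:R) / t) *
     (2 ^+ k) `^ (1 + #|I|%:R / t - #|I|%:R / s)))
   (rect a (dyadic_sides I k.+1)).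
Proof.
move=> T0 H.
have s0 : 0 < s by move: s1; lra.
have t0 : 0 < t by move: t1; lra.
set c := 2 `^ _ * _.
have c0 : 0 <= c by rewrite mulr_ge0 ?powR_ge0.
pose l (J : seq 'I_d) i := if i \in J then (2 ^ k.+1)%N else dyadic_sides I k i.
have main (J : seq 'I_d) : uniq J -> {subset J <= I} -> forall a,
    sobolev f s t (T + (size J)%:R * c) (rect a (l J)).
  elim: J => [_ _ b|i0 J IH /= /andP[iJ uJ] sJ b]; first by rewrite mul0r addr0; exact: H.
  have i0I : i0 \in I by apply: sJ; rewrite mem_head.
  have {}IH := IH uJ (fun j h => sJ j (mem_behead (s := i0 :: J) h)).
  have li0 : l J i0 = (2 ^ k)%N by rewrite /l (negbTE iJ) /dyadic_sides i0I.
  have lpos i : (0 < l J i)%N by rewrite /l /dyadic_sides; case: ifP => _; [|case: ifP => _]; rewrite ?expn_gt0.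
  have lb : (2 ^ (k * #|I|) <= \prod_i l J i)%N.
    rewrite -prod_dyadic_sides; apply: leq_prod => i _; rewrite /l /dyadic_sides.
    have : (i \in J) -> i \in I by move=> h; apply: sJ; rewrite inE h orbT.
    case: (i \in J) => [/(_ isT) -> |_]; last by [].
    by rewrite leq_exp2l.
  have ub : (\prod_i l J i <= 2 ^ (k.+1 * #|I|))%N.
    rewrite -prod_dyadic_sides; apply: leq_prod => i _; rewrite /l /dyadic_sides.
    have : (i \in J) -> i \in I by move=> h; apply: sJ; rewrite inE h orbT.
    case: (i \in J) => [/(_ isT) -> //|_]; by case: ifP => // _; rewrite leq_exp2l.
  have E : set_side (l J) i0 (2 * l J i0) =1 l (i0 :: J).
    move=> i; rewrite /set_side li0 /l inE; case: eqP => //= _; by rewrite expnS.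
  apply: (perm_sobolev (eq_rect _ E)).
  apply: sobolev_mono (sobolev_rect_double _ _ _ lpos IH).
    by rewrite !addr_ge0 ?mulr_ge0 ?powR_ge0 ?ler0n.
  rewrite -(natr1 (size J)) [(_ + 1) * c]mulrDl mul1r addrA lerD2l li0.
  set n := (\prod_i l J i)%N in lb ub *.
  pose m : R := #|I|%:R; pose K : R := 2 ^+ k.
  have K0 : 0 < K by rewrite exprn_gt0.
  have nlb : K `^ m <= n%:R.
    by rewrite powR_mulrn ?(ltW K0) // -exprM -natrX ler_nat.
  have nub : n%:R <= 2 `^ m * K `^ m.
    by rewrite !powR_mulrn ?(ltW K0) // -exprM -exprD -natrX ler_nat -mulSn.
  have n0 : 0 < n%:R :> R by apply: lt_le_trans nlb; rewrite powR_gt0.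
  have A1 : (2 * n%:R) `^ t^-1 <= 2 `^ ((1 + m) / t) * K `^ (m / t).
    rewrite !powRrM -powRM ?powR_ge0 //; apply: powRr_le; rewrite ?mulr_ge0 ?invr_ge0 ?(ltW t0) ?(ltW n0) //.
    rewrite powRD ?pnatr_eq0 ?implybT // powRr1 // -mulrA ler_wpM2l //.
  have A2 : n%:R `^ (- s^-1) <= K `^ (- (m / s)).
    rewrite !powRN lef_pV2 ?posrE ?powR_gt0 // powRrM; apply: powRr_le => //.
    - exact: powR_ge0.
    - by rewrite invr_ge0 ltW.
  apply: (@le_trans _ _ (2 `^ ((1 + m) / t) * K `^ (m / t) * K `^ (- (m / s)) * K)).
    by rewrite natrX ler_wpM2r ?(ltW K0) // ler_pM ?powR_ge0.
  rewrite /c -/K -/m -!mulrA ler_wpM2l ?powR_ge0 //.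
  rewrite -[X in _ * (_ * X)]powRr1 ?(ltW K0) // -!powRD ?(gt_eqF K0) ?implybT //.
  by apply: eq_le_refl; congr (_ `^ _); ring.
  by rewrite addr_ge0 ?mulr_ge0 ?ler0n.
have E : l (enum I) =1 dyadic_sides I k.+1.
  by move=> i; rewrite /l /dyadic_sides mem_enum; case: (i \in I).
have := main (enum I) (enum_uniq _) _ a; rewrite -cardE => h.
by apply: (perm_sobolev (eq_rect _ E)); apply: h => i; rewrite mem_enum.
Qed.

End dyadic_rectangles.

(* Doubling one side at a time: each doubling costs the difference of two adjacent
   means, which telescopes; the costs sum geometrically as the exponent is positive. *)
Lemma sobolev_dyadic (R : realType) (d m : nat) (s t : R) :
  1 <= s -> s <= t -> 1 < t -> 0 < 1 + m%:R / t - m%:R / s ->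
  exists2 C : R, 0 <= C & forall (f : lattice d -> R) (I : {set 'I_d}) (k : nat) (a : lattice d),
    #|I| = m ->
    sobolev f s t (C * (2 ^+ k) `^ (1 + m%:R / t - m%:R / s)) (rect a (dyadic_sides I k)).
Proof.
move=> s1 st t1; set al := 1 + _ - _ => al0.
set c : R := m%:R * 2 `^ ((1 + m%:R) / t).
have c0 : 0 <= c by rewrite mulr_ge0 ?powR_ge0.
have p1 : 0 < 2 `^ al - 1 :> R.
  rewrite subr_gt0 -[ltLHS](powRr0 2); apply: (@lt_le_trans _ _ (2 `^ al)) => //.
  rewrite /powR pnatr_eq0 /= mul0r ltr_expR mulr_gt0 // ln_gt0 // ltr1n //.
(* The fixed point of the recursion, C 2^al = C + c: passing from side 2^k to 2^(k+1) reproduces the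
   constant. It is finite because al > 0. *)
exists (c / (2 `^ al - 1)); first by rewrite divr_ge0 // ltW.
move=> f I k a Im; elim: k a => [|k IH] a.
  rewrite expr0 powR1 mulr1 /sobolev.
  have : size (rect a (dyadic_sides I 0)) = 1%N.
    by rewrite size_rect prod_dyadic_sides mul0n expn0.
  case: (rect _ _) => // x [|] // _.
  by rewrite big_seq1 /mean big_seq1 divr1 subrr normr0 powR0 ?powR_ge0 // gt_eqF //; lra.
have := sobolev_scale_up s1 st t1 a _ IH; rewrite Im -/al => h.
have K0 : 0 <= (2 ^+ k : R) `^ al by exact: powR_ge0.
apply: sobolev_mono (h _) => //.
- rewrite addr_ge0 ?mulr_ge0 ?powR_ge0 ?invr_ge0 // ltW //.
- rewrite exprS powRM ?exprn_ge0 // [m%:R * _]mulrA -/c.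
  have {2}-> : c = c / (2 `^ al - 1) * (2 `^ al - 1) by rewrite divfK ?gt_eqF.
  by apply: eq_le_refl; ring.
- by rewrite mulr_ge0 // divr_ge0 // ltW.
Qed.

(** * Balls and spheres in the sup norm, and their coverings by dyadic cells *)

Section balls.
Context {d : nat}.
Implicit Types (x y : lattice d) (n : nat).

Definition supnorm x : nat := (\max_(i < d) absz (x 0 i)%R)%N.

Lemma supnorm_leP x n : reflect (forall i, `|x 0 i| <= n%:Z) (supnorm x <= n)%N.
Proof.
apply: (iffP (bigmax_leqP _ _ _)) => [h i|h i _]; first by have := h i isT; lia.
by have := h i; lia.
Qed.

Lemma supnorm_coord x i : `|x 0 i| <= (supnorm x)%:Z.
Proof. by move/supnorm_leP: (leqnn (supnorm x)). Qed.

Lemma supnormD x y : (supnorm (x + y)%R <= supnorm x + supnorm y)%N.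
Proof.
apply/supnorm_leP => i; rewrite latticeD.
by have := supnorm_coord x i; have := supnorm_coord y i; lia.
Qed.

Lemma supnormN x : supnorm (- x) = supnorm x.
Proof. by apply: eq_bigr => i _; rewrite mxE abszN. Qed.

Lemma supnorm_unitv i : (supnorm (unitv i) <= 1)%N.
Proof. by apply/supnorm_leP => j; rewrite unitvE; case: eqP. Qed.

Lemma supnorm0 : supnorm 0 = 0%N.
Proof. by apply/eqP; rewrite -leqn0; apply/supnorm_leP => i; rewrite mxE. Qed.

Definition zball n : seq (lattice d) :=
  rect (\row_i (- n%:Z)) (fun=> (2 * n).+1).

Lemma mem_zball n x : (x \in zball n) = (supnorm x <= n)%N.
Proof.
apply/mem_rectP/supnorm_leP => h i; have := h i; rewrite !mxE; lia.
Qed.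

Lemma uniq_zball n : uniq (zball n). Proof. exact: uniq_rect. Qed.

Lemma size_zball n : size (zball n) = ((2 * n).+1 ^ d)%N.
Proof. by rewrite size_rect prod_nat_const card_ord. Qed.

Definition zsphere n : seq (lattice d) := [seq x <- zball n | supnorm x == n].

Lemma mem_zsphere n x : (x \in zsphere n) = (supnorm x == n).
Proof. by rewrite mem_filter mem_zball; case: eqP => // ->; rewrite leqnn. Qed.

Lemma uniq_zsphere n : uniq (zsphere n). Proof. by rewrite filter_uniq // uniq_zball. Qed.

End balls.

Section covers.
Context {R : realType}.

Lemma sum_cover (T : eqType) (I : finType) (s : seq T) (t : I -> seq T) (F : T -> R) :
  uniq s -> (forall i, uniq (t i)) -> (forall x, 0 <= F x) ->
  (forall x, x \in s -> exists i, x \in t i) ->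
  \sum_(x <- s) F x <= \sum_i \sum_(x <- t i) F x.
Proof.
move=> us ut F0 h.
apply: (@le_trans _ _ (\sum_i \sum_(x <- s | x \in t i) F x)).
  under [leRHS]eq_bigr do rewrite big_mkcond.
  rewrite exchange_big /= big_seq [leRHS]big_seq; apply: ler_sum => x /h[i xi].
  by rewrite (bigD1 i) //= xi lerDl sumr_ge0 // => j _; case: ifP.
apply: ler_sum => i _; rewrite -big_filter; apply: sum_sub; rewrite ?filter_uniq //.
by move=> x; rewrite mem_filter => /andP[].
Qed.

Context {d : nat}.

(** Cells start at multiples of 2^n and are pushed back where they would leave the box, so they may
    overlap. Five per direction suffice for sides up to 5 2^n, which includes 2 rho + 1 for rho <= 2
    2^n. *)
Definition cover_corner (b : lattice d) (L : 'I_d -> nat) (J : {set 'I_d}) (n : nat)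
    (o : {ffun 'I_d -> 'I_5}) : lattice d :=
  b + \row_i (if i \in J then (minn (o i * 2 ^ n) (L i - 2 ^ n))%:Z else 0).

Variables (b : lattice d) (L : 'I_d -> nat) (J : {set 'I_d}) (n : nat).
Hypotheses (LJ : forall i, i \in J -> (2 ^ n <= L i <= 5 * 2 ^ n)%N)
  (LnJ : forall i, i \notin J -> L i = 1%N).

Lemma cover_sub o : {subset rect (cover_corner b L J n o) (dyadic_sides J n) <= rect b L}.
Proof.
move=> x /mem_rectP h; apply/mem_rectP => i; have := h i.
rewrite /dyadic_sides latticeD mxE; move: (x 0 i) (b 0 i) => xi bi.
case: ifP => [/LJ|/negbT/LnJ ->]; last lia.
by move: (o i * 2 ^ n)%N (L i) (2 ^ n)%N => u v w; lia.
Qed.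

Lemma cover_mem x : x \in rect b L ->
  exists o, x \in rect (cover_corner b L J n o) (dyadic_sides J n).
Proof.
move=> /mem_rectP h.
have r0 : (0 < 2 ^ n)%N by rewrite expn_gt0.
pose k i := (absz (x 0 i - b 0 i)%R %/ 2 ^ n)%N.
have k5 i : i \in J -> (k i < 5)%N.
  move=> /LJ Li; rewrite ltn_divLR //; have := h i.
  by move: (x 0 i) (b 0 i) Li; move: (2 ^ n)%N (L i) => u v xi bi Li; lia.
exists [ffun i => inord (k i)]; apply/mem_rectP => i; have := h i.
rewrite /dyadic_sides latticeD mxE ffunE; case: ifP => [iJ|/negbT/LnJ ->]; last lia.
rewrite inordK ?k5 //; have := LJ iJ.
have := divn_eq (absz (x 0 i - b 0 i)%R) (2 ^ n); rewrite -/(k i).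
have := ltn_pmod (absz (x 0 i - b 0 i)%R) r0.
move: (x 0 i) (b 0 i) => xi bi; move: (L i) (k i * 2 ^ n)%N (absz (xi - bi)%R %% 2 ^ n)%N (2 ^ n)%N => l u v w; lia.
Qed.

End covers.

Section local_inequalities.
Context {R : realType} {d : nat}.
Variables (s : R).
Hypotheses (s1 : 1 < s).

Lemma edge_energy_sub (v : lattice d -> R) (D B : seq (lattice d)) :
  uniq D -> uniq B -> {subset D <= B} -> edge_energy v s D <= edge_energy v s B.
Proof.
move=> uD uB DB.
apply: (@le_trans _ _ (\sum_(x <- D) \sum_i (if x + unitv i \in B then `|grad v i x| `^ s else 0))).
  apply: ler_sum => x _; apply: ler_sum => i _; case: ifP => [/DB ->//|_].
  exact: edge_energy_term_ge0.
by apply: sum_sub => // x _; apply: sumr_ge0 => i _; exact: edge_energy_term_ge0.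
Qed.

(** At the zeros of v, at least half of D, the deviation equals the mean. Hence the mean is itself
    controlled by the deviations, with a factor 2, and v <= |v - m| + m gives the total factor 3. *)
Lemma sum_powR_vanishing (v : lattice d -> R) (D : seq (lattice d)) :
  (forall x, 0 <= v x) -> (2 * count (fun x => 0 < v x)%R D <= size D)%N ->
  \sum_(x <- D) v x `^ s <= 2 `^ s * 3 * \sum_(x <- D) `|v x - mean v D| `^ s.
Proof.
move=> v0 cnt.
have s0 : 0 < s by move: s1; lra.
set m := mean v D; set O := \sum_(x <- D) `|_| `^ s.
have m0 : 0 <= m by rewrite divr_ge0 ?ler0n ?sum_ge0.
have O0 : 0 <= O by apply: sum_ge0 => x; exact: powR_ge0.
have K : (size D)%:R * m `^ s <= 2 * O.
  have cz : (size D <= 2 * count (fun x => ~~ (0 < v x))%R D)%N.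
    move: cnt; rewrite -(count_predC (fun x => 0 < v x)%R D) -[count (predC _) _]/(count (fun x => ~~ (0 < v x))%R D).
    by move: (count _ D) (count _ D) => a b; lia.
  apply: (@le_trans _ _ ((2 * count (fun x => ~~ (0 < v x))%R D)%:R * m `^ s)).
    by rewrite ler_wpM2r ?powR_ge0 // ler_nat.
  rewrite natrM -mulrA ler_wpM2l // -sum1_count natr_sum mulr_suml big_mkcond.
  apply: ler_sum => x _; case: ifP => [|_]; last exact: powR_ge0.
  rewrite -leNgt mul1r => vx; apply: powRr_le; rewrite ?(ltW s0) //.
  have -> : v x = 0 by apply/eqP; rewrite eq_le vx v0.
  by rewrite sub0r normrN ger0_norm.
apply: (@le_trans _ _ (2 `^ s * (O + \sum_(x <- D) m `^ s))).
  rewrite -big_split mulr_sumr /=; apply: ler_sum => x _.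
  apply: le_trans (powRD_le (ltW s0) _ m0) => //.
  apply: powRr_le; rewrite ?(ltW s0) //.
  by have := ler_norm (v x - m); lra.
rewrite sum_const -mulrA ler_wpM2l ?powR_ge0 //; lra.
Qed.

(* The support condition makes v vanish on half of every box of side 2^n, so that
   no mean has to be subtracted. *)
Lemma ball_poincare : exists2 C : R, 0 <= C & forall (v : lattice d -> R) (n rho : nat),
  (forall x, 0 <= v x) -> (2 ^ n <= rho <= 2 * 2 ^ n)%N ->
  (2 * count (fun x => 0 < v x)%R (zball rho) <= (2 ^ n) ^ d)%N ->
  \sum_(x <- zball rho) v x `^ s <= C * (2 ^+ n) `^ s * edge_energy v s (zball rho).
Proof.
have s0 : 0 < s by move: s1; lra.
have al : 1 + d%:R / s - d%:R / s = 1 by rewrite addrK.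
have [|C C0 HC] := @sobolev_dyadic R d d s s (ltW s1) (lexx _) s1; first by rewrite al.
exists ((5 ^ d)%:R * (2 `^ s * 3 * C `^ s)); first by rewrite !mulr_ge0 ?powR_ge0.
move=> v n rho v0 hrho cnt.
pose L : 'I_d -> nat := fun=> (2 * rho).+1.
pose J : {set 'I_d} := [set: 'I_d]%SET.
have cJ : #|J| = d by rewrite cardsT card_ord.
have LJ (i : 'I_d) : i \in J -> (2 ^ n <= L i <= 5 * 2 ^ n)%N.
  by move=> _; rewrite /L; have : (0 < 2 ^ n)%N by [rewrite expn_gt0]; lia.
have LnJ (i : 'I_d) : i \notin J -> L i = 1%N by rewrite inE.
apply: le_trans (@sum_cover R _ _ (zball rho)
  (fun o => rect (cover_corner (\row_i (- rho%:Z)) L J n o) (dyadic_sides J n)) _ _ _ _ _) _.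
- exact: uniq_zball.
- by move=> o; exact: uniq_rect.
- by move=> x; exact: powR_ge0.
- by move=> x; exact: cover_mem.
have card : (#|{: {ffun 'I_d -> 'I_5}}| = 5 ^ d)%N by rewrite card_ffun !card_ord.
rewrite -card -!mulrA mulr_natl -sumr_const; apply: ler_sum => o _.
set D := rect _ _.
have DB : {subset D <= zball rho} by exact: cover_sub.
have sD : size D = ((2 ^ n) ^ d)%N by rewrite size_rect prod_dyadic_sides cJ expnM.
apply: le_trans (sum_powR_vanishing v0 _) _.
  rewrite sD; apply: leq_trans cnt; rewrite leq_mul2l /= -!size_filter.
  apply: uniq_leq_size; first by rewrite filter_uniq // uniq_rect.
  by move=> x; rewrite !mem_filter => /andP[-> /DB].
rewrite -!mulrA ler_wpM2l ?powR_ge0 // ler_wpM2l //.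
have := HC v J n (cover_corner (\row_i (- rho%:Z)) L J n o) cJ.
rewrite al powRr1 ?exprn_ge0 // => h.
apply: le_trans h _; rewrite -/D.
rewrite !powRM ?powR_ge0 ?exprn_ge0 ?mulr_ge0 ?exprn_ge0 // -mulrA.
rewrite ler_wpM2l ?powR_ge0 // ler_wpM2l ?powR_ge0 //.
rewrite powRVK ?edge_energy_ge0 ?gt_eqF //.
by apply: edge_energy_sub; rewrite ?uniq_rect.
Qed.

(* The |grad v|^s + r^-s v^s density whose sum is a scale-invariant W^{1,s} norm. *)
Definition sob_density (v : lattice d -> R) (B : seq (lattice d)) (r : R) (x : lattice d) : R :=
  \sum_i (if x + unitv i \in B then `|grad v i x| `^ s else 0) + (v x / r) `^ s.

Lemma sob_density_ge0 v B r x : 0 <= sob_density v B r x.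
Proof.
by rewrite addr_ge0 ?powR_ge0 // sumr_ge0 // => i _; exact: edge_energy_term_ge0.
Qed.

(** No mean is subtracted here: Jensen's inequality bounds the mean through the zero-order term (v /
    r)^s of the density, which has the same scaling as the gradient term. *)
Lemma sum_powR_dyadic (t : R) (m : nat) : s <= t -> 0 < 1 + m%:R / t - m%:R / s ->
  exists2 C : R, 0 <= C & forall (v : lattice d -> R) (B : seq (lattice d)) (I : {set 'I_d}) n a,
  (forall x, 0 <= v x) -> #|I| = m -> {subset rect a (dyadic_sides I n) <= B} ->
  \sum_(x <- rect a (dyadic_sides I n)) v x `^ t <=
  (C * (2 ^+ n) `^ (1 + m%:R / t - m%:R / s) *
   (\sum_(x <- rect a (dyadic_sides I n)) sob_density v B (2 ^+ n) x) `^ s^-1) `^ t.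
Proof.
move=> st al0; have s0 : 0 < s by move: s1; lra.
have t1 : 1 < t by move: s1; lra.
have t0 : 0 < t by lra.
have [C C0 HC] := @sobolev_dyadic R d m s t (ltW s1) st t1 al0.
(* C is for the deviation from the mean, 1 for the mean itself. *)
exists (C + 1); first by rewrite addr_ge0.
move=> v B I n a v0 Im DB; set D := rect _ _ in DB *.
set al := 1 + _ - _ in al0 HC *.
set G := \sum_(x <- D) sob_density _ _ _ _.
set r : R := 2 ^+ n.
have r0 : 0 < r by rewrite exprn_gt0.
have G0 : 0 <= G by apply: sum_ge0 => x; exact: sob_density_ge0.
have sD : (size D)%:R = r `^ m%:R.
  by rewrite size_rect prod_dyadic_sides Im powR_mulrn ?(ltW r0) // natrX -exprM.
have n0 : 0 < (size D)%:R :> R by rewrite sD powR_gt0.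
have GE : edge_energy v s D <= G.
  apply: ler_sum => x _; rewrite -[leLHS]addr0; apply: lerD; last exact: powR_ge0.
  apply: ler_sum => i _; case: ifP => [/DB ->//|_]; exact: edge_energy_term_ge0.
have GV : \sum_(x <- D) v x `^ s <= r `^ s * G.
  rewrite mulr_sumr; apply: ler_sum => x _.
  rewrite mulrDr -powRM ?(ltW r0) ?divr_ge0 ?(ltW r0) // [r * _]mulrC divfK ?gt_eqF // lerDr.
  by rewrite mulr_ge0 ?powR_ge0 // sumr_ge0 // => i _; exact: edge_energy_term_ge0.
set M := mean v D.
have M0 : 0 <= M by rewrite divr_ge0 ?ler0n ?sum_ge0.
have ME : M <= (size D)%:R `^ (- s^-1) * (r * G `^ s^-1).
  rewrite /M /mean ler_pdivrMr //.
  apply: (@le_trans _ _ (((size D)%:R `^ (s - 1) * (r `^ s * G)) `^ s^-1)).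
    apply: powR_le_inv; rewrite ?sum_ge0 ?mulr_ge0 ?powR_ge0 //.
    by apply: le_trans (jensen_sum _ (ltW s1) v0) _; rewrite ler_wpM2l ?powR_ge0.
  rewrite !powRM ?mulr_ge0 ?powR_ge0 // powRK ?(ltW r0) ?gt_eqF // -powRrM.
  rewrite [leRHS]mulrAC ler_wpM2r ?mulr_ge0 ?powR_ge0 ?(ltW r0) //.
  rewrite -[X in _ <= _ * X]powRr1 ?(ltW n0) // -powRD ?(gt_eqF n0) ?implybT //.
  by rewrite mulrBl mul1r mulfV ?gt_eqF // addrC.
apply: powR_inv_le => //.
- by apply: sum_ge0 => x; exact: powR_ge0.
- by rewrite !mulr_ge0 ?powR_ge0 ?addr_ge0.
apply: (@le_trans _ _ ((\sum_(x <- D) (`|v x - M| + M) `^ t) `^ t^-1)).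
  apply: powRr_le; rewrite ?invr_ge0 ?(ltW t0) //.
    by apply: sum_ge0 => x; exact: powR_ge0.
  apply: ler_sum => x _; apply: powRr_le; rewrite ?(ltW t0) //.
  by have := ler_norm (v x - M); lra.
apply: le_trans (@minkowski_sum R _ D (fun x => `|v x - M|) (fun=> M) t t1 _ _) _ => //.
rewrite -mulrA mulrDl mul1r; apply: lerD.
  apply: (@le_trans _ _ (((C * r `^ al * edge_energy v s D `^ s^-1) `^ t) `^ t^-1)).
    apply: powRr_le; [|exact: (HC v I n a Im)|by rewrite invr_ge0 ltW].
    by apply: sum_ge0 => x; exact: powR_ge0.
  rewrite powRK ?gt_eqF ?mulr_ge0 ?powR_ge0 // -!mulrA ler_wpM2l // ler_wpM2l ?powR_ge0 //.
  by apply: powRr_le; rewrite ?edge_energy_ge0 // invr_ge0 ltW.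
rewrite sum_const powRM ?powR_ge0 ?(ltW n0) // powRK ?gt_eqF //.
apply: (@le_trans _ _ ((size D)%:R `^ t^-1 * ((size D)%:R `^ (- s^-1) * (r * G `^ s^-1)))).
  by rewrite ler_wpM2l ?powR_ge0.
rewrite !mulrA ler_wpM2r ?powR_ge0 // sD -!powRrM -[X in _ * X <= _]powRr1 ?(ltW r0) //.
rewrite -!powRD ?(gt_eqF r0) ?implybT //; apply: eq_le_refl; congr (_ `^ _); rewrite /al; ring.
Qed.

End local_inequalities.

(* A face of the sphere is a box of dimension d-1, whence the exponent. *)
Lemma sphere_sobolev (R : realType) (d : nat) (s t : R) :
  1 < s -> s <= t -> 0 < 1 + d.-1%:R / t - d.-1%:R / s ->
  exists2 C : R, 0 <= C & forall (v : lattice d -> R) (B : seq (lattice d)) (n tau : nat),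
  (forall x, 0 <= v x) -> (2 ^ n <= tau <= 2 * 2 ^ n)%N -> {subset zsphere tau <= B} ->
  \sum_(x <- zsphere tau) v x `^ t <=
  (C * (2 ^+ n) `^ (1 + d.-1%:R / t - d.-1%:R / s) *
   (\sum_(x <- zsphere tau) sob_density s v B (2 ^+ n) x) `^ s^-1) `^ t.
Proof.
move=> s1 st al0; have [C C0 HC] := @sum_powR_dyadic R d s s1 t d.-1 st al0.
have t0 : 0 < t by lra.
have s0 : 0 < s by lra.
(* An upper bound for the number of cells, indexed by a face and a position in it; its root of order
   t becomes the factor [Nc] in the sum of t-th powers. *)
pose Nc : R := #|{: ('I_d * bool) * {ffun 'I_d -> 'I_5}}|%:R.
exists (Nc `^ t^-1 * C); first by rewrite mulr_ge0 ?powR_ge0.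
move=> v B n tau v0 htau SB.
have r0 : (0 < 2 ^ n)%N by rewrite expn_gt0.
set al := 1 + _ - _ in al0 HC *.
set G := \sum_(x <- _) sob_density _ _ _ _ _.
have G0 : 0 <= G by apply: sum_ge0 => x; exact: sob_density_ge0.
(* The face f is the part of the sphere where the coordinate f.1 equals tau or -tau, according to
   f.2; it is a box of width 1 in the direction f.1. *)
pose L (f : 'I_d * bool) (i : 'I_d) : nat := if i == f.1 then 1%N else (2 * tau).+1.
pose b (f : 'I_d * bool) : lattice d :=
  \row_i (if (i == f.1) && f.2 then tau%:Z else - tau%:Z).
pose J (f : 'I_d * bool) : {set 'I_d} := (~: [set f.1])%SET.
have cJ f : #|J f| = d.-1 by rewrite cardsC1 card_ord.
have LJ f (i : 'I_d) : i \in J f -> (2 ^ n <= L f i <= 5 * 2 ^ n)%N.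
  by rewrite !inE /L => /negbTE ->; lia.
have LnJ f (i : 'I_d) : i \notin J f -> L f i = 1%N by rewrite !inE negbK /L => ->.
pose D (k : ('I_d * bool) * {ffun 'I_d -> 'I_5}) :=
  rect (cover_corner (b k.1) (L k.1) (J k.1) n k.2) (dyadic_sides (J k.1) n).
have faceS f : {subset rect (b f) (L f) <= zsphere tau}.
  move=> x /mem_rectP h; rewrite mem_zsphere eqn_leq; apply/andP; split.
    apply/supnorm_leP => i; have := h i; rewrite /b /L mxE; move: (x 0 i) => xi.
    by case: eqP => _; case: (f.2) => /=; lia.
  have := h f.1; rewrite /b /L mxE eqxx /=; have := supnorm_coord x f.1.
  by move: (x 0 f.1) => xi; case: (f.2); lia.
have DS k : {subset D k <= zsphere tau} by move=> x /(cover_sub (LJ k.1) (LnJ k.1)) /faceS.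
apply: le_trans (@sum_cover R _ _ (zsphere tau) D _ _ _ _ _) _.
- exact: uniq_zsphere.
- by move=> k; exact: uniq_rect.
- by move=> x; exact: powR_ge0.
- move=> x; rewrite mem_zsphere => /eqP xt.
  have [i0 hi0] : exists i0, absz (x 0 i0) = tau.
    apply: contrapT => hn.
    have : (supnorm x <= tau.-1)%N.
      apply/supnorm_leP => i; have := supnorm_coord x i; rewrite xt => h.
      have : absz (x 0 i) <> tau by move=> e; apply: hn; exists i.
      by move: (x 0 i) h => xi h; lia.
    by rewrite xt; lia.
  pose f := (i0, 0 <= x 0 i0).
  have xf : x \in rect (b f) (L f).
    apply/mem_rectP => i; rewrite /b /L mxE /=; have := supnorm_coord x i; rewrite xt.
    have [->|_] := eqVneq i i0; last by move: (x 0 i) => xi /=; lia.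
    by move: (x 0 i0) hi0 => xi; case: (leP 0 xi) => /= h1 h2 h3; lia.
  by have [k hk] := cover_mem (LJ f) (LnJ f) xf; exists (f, k).
rewrite !powRM ?mulr_ge0 ?powR_ge0 // powRVK ?ler0n ?gt_eqF // -!mulrA mulr_natl -sumr_const.
apply: ler_sum => k _; rewrite !mulrA -!powRM ?mulr_ge0 ?powR_ge0 //.
apply: le_trans (HC v B (J k.1) n _ v0 (cJ _) _) _; first by move=> x /DS /SB.
apply: powRr_le; rewrite ?mulr_ge0 ?powR_ge0 ?(ltW t0) //.
rewrite ler_wpM2l ?mulr_ge0 ?powR_ge0 //.
apply: powRr_le; rewrite ?invr_ge0 ?(ltW s0) //.
  by apply: sum_ge0 => x; exact: sob_density_ge0.
apply: sum_sub => //; first exact: uniq_rect.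
  exact: (DS k).
by move=> x _; exact: sob_density_ge0.
Qed.

(** * De Giorgi iteration for harmonic functions *)

Section caccioppoli.
Context {R : realType} {d : nat}.
Variable a : lattice d -> 'I_d -> R.
Hypothesis a0 : forall x i, 0 <= a x i.

(** The sum over the neighbours y of x of the conductance of {x, y} times u(y) - u(x). Conductances
    are stored at the lower end of an edge, hence the shift for the edges that arrive at x from
    below. *)
Definition generator (u : lattice d -> R) (x : lattice d) : R :=
  \sum_i (a x i * grad u i x - a (x - unitv i) i * grad u i (x - unitv i)).

Definition speed (x : lattice d) : R := \sum_i (a x i + a (x - unitv i) i).

Lemma speed_ge0 x : 0 <= speed x.
Proof. by apply: sumr_ge0 => i _; rewrite addr_ge0. Qed.

Lemma sum_zball_shift (g : lattice d -> R) n i : (forall x, g x != 0 -> (supnorm x <= n)%N) ->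
  \sum_(x <- zball n.+1) g (x + unitv i) = \sum_(x <- zball n.+1) g x.
Proof.
move=> hg; rewrite -(big_map (fun x => x + unitv i) xpredT g); apply: sum_supp_eq.
- by rewrite map_inj_uniq ?uniq_zball // => x y /addIr.
- exact: uniq_zball.
move=> x /hg xn; rewrite mem_zball (leq_trans xn) // andbT; apply/mapP.
exists (x - unitv i); last by rewrite subrK.
rewrite mem_zball (leq_trans (supnormD _ _)) // supnormN -addn1.
by rewrite leq_add // supnorm_unitv.
Qed.

(** The additional layer of radius n + 1 contains the lower end of every edge on which phi varies,
    so there are no boundary terms. *)
Lemma summation_by_parts (u phi : lattice d -> R) n :
  (forall x, phi x != 0 -> (supnorm x <= n)%N) ->
  \sum_(x <- zball n.+1) phi x * generator u x =
  - \sum_(x <- zball n.+1) \sum_i a x i * grad u i x * grad phi i x.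
Proof.
move=> hphi; rewrite [X in _ = - X]exchange_big /=.
under eq_bigr do rewrite mulr_sumr; rewrite exchange_big -sumrN /=; apply: eq_bigr => i _.
pose J x := a x i * grad u i x.
under eq_bigr do rewrite mulrBr -/(J _) -/(J (_ - _)).
rewrite big_split sumrN /= -(@sum_zball_shift (fun x => phi x * J (x - unitv i)) n i); last first.
  by move=> x; rewrite mulf_eq0 negb_or => /andP[/hphi].
rewrite -sumrB -sumrN; apply: eq_bigr => x _; rewrite addrK /J /grad; ring.
Qed.

(** U, W are the values of u at the ends of an edge and p, q those of the cut-off. If both U and W
    exceed k this is an identity; otherwise the difference of the two sides is a product with a
    definite sign. *)
Lemma caccioppoli_pointwise (U W k p q : R) :
  (q * Num.max (W - k) 0 - p * Num.max (U - k) 0) ^+ 2 -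
  (q - p) ^+ 2 * (Num.max (U - k) 0 * Num.max (W - k) 0) <=
  (W - U) * (q ^+ 2 * Num.max (W - k) 0 - p ^+ 2 * Num.max (U - k) 0).
Proof.
have [Wk|kW] := leP (W - k) 0; have [Uk|kU] := leP (U - k) 0.
- by rewrite !mulr0 !subr0 expr0n mulr0.
- rewrite !mulr0 sub0r sqrrN subr0 sub0r exprMn.
  have : p ^+ 2 * (U - k) * (W - k) <= 0 by rewrite mulr_ge0_le0 // mulr_ge0 ?sqr_ge0 // ltW.
  by nra.
- rewrite mulr0 mul0r mulr0 !subr0 exprMn.
  have : q ^+ 2 * (W - k) * (U - k) <= 0 by rewrite mulr_ge0_le0 // mulr_ge0 ?sqr_ge0 // ltW.
  by nra.
- by apply: eq_le_refl; ring.
Qed.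

(** The equation is tested with eta^2 v. On the right only edges on which the cut-off varies
    contribute, which is what allows the cut-off to select spheres. *)
Lemma caccioppoli (u eta : lattice d -> R) (k : R) n :
  let v x := Num.max (u x - k) 0 in
  (forall x, eta x != 0 -> (supnorm x <= n)%N) ->
  (forall x, (supnorm x <= n)%N -> generator u x = 0) ->
  \sum_(x <- zball n.+1) \sum_i a x i * (grad (fun y => eta y * v y) i x) ^+ 2 <=
  \sum_(x <- zball n.+1) \sum_i a x i * (grad eta i x) ^+ 2 * (v x * v (x + unitv i)).
Proof.
move=> v heta hu; pose phi x := eta x ^+ 2 * v x.
have hphi x : phi x != 0 -> (supnorm x <= n)%N.
  by move=> h; apply: heta; apply: contraNneq h => h; rewrite /phi h expr0n mul0r.
have S : \sum_(x <- zball n.+1) \sum_i a x i * grad u i x * grad phi i x = 0.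
  apply/eqP; rewrite -oppr_eq0 -summation_by_parts // big1 // => x _.
  have [->|/hphi/hu ->] := eqVneq (phi x) 0; by rewrite ?mul0r ?mulr0.
rewrite -subr_le0 -[leRHS]S -sumrB; apply: ler_sum => x _; rewrite -sumrB; apply: ler_sum => i _.
rewrite -!mulrA -mulrBr ler_wpM2l //.
apply: le_trans (caccioppoli_pointwise _ _ k _ _).
by apply: eq_le_refl; rewrite /v /grad; ring.
Qed.

Variables (rho sigma : nat) (G : seq nat).
Hypotheses (uG : uniq G) (G0 : G != [::]) (hG : forall g, g \in G -> (rho <= g < sigma)%N).

(* Radial, with slope 1 / |G| across the spheres of radius in G only. *)
Definition cutoff (x : lattice d) : R :=
  (count (fun g => (supnorm x <= g)%N) G)%:R / (size G)%:R.

Lemma size_G_gt0 : 0 < (size G)%:R :> R.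
Proof. by rewrite ltr0n lt0n size_eq0. Qed.

Lemma cutoff1 x : (supnorm x <= rho)%N -> cutoff x = 1.
Proof.
move=> xr; rewrite /cutoff; have /eqP -> : count (fun g => (supnorm x <= g)%N) G == size G.
  by rewrite -all_count; apply/allP => g /hG/andP[h _]; exact: leq_trans h.
by rewrite divff // gt_eqF // size_G_gt0.
Qed.

Lemma cutoff0 x : (sigma <= supnorm x)%N -> cutoff x = 0.
Proof.
move=> xr; rewrite /cutoff; have /eqP -> : count (fun g => (supnorm x <= g)%N) G == 0%N.
  rewrite -leqn0 leqNgt -has_count; apply/hasPn => g /hG/andP[_ h].
  by rewrite -ltnNge (leq_trans h).
by rewrite mul0r.
Qed.

(** The number of jumps of the cut-off, from a sphere g in G to the sphere g + 1, for which x lies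
    on one of these two spheres. *)
Definition radial_mult (x : lattice d) : nat :=
  count (fun g => supnorm x == g) G + count (fun g => supnorm x == g.+1) G.

Lemma count_step (m : nat) :
  (count (fun g => m <= g)%N G = count (fun g => m == g) G + count (fun g => m.+1 <= g)%N G)%N.
Proof.
rewrite -count_predUI [X in (_ + X)%N](_ : _ = 0%N) ?addn0.
  by apply: eq_count => g /=; rewrite leq_eqVlt.
by apply/eqP; rewrite -leqn0 leqNgt -has_count; apply/hasPn => g _ /=; case: ltngtP.
Qed.

Lemma count_eq_le1 (m : nat) : (count (fun g => m == g) G <= 1)%N.
Proof.
rewrite (eq_count (a2 := pred1 m)); first by rewrite count_uniq_mem // leq_b1.
by move=> g /=; rewrite eq_sym.
Qed.

(** Between neighbours the norm changes by at most one, so the count in [cutoff] changes by 0 or 1,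
    which equals its own square. *)
Lemma grad_cutoff_aux x y : (supnorm x <= (supnorm y).+1)%N -> (supnorm y <= (supnorm x).+1)%N ->
  (cutoff y - cutoff x) ^+ 2 <= (size G)%:R ^- 2 * (radial_mult x)%:R.
Proof.
move=> xy yx; have N0 := size_G_gt0.
have sq1 (c : nat) : (c <= 1)%N -> (c%:R : R) ^+ 2 = c%:R by case: c => [|[|]] // _; rewrite ?expr0n ?expr1n.
rewrite /cutoff -mulrBl exprMn exprVn mulrC ler_wpM2l ?invr_ge0 ?exprn_ge0 ?(ltW N0) //.
rewrite /radial_mult.
have [e|ne] := eqVneq (supnorm x) (supnorm y); first by rewrite e subrr expr0n ler0n.
have [e|e] : supnorm y = (supnorm x).+1 \/ supnorm x = (supnorm y).+1 by move/eqP: ne; lia.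
  rewrite e (count_step (supnorm x)) natrD opprD addrCA subrr addr0 sqrrN sq1 ?count_eq_le1 //.
  by rewrite ler_nat leq_addr.
rewrite e (count_step (supnorm y)) natrD addrK sq1 ?count_eq_le1 //.
by rewrite ler_nat (eq_count (a2 := fun g => (supnorm y).+1 == g.+1)) ?leq_addl.
Qed.

Lemma supnorm_step (x : lattice d) i : (supnorm x <= (supnorm (x + unitv i)).+1)%N /\
   (supnorm (x + unitv i) <= (supnorm x).+1)%N.
Proof.
split; last by rewrite -[X in (_ <= X)%N]addn1 (leq_trans (supnormD _ _)) // leq_add // supnorm_unitv.
have {1}-> : x = (x + unitv i) + - unitv i by rewrite addrK.
by rewrite -[X in (_ <= X)%N]addn1 (leq_trans (supnormD _ _)) // supnormN leq_add // supnorm_unitv.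
Qed.

Lemma radial_mult_supp (x : lattice d) : radial_mult x != 0%N -> (supnorm x <= sigma)%N.
Proof.
apply: contraR; rewrite -ltnNge => h; rewrite /radial_mult addn_eq0; apply/andP; split;
  rewrite -leqn0 leqNgt -has_count; apply/hasPn => g /hG; lia.
Qed.

Lemma sum_zsphereE (F : lattice d -> R) (tau n : nat) : (tau <= n)%N ->
  \sum_(x <- zball n) (supnorm x == tau)%:R * F x = \sum_(x <- zsphere tau) F x.
Proof.
move=> tn; have -> : \sum_(x <- zball n) (supnorm x == tau)%:R * F x =
    \sum_(x <- [seq x <- zball n | supnorm x == tau]) F x.
  rewrite big_filter [RHS]big_mkcond; apply: eq_bigr => x _.
  by case: eqP => _; rewrite ?mul1r ?mul0r.
apply: perm_big; apply: uniq_perm; rewrite ?uniq_zsphere ?filter_uniq ?uniq_zball // => x.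
by rewrite mem_zsphere mem_filter mem_zball; case: eqP => // ->.
Qed.

Lemma sum_radial_mult (F : lattice d -> R) :
  \sum_(x <- zball sigma) (radial_mult x)%:R * F x =
  \sum_(g <- G) (\sum_(x <- zsphere g) F x + \sum_(x <- zsphere g.+1) F x).
Proof.
have cnt (P : pred nat) : (count P G)%:R = \sum_(g <- G) (P g)%:R :> R.
  by rewrite -sum1_count natr_sum [LHS]big_mkcond; apply: eq_bigr => g _; case: (P g).
under eq_bigr do rewrite natrD !cnt -big_split mulr_suml.
rewrite exchange_big big_seq [RHS]big_seq; apply: eq_bigr => g /hG/andP[_ gs] /=.
under eq_bigr do rewrite mulrDl.
by rewrite big_split /= !sum_zsphereE // ltnW.
Qed.

(** The product of the two values of v is at most half the sum of the squares. Both ends of an edge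
    on which the cut-off jumps have positive multiplicity, so each square is charged to its own end,
    and the conductances around a vertex add up to [speed]. *)
Lemma cutoff_energy (v : lattice d -> R) : (forall x, 0 <= v x) -> (0 < sigma)%N ->
  \sum_(x <- zball sigma) \sum_i a x i * (grad cutoff i x) ^+ 2 * (v x * v (x + unitv i)) <=
  2^-1 * (size G)%:R ^- 2 * \sum_(g <- G) (\sum_(x <- zsphere g) speed x * v x ^+ 2 +
     \sum_(x <- zsphere g.+1) speed x * v x ^+ 2).
Proof.
move=> v0 s0; set N2 := (size G)%:R ^- 2.
have N20 : 0 <= N2 by rewrite invr_ge0 exprn_ge0.
pose F x : R := (radial_mult x)%:R * v x ^+ 2.
have F0 x : 0 <= F x by rewrite mulr_ge0 ?sqr_ge0.
apply: (@le_trans _ _ (\sum_(x <- zball sigma) \sum_i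
   2^-1 * N2 * (a x i * F x + a x i * F (x + unitv i)))).
  apply: ler_sum => x _; apply: ler_sum => i _.
  rewrite [leRHS](_ : _ = a x i * (2^-1 * N2 * (F x + F (x + unitv i)))); last by ring.
  rewrite -[leLHS]mulrA ler_wpM2l //.
  have [h1 h2] := supnorm_step x i.
  have g1 : (grad cutoff i x) ^+ 2 <= N2 * (radial_mult x)%:R by exact: grad_cutoff_aux.
  have g2 : (grad cutoff i x) ^+ 2 <= N2 * (radial_mult (x + unitv i))%:R.
    by rewrite /grad -sqrrN opprB; exact: grad_cutoff_aux.
  apply: (@le_trans _ _ ((grad cutoff i x) ^+ 2 * (2^-1 * (v x ^+ 2 + v (x + unitv i) ^+ 2)))).
    rewrite ler_wpM2l ?sqr_ge0 //; have := sqr_ge0 (v x - v (x + unitv i)); rewrite sqrrB; lra.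
  rewrite /F; have k1 := ler_wpM2r (sqr_ge0 (v x)) g1.
  have k2 := ler_wpM2r (sqr_ge0 (v (x + unitv i))) g2.
  by move: k1 k2; rewrite -!mulrA; lra.
under eq_bigr do rewrite -mulr_sumr; rewrite -mulr_sumr ler_wpM2l ?mulr_ge0 ?invr_ge0 //.
under eq_bigr do rewrite big_split; rewrite big_split /=.
rewrite -sum_radial_mult.
have -> : \sum_(x <- zball sigma) (radial_mult x)%:R * (speed x * v x ^+ 2) =
   \sum_(x <- zball sigma) \sum_i a x i * F x +
   \sum_(x <- zball sigma) \sum_i a (x - unitv i) i * F x.
  rewrite -big_split; apply: eq_bigr => x _ /=; rewrite -big_split mulrCA mulr_suml.
  by apply: eq_bigr => i _; rewrite /= mulrDl.
rewrite lerD2l exchange_big [leRHS]exchange_big; apply: ler_sum => i _ /=.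
pose g x := a (x - unitv i) i * F x.
have g0 x : 0 <= g x by rewrite mulr_ge0.
have gs x : g x != 0 -> (supnorm x <= sigma)%N.
  by rewrite !mulf_eq0 !negb_or pnatr_eq0 => /andP[_ /andP[/radial_mult_supp]].
apply: (@le_trans _ _ (\sum_(x <- zball sigma.+1) g (x + unitv i))).
  under [leRHS]eq_bigr do rewrite /g addrK.
  apply: sum_sub; first exact: uniq_zball.
    by move=> x; rewrite !mem_zball => h; rewrite ltnW.
  by move=> x _; rewrite mulr_ge0.
rewrite (sum_zball_shift i gs) /g; apply: eq_le_refl; apply: sum_supp_eq; rewrite ?uniq_zball // => x.
by move=> /gs h; rewrite !mem_zball h ltnW.
Qed.

(** The cut-off is 1 up to radius rho, where its product with v has the gradient of v, and 0 from
    radius sigma on, so that harmonicity strictly inside sigma is enough. *)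
Lemma energy_le (u : lattice d -> R) (k : R) :
  let v x := Num.max (u x - k) 0 in (0 < sigma)%N ->
  (forall x, (supnorm x < sigma)%N -> generator u x = 0) ->
  \sum_(x <- zball rho) \sum_i (if x + unitv i \in zball rho then a x i * (grad v i x) ^+ 2 else 0) <=
  2^-1 * (size G)%:R ^- 2 * \sum_(g <- G) (\sum_(x <- zsphere g) speed x * v x ^+ 2 +
     \sum_(x <- zsphere g.+1) speed x * v x ^+ 2).
Proof.
move=> v s0 hu.
have v0 x : 0 <= v x by rewrite /v le_max lexx orbT.
have rs : (rho <= sigma)%N.
  by case: (G) G0 hG => // g G' _ /(_ g (mem_head _ _)) /andP[h1 h2]; rewrite ltnW // (leq_ltn_trans h1).
apply: le_trans (cutoff_energy v0 s0).
have h1 x : cutoff x != 0 -> (supnorm x <= sigma.-1)%N.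
  by apply: contraR; rewrite -ltnNge prednK // => /cutoff0 ->.
have h2 x : (supnorm x <= sigma.-1)%N -> generator u x = 0.
  by move=> h; apply: hu; rewrite -(prednK s0).
have := caccioppoli k h1 h2; rewrite (prednK s0); apply: le_trans.
apply: (@le_trans _ _ (\sum_(x <- zball rho) \sum_i a x i * (grad (fun y => cutoff y * v y) i x) ^+ 2)).
  rewrite big_seq [leRHS]big_seq; apply: ler_sum => x; rewrite mem_zball => xr.
  apply: ler_sum => i _; case: ifP; last by rewrite mulr_ge0 ?sqr_ge0.
  by rewrite mem_zball => yr; rewrite /grad !cutoff1 // !mul1r.
apply: sum_sub; first exact: uniq_zball.
  by move=> x; rewrite !mem_zball => h; exact: leq_trans rs.
by move=> x _; apply: sumr_ge0 => i _; rewrite mulr_ge0 ?sqr_ge0.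
Qed.

End caccioppoli.

(** * Good spheres and the energy on a smaller ball *)

Section pigeonhole.
Context {R : realType}.

(** Markov's inequality with four times the average as threshold: two such conditions together
    exclude at most half of the indices. The strict inequality keeps the case A = 0 true. *)
Lemma markov_count (s : seq nat) (f : nat -> R) (A : R) :
  (forall x, 0 <= f x) -> \sum_(x <- s) f x <= A ->
  (4 * count (fun x => 4 * A / (size s)%:R < f x)%R s <= size s)%N.
Proof.
move=> f0 fA; set P := (fun x => _); set N := (size s)%:R in P *.
have A0 : 0 <= A by apply: le_trans fA; exact: sum_ge0.
have [->//|cnt0] := posnP (count P s).
have N0 : 0 < N by rewrite ltr0n (leq_trans cnt0) // count_size.
have K : \sum_(x <- s | P x) f x <= A.
  apply: le_trans fA; rewrite [leRHS](bigID P) /= lerDl; exact: sumr_ge0.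
have K2 : (count P s)%:R * (4 * A / N) <= \sum_(x <- s | P x) f x.
  rewrite -sum1_count natr_sum mulr_suml; apply: ler_sum => x Px; rewrite mul1r; exact: ltW.
have [A00|An] := eqVneq A 0.
  move: cnt0; rewrite -has_count => /hasP[x xs]; rewrite /P A00 mulr0 mul0r => fx.
  have : f x <= 0 by rewrite -A00; apply: le_trans fA; rewrite (big_rem x) //= lerDl; exact: sum_ge0.
  by rewrite leNgt fx.
have Ap : 0 < A by rewrite lt_def An.
rewrite -(ler_nat R) natrM.
have := le_trans K2 K; rewrite [4 * A]mulrC -!mulrA mulrCA ger_pMr // !mulrA ler_pdivrMr // mul1r.
by rewrite [_ * 4]mulrC.
Qed.

Lemma good_indices (s : seq nat) (f g : nat -> R) (A B : R) :
  (forall x, 0 <= f x) -> (forall x, 0 <= g x) ->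
  \sum_(x <- s) f x <= A -> \sum_(x <- s) g x <= B ->
  (size s <= 2 * size [seq x <- s | ((f x <= 4 * A / (size s)%:R) && (g x <= 4 * B / (size s)%:R))%R])%N.
Proof.
move=> f0 g0 /(markov_count f0) h1 /(markov_count g0) h2.
rewrite size_filter; set P1 := (fun x => _ < f x) in h1; set P2 := (fun x => _ < g x) in h2.
set P := (fun x => _ && _).
have := count_predC P s.
have : (count (predC P) s <= count P1 s + count P2 s)%N.
  rewrite -count_predUI; apply: leq_trans (leq_addr _ _); apply: sub_count => x /=.
  by rewrite /P /P1 /P2 negb_and -!ltNge.
by move: h1 h2; move: (count _ s) (count _ s) (count _ s) (count _ s) (size s) => a b c e N; lia.
Qed.

(** Hölder twice: f against the rest, then g against h with the weights y / (1 - x) and z / (1 -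
    x). *)
Lemma hoelder3_sum (T : eqType) (s : seq T) (f g h : T -> R) (x y z : R) :
  0 < x -> 0 < y -> 0 < z -> x + y + z = 1 ->
  (forall i, 0 <= f i) -> (forall i, 0 <= g i) -> (forall i, 0 <= h i) ->
  \sum_(i <- s) f i `^ x * g i `^ y * h i `^ z <=
  (\sum_(i <- s) f i) `^ x * (\sum_(i <- s) g i) `^ y * (\sum_(i <- s) h i) `^ z.
Proof.
move=> x0 y0 z0 xyz f0 g0 h0.
have x1 : 0 < 1 - x by lra.
have x1n : 1 - x != 0 by rewrite gt_eqF.
pose l := y / (1 - x).
have l1 : 1 - l = z / (1 - x) by have -> : z = 1 - x - y by [lra]; rewrite /l [in RHS]mulrBl divff.
have ly : l * (1 - x) = y by rewrite /l divfK.
have lz : (1 - l) * (1 - x) = z by rewrite l1 divfK.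
have l01 : 0 < l < 1.
  by rewrite divr_gt0 //= ltr_pdivrMr // mul1r; lra.
have x01 : 0 < x < 1 by apply/andP; split; lra.
have := @hoelder_sum R T s f (fun i => g i `^ l * h i `^ (1 - l)) x x01 f0
  (fun i => mulr_ge0 (powR_ge0 _ _) (powR_ge0 _ _)).
under eq_bigr do rewrite powRM ?powR_ge0 // -!powRrM ly lz mulrA.
move=> H; apply: le_trans H _; rewrite -mulrA ler_wpM2l ?powR_ge0 //.
rewrite -ly -lz (powRrM _ l) (powRrM _ (1 - l)) -powRM ?powR_ge0 //.
apply: powRr_le; rewrite ?(ltW x1) //.
  by apply: sum_ge0 => i; rewrite mulr_ge0 ?powR_ge0.
exact: (hoelder_sum s l01 g0 h0).
Qed.

End pigeonhole.

Section energy_step.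
Context {R : realType} {d : nat}.
Hypothesis d0 : (0 < d)%N.

Lemma sum_zspheres (F : lattice d -> R) (rho N n : nat) : (forall x, 0 <= F x) ->
  (rho + N <= n.+1)%N ->
  \sum_(g <- iota rho N) \sum_(x <- zsphere g) F x <= \sum_(x <- zball n) F x.
Proof.
move=> F0 h.
have -> : \sum_(g <- iota rho N) \sum_(x <- zsphere g) F x =
   \sum_(g <- iota rho N) \sum_(x <- zball n) (supnorm x == g)%:R * F x.
  rewrite big_seq [RHS]big_seq; apply: eq_bigr => g; rewrite mem_iota => hg.
  by rewrite sum_zsphereE //; lia.
rewrite exchange_big; apply: ler_sum => x _ /=; rewrite -mulr_suml ler_piMl //.
have -> : \sum_(g <- iota rho N) (supnorm x == g)%:R = (count (pred1 (supnorm x)) (iota rho N))%:R :> R.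
  by rewrite -sum1_count natr_sum [RHS]big_mkcond; apply: eq_bigr => g _ /=; rewrite eq_sym; case: eqP.
by rewrite count_uniq_mem ?iota_uniq // lern1 leq_b1.
Qed.

(** By [tp], v in L^t and the speed in L^p bound the sum of speed times v^2 by Hölder; [al0] is the
    subcritical Sobolev condition in dimension d - 1. *)
Variables (p s t : R).
Hypotheses (p1 : 1 < p) (s1 : 1 < s) (st : s <= t) (tp : t * (1 - p^-1) = 2)
  (al0 : 0 < 1 + d.-1%:R / t - d.-1%:R / s).

(* At least half of the 2^j spheres between rho and sigma carry at most four times the
   average of speed^p and of the Sobolev density; the cut-off decreases only there, where
   Hoelder and the (d-1)-dimensional Sobolev inequality apply. *)
Lemma energy_step : exists2 C : R, 0 <= C &
  forall (a : lattice d -> 'I_d -> R) (u : lattice d -> R) (k M Bd : R) (n j rho : nat),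
  let v x := Num.max (u x - k) 0 in
  let sigma := (rho + 2 ^ j)%N in
  let r : R := 2 ^+ n in
  (forall x i, 0 <= a x i) -> 0 <= M -> 0 <= Bd -> (j <= n)%N ->
  (2 ^ n <= rho)%N -> (sigma <= 2 * 2 ^ n)%N ->
  (forall x, (supnorm x < sigma)%N -> generator a u x = 0) ->
  \sum_(x <- zball sigma) speed a x `^ p <= M * r ^+ d ->
  \sum_(x <- zball sigma) sob_density s v (zball sigma) r x <= Bd * r ^+ d ->
  \sum_(x <- zball rho) \sum_i
     (if x + unitv i \in zball rho then a x i * (grad v i x) ^+ 2 else 0) <=
  C * (2 ^+ (n - j)) `^ (1 + p^-1 + 2 / s) * M `^ p^-1 * Bd `^ (2 / s) * r ^+ d.
Proof.
have [C C0 HC] := sphere_sobolev s1 st al0; set al := 1 + _ - _ in HC.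
have s0 : 0 < s by move: s1; lra.
have p0 : 0 < p by move: p1; lra.
have t0 : 0 < t by move: st; lra.
exists (2 * 8 `^ p^-1 * C ^+ 2 * 8 `^ (2 / s)); first by rewrite !mulr_ge0 ?powR_ge0 ?exprn_ge0.
move=> a u k M Bd n j rho v sigma r a0 M0 Bd0 jn rrho sig hu HM HB.
set E := (X in X <= _).
have v0 x : 0 <= v x by rewrite /v le_max lexx orbT.
have r0 : 0 < r by rewrite exprn_gt0.
set be : R := 2 ^+ (n - j).
have be0 : 0 < be by rewrite exprn_gt0.
have Nr : (2 ^ j)%:R = r / be :> R.
  by rewrite natrX /r /be -{1}(subnKC jn) exprD mulfK // gt_eqF.
have N0 : (0 < 2 ^ j)%N by rewrite expn_gt0.
pose m := d.-1.
have rd : r ^+ d = r * r ^+ m by rewrite -exprS prednK.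
pose aa tau := \sum_(x <- zsphere tau) speed a x `^ p.
pose bb tau := \sum_(x <- zsphere tau) sob_density s v (zball sigma) r x.
have aa0 tau : 0 <= aa tau by apply: sum_ge0 => x; exact: powR_ge0.
have bb0 tau : 0 <= bb tau by apply: sum_ge0 => x; exact: sob_density_ge0.
pose S := iota rho (2 ^ j).
have sS : size S = (2 ^ j)%N by rewrite size_iota.
have two (F : lattice d -> R) (Q : R) : (forall x, 0 <= F x) -> \sum_(x <- zball sigma) F x <= Q ->
   \sum_(g <- S) (\sum_(x <- zsphere g) F x + \sum_(x <- zsphere g.+1) F x) <= 2 * Q.
  move=> F0 FQ; rewrite big_split mulrDl mul1r /=; apply: lerD; apply: le_trans FQ.
    by apply: sum_zspheres.
  have -> : \sum_(g <- S) \sum_(x <- zsphere g.+1) F x =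
      \sum_(g <- iota (1 + rho) (2 ^ j)) \sum_(x <- zsphere g) F x by rewrite iotaDl big_map.
  by apply: sum_zspheres.
have SA : \sum_(g <- S) (aa g + aa g.+1) <= 2 * (M * r ^+ d).
  exact: (two (fun x => speed a x `^ p) _ (fun x => powR_ge0 _ _) HM).
have SB : \sum_(g <- S) (bb g + bb g.+1) <= 2 * (Bd * r ^+ d).
  exact: (two (sob_density s v (zball sigma) r) _ (sob_density_ge0 _ _ _ _) HB).
set G := [seq g <- S | ((aa g + aa g.+1 <= 4 * (2 * (M * r ^+ d)) / (size S)%:R) &&
   (bb g + bb g.+1 <= 4 * (2 * (Bd * r ^+ d)) / (size S)%:R))%R].
have sG : (2 ^ j <= 2 * size G)%N.
  have aa2 g : 0 <= aa g + aa g.+1 by rewrite addr_ge0.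
  have bb2 g : 0 <= bb g + bb g.+1 by rewrite addr_ge0.
  have := good_indices aa2 bb2 SA SB; rewrite -/G {1}sS; exact.
have G0 : G != [::].
  rewrite -size_eq0 -lt0n; have := leq_trans N0 sG.
  by rewrite muln_gt0 => /andP[].
have uG : uniq G by rewrite filter_uniq // iota_uniq.
have hG g : g \in G -> (rho <= g < sigma)%N by rewrite mem_filter mem_iota => /andP[].
have sig0 : (0 < sigma)%N by rewrite /sigma addn_gt0 N0 orbT.
(* The 8 is 2 for the pair of spheres g, g + 1, times 4 from Markov's inequality. Averaging r^d over
   the r / be spheres leaves be r^(d-1). *)
pose Am : R := 8 * M * be * r ^+ m; pose Bm : R := 8 * Bd * be * r ^+ m.
have Am0 : 0 <= Am by rewrite !mulr_ge0 ?exprn_ge0 ?(ltW be0) ?(ltW r0).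
have Bm0 : 0 <= Bm by rewrite !mulr_ge0 ?exprn_ge0 ?(ltW be0) ?(ltW r0).
have level (Q : R) : 4 * (2 * (Q * r ^+ d)) / (size S)%:R = 8 * Q * be * r ^+ m.
  rewrite sS Nr rd; field; by rewrite !gt_eqF.
pose W : R := Am `^ p^-1 * (C * r `^ al * Bm `^ s^-1) ^+ 2.
have W0 : 0 <= W by rewrite mulr_ge0 ?powR_ge0 ?sqr_ge0.
have sphW tau : (2 ^ n <= tau)%N -> (tau <= sigma)%N -> aa tau <= Am -> bb tau <= Bm ->
    \sum_(x <- zsphere tau) speed a x * v x ^+ 2 <= W.
  move=> t1 t2 hA hB.
  have pp : 0 < p^-1 < 1 by rewrite invr_gt0 p0 invf_lt1.
  have := @hoelder_sum R _ (zsphere tau) (fun x => speed a x `^ p) (fun x => v x `^ t) _ pp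
    (fun x => powR_ge0 _ _) (fun x => powR_ge0 _ _).
  under eq_bigr => x _ do rewrite powRK ?gt_eqF ?speed_ge0 // -powRrM tp powR_mulrn //.
  move=> H; apply: le_trans H _; apply: ler_pM; rewrite ?powR_ge0 //.
    by apply: powRr_le; rewrite ?aa0 ?invr_ge0 ?(ltW p0).
  rewrite -[(_ * _ * _) ^+ 2]powR_mulrn; last by rewrite !mulr_ge0 ?powR_ge0.
  rewrite -tp powRrM; apply: powRr_le; last by lra.
    by apply: sum_ge0 => x; exact: powR_ge0.
  apply: le_trans (HC v (zball sigma) n tau v0 _ _) _.
  - by rewrite t1 (leq_trans t2).
  - by move=> x; rewrite mem_zsphere mem_zball => /eqP ->.
  apply: powRr_le; rewrite ?mulr_ge0 ?powR_ge0 ?(ltW t0) //.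
  rewrite ler_wpM2l ?mulr_ge0 ?powR_ge0 //.
  by apply: powRr_le; rewrite ?bb0 ?invr_ge0 ?(ltW s0).
(* Each of the |G| jumps contributes at most 2 W, against the squared slope 1 / |G|^2. *)
have EW : E <= (size G)%:R ^-1 * W.
  apply: le_trans (energy_le a0 uG G0 hG k sig0 hu) _; rewrite -/v.
  have G1 : 0 < (size G)%:R :> R by rewrite ltr0n lt0n size_eq0.
  apply: (@le_trans _ _ (2^-1 * (size G)%:R ^- 2 * \sum_(g <- G) (2 * W))).
    rewrite ler_wpM2l ?mulr_ge0 ?invr_ge0 ?exprn_ge0 // big_seq [leRHS]big_seq.
    apply: ler_sum => g; rewrite mem_filter !level -/Am -/Bm mem_iota => /andP[/andP[hA hB] /andP[g1 g2]].
    have g3 := leq_trans rrho g1.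
    rewrite [2 * W]mulrDl mul1r; apply: lerD; apply: sphW.
    - exact: g3.
    - exact: ltnW g2.
    - by apply: le_trans hA; rewrite lerDl.
    - by apply: le_trans hB; rewrite lerDl.
    - exact: leqW g3.
    - exact: g2.
    - by apply: le_trans hA; rewrite lerDr.
    - by apply: le_trans hB; rewrite lerDr.
  rewrite sum_const; apply: eq_le_refl; field; by rewrite gt_eqF.
apply: le_trans EW _.
apply: (@le_trans _ _ (2 * be / r * W)).
  have G1 : 0 < (size G)%:R :> R by rewrite ltr0n lt0n size_eq0.
  have h : r / be <= 2 * (size G)%:R by rewrite -Nr -natrM ler_nat.
  rewrite ler_wpM2r // -div1r ler_pdivrMr // mulrAC ler_pdivlMr // mul1r.
  by move: h; rewrite ler_pdivrMr // mulrAC.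
rewrite /W /Am /Bm.
rewrite !exprMn -[(_ `^ al) ^+ 2]powR_mulrn ?powR_ge0 // -[(_ `^ s^-1) ^+ 2]powR_mulrn ?powR_ge0 //.
rewrite -!powRrM [s^-1 * 2]mulrC.
rewrite !powRM ?mulr_ge0 ?exprn_ge0 ?(ltW be0) ?(ltW r0) //.
rewrite !powRD ?(gt_eqF be0) ?implybT // powRr1 ?(ltW be0) //.
(* The powers of r collect to r^d because 2 / t = 1 - 1 / p: the estimate is scale invariant. *)
have -> : r ^+ d = r^-1 * ((r ^+ m) `^ p^-1 * (r `^ (al * 2) * (r ^+ m) `^ (2 / s))).
  rewrite -!powR_mulrn ?(ltW r0) // -!powRrM -powR_inv1 ?(ltW r0) // -!powRD ?(gt_eqF r0) ?implybT //.
  congr (_ `^ _).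
  have -> : d%:R = m%:R + 1 :> R by rewrite natr1 prednK.
  have tq : 2 / t = 1 - p^-1 by rewrite -tp mulrAC divff ?mul1r ?gt_eqF.
  have -> : al * 2 = 2 + m%:R * (2 / t) - m%:R * (2 / s) by rewrite /al; ring.
  by rewrite tq; ring.
by apply: eq_le_refl; ring.
Qed.

End energy_step.

Section edge_hoelder.
Context {R : realType} {d : nat}.
Variables (q s th : R).
Hypotheses (q0 : 0 < q) (s0 : 0 < s) (th0 : 0 < th)
  (sq : s / 2 + s / (2 * q) + th = 1).

(** On each edge |grad v|^s is (a |grad v|^2)^(s/2) times a^(-s/2), and Hölder with three factors
    applies. The third factor counts the edges where the gradient may be nonzero; its power th is
    the gain that drives the iteration. *)
Lemma edge_hoelder (a : lattice d -> 'I_d -> R) (v : lattice d -> R) (B : seq (lattice d))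
   (P : lattice d -> 'I_d -> bool) :
  (forall x i, 0 < a x i) -> (forall x i, ~~ P x i -> grad v i x = 0) ->
  edge_energy v s B <=
  (\sum_(x <- B) \sum_i (if x + unitv i \in B then a x i * (grad v i x) ^+ 2 else 0)) `^ (s / 2) *
  (\sum_(x <- B) \sum_i a x i `^ (- q)) `^ (s / (2 * q)) *
  (\sum_(x <- B) \sum_i ((x + unitv i \in B) && P x i)%:R) `^ th.
Proof.
move=> a0 hP.
pose S := [seq (x, i) | x <- B, i <- index_enum 'I_d].
have sumS (F : lattice d -> 'I_d -> R) :
    \sum_(x <- B) \sum_i F x i = \sum_(e <- S) F e.1 e.2 by rewrite /S big_allpairs.
have s20 : 0 < s / 2 by rewrite divr_gt0.
have sq0 : 0 < s / (2 * q) by rewrite divr_gt0 // mulr_gt0.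
rewrite /edge_energy !sumS.
apply: le_trans (@hoelder3_sum R _ S
  (fun e => if e.1 + unitv e.2 \in B then a e.1 e.2 * (grad v e.2 e.1) ^+ 2 else 0)
  (fun e => a e.1 e.2 `^ (- q)) (fun e => ((e.1 + unitv e.2 \in B) && P e.1 e.2)%:R)
  (s / 2) (s / (2 * q)) th s20 sq0 th0 sq _ _ _).
- apply: ler_sum => -[x i] _ /=; case: ifP => _; last by rewrite !mulr_ge0 ?powR_ge0.
  have [Px|/hP g0] := boolP (P x i); last first.
    by rewrite g0 normr0 powR0 ?gt_eqF // !mulr_ge0 ?powR_ge0.
  rewrite powR1 mulr1 powRM ?sqr_ge0 ?(ltW (a0 _ _)) // -powRrM.
  rewrite mulrAC -powRD ?(gt_eqF (a0 _ _)) ?implybT //.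
  have -> : s / 2 + - q * (s / (2 * q)) = 0 by field; rewrite gt_eqF.
  by rewrite powRr0 mul1r -real_normK ?num_real // -powR_mulrn ?normr_ge0 // -powRrM mulrC divfK.
- by move=> e; case: ifP => // _; rewrite mulr_ge0 ?sqr_ge0 ?(ltW (a0 _ _)).
- by move=> e; exact: powR_ge0.
- by move=> e.
Qed.

Lemma sum_edges_count (B : seq (lattice d)) (Q : pred (lattice d)) : uniq B ->
  \sum_(x <- B) \sum_i ((x + unitv i \in B) && (Q x || Q (x + unitv i)))%:R <=
  2 * d%:R * (count Q B)%:R :> R.
Proof.
move=> uB; rewrite exchange_big /=.
have -> : 2 * d%:R * (count Q B)%:R = \sum_(i < d) 2 * (count Q B)%:R :> R.
  by rewrite sumr_const card_ord -[RHS]mulr_natr [LHS]mulrAC.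
apply: ler_sum => i _.
apply: (@le_trans _ _ (\sum_(x <- B) (Q x)%:R + \sum_(x <- B) ((x + unitv i \in B) && Q (x + unitv i))%:R)).
  rewrite -big_split /=; apply: ler_sum => x _; rewrite -natrD ler_nat.
  by case: (_ \in B); case: (Q x); case: (Q _).
have cE : \sum_(x <- B) (Q x)%:R = (count Q B)%:R :> R.
  by rewrite -sum1_count natr_sum [RHS]big_mkcond; apply: eq_bigr => x _; case: (Q x).
rewrite mulrDl mul1r; apply: lerD; rewrite -cE //.
rewrite -(big_map (fun x => x + unitv i) xpredT (fun y => ((y \in B) && Q y)%:R)) /=.
rewrite (bigID (mem B)) /= [X in _ + X]big1 ?addr0; last by move=> y /negbTE ->.
rewrite -big_filter; apply: (@le_trans _ _ (\sum_(y <- B) ((y \in B) && Q y)%:R)).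
  apply: sum_sub => [|y|//].
    by rewrite filter_uniq // map_inj_uniq // => x y /addIr.
  by rewrite mem_filter => /andP[].
by apply: ler_sum => y _; rewrite ler_nat; case: (_ \in _).
Qed.

End edge_hoelder.

Section de_giorgi_recursion.
Context {R : realType}.

(** The superlinear power 1 + th absorbs the growth b^i: the rate g <= rho is chosen with b g^th <=
    1, then K so large that one step gains the factor g. K depends neither on y nor on n, and the
    recursion is needed below n only. *)
Lemma geometric_decay (M C b th be rho : R) : 0 < M -> 0 < C -> 1 <= b -> 0 < th -> 0 < be -> 0 < rho <= 1 ->
  exists2 K : R, 1 <= K & forall (y : nat -> R) n, (forall i, 0 <= y i) -> y 0%N <= M ->
   (forall i, (i < n)%N -> y i.+1 <= C * b ^+ i * K `^ (- be) * y i `^ (1 + th)) ->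
   y n <= M * rho ^+ n.
Proof.
move=> M0 C0 b1 th0 be0 /andP[rho0 rho1].
have b0 : 0 < b by lra.
pose g := Num.min rho (b `^ (- th^-1)).
have g0 : 0 < g by rewrite lt_min rho0 powR_gt0.
have bg : b * g `^ th <= 1.
  have : g `^ th <= (b `^ (- th^-1)) `^ th.
    by apply: powRr_le; rewrite ?(ltW g0) ?(ltW th0) // ge_min lexx orbT.
  rewrite -powRrM mulNr mulVf ?gt_eqF // powR_inv1 ?(ltW b0) // => h.
  by rewrite mulrC -ler_pdivlMr // mul1r.
pose K := Num.max 1 ((C * M `^ th / g) `^ be^-1).
have K1 : 1 <= K by rewrite le_max lexx.
have K0 : 0 < K by lra.
have CK : C * M `^ th * K `^ (- be) <= g.
  rewrite powRN ler_pdivrMr ?powR_gt0 // [leRHS]mulrC -ler_pdivrMr //.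
  rewrite -[leLHS](@powRVK R _ be) ?gt_eqF ?divr_ge0 ?mulr_ge0 ?powR_ge0 ?(ltW g0) ?(ltW C0) //.
  by apply: powRr_le; rewrite ?powR_ge0 ?(ltW be0) // le_max lexx orbT.
exists K => // y n y0 yM rec.
have main i : (i <= n)%N -> y i <= M * g ^+ i.
  elim: i => [|i IH] lin; first by rewrite expr0 mulr1.
  have {}IH := IH (ltnW lin).
  apply: le_trans (rec i lin) _.
  apply: (@le_trans _ _ (C * b ^+ i * K `^ (- be) * (M * g ^+ i) `^ (1 + th))).
    rewrite ler_wpM2l ?mulr_ge0 ?exprn_ge0 ?powR_ge0 ?(ltW C0) ?(ltW b0) //.
    by apply: powRr_le => //; lra.
  have Mg0 : 0 < M * g ^+ i by rewrite mulr_gt0 // exprn_gt0.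
  rewrite powRD ?(gt_eqF Mg0) ?implybT // powRr1 ?(ltW Mg0) //.
  rewrite (@powRM _ M (g ^+ i)) ?(ltW M0) ?exprn_ge0 ?(ltW g0) //.
  have -> : (g ^+ i) `^ th = (g `^ th) ^+ i.
    by rewrite -!powR_mulrn ?powR_ge0 ?(ltW g0) // powRAC.
  have -> : C * b ^+ i * K `^ (- be) * (M * g ^+ i * (M `^ th * (g `^ th) ^+ i)) =
     (C * M `^ th * K `^ (- be)) * ((b * g `^ th) ^+ i) * (M * g ^+ i) by rewrite exprMn; ring.
  rewrite exprS [leRHS](_ : _ = g * 1 * (M * g ^+ i)); last by ring.
  apply: ler_wpM2r; first exact: ltW.
  apply: ler_pM => //; rewrite ?exprn_ge0 ?mulr_ge0 ?powR_ge0 ?(ltW C0) ?(ltW b0) //.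
  by apply: exprn_ile1 => //; rewrite mulr_ge0 ?powR_ge0 ?(ltW b0).
apply: le_trans (main n (leqnn n)) _; apply: ler_wpM2l; first exact: ltW.
by apply: lerXn2r; rewrite ?nnegrE ?(ltW g0) ?(ltW rho0) // ge_min lexx.
Qed.

End de_giorgi_recursion.

Section de_giorgi_step.
Context {R : realType} {d : nat}.
Hypothesis d0 : (0 < d)%N.
Variables (p q s t th : R).
Hypotheses (p1 : 1 < p) (q0 : 0 < q) (s1 : 1 < s) (st : s <= t)
  (tp : t * (1 - p^-1) = 2) (al0 : 0 < 1 + d.-1%:R / t - d.-1%:R / s)
  (th0 : 0 < th) (sq : s / 2 + s / (2 * q) + th = 1).

Definition excess (u : lattice d -> R) (k : R) (x : lattice d) : R := Num.max (u x - k) 0.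

Lemma excess_ge0 u k x : 0 <= excess u k x.
Proof. by rewrite /excess le_max lexx orbT. Qed.

Lemma excess_gt0 u k x : (0 < excess u k x) = (k < u x).
Proof. by rewrite /excess lt_max ltxx orbF subr_gt0. Qed.

Lemma excess_mono u h k x : h <= k -> excess u k x <= excess u h x.
Proof.
by move=> hk; rewrite /excess ge_max !le_max lexx orbT andbT lerD2l lerN2 hk.
Qed.

Lemma max_sub_mono (A B h k : R) : B <= A -> h <= k ->
  0 <= Num.max (A - k) 0 - Num.max (B - k) 0 <= Num.max (A - h) 0 - Num.max (B - h) 0.
Proof.
move=> BA hk; have [h1|h1] := leP (A - k) 0; have [h2|h2] := leP (B - k) 0;
  have [h3|h3] := leP (A - h) 0; have [h4|h4] := leP (B - h) 0; apply/andP; split; lra.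
Qed.

Lemma max_sub_le (A B k : R) : B <= A ->
  0 <= Num.max (A - k) 0 - Num.max (B - k) 0 <= A - B.
Proof.
by move=> BA; have [h1|h1] := leP (A - k) 0; have [h2|h2] := leP (B - k) 0; apply/andP; split; lra.
Qed.

Lemma grad_excess_mono u h k i x : h <= k ->
  `|grad (excess u k) i x| <= `|grad (excess u h) i x|.
Proof.
move=> hk; rewrite /grad /excess.
have [BA|/ltW AB] := leP (u x) (u (x + unitv i)).
  have /andP[h1 h2] := max_sub_mono BA hk.
  by rewrite !ger0_norm // (le_trans h1).
have /andP[h1 h2] := max_sub_mono AB hk.
by rewrite distrC [leRHS]distrC !ger0_norm // (le_trans h1).
Qed.

Lemma grad_excess_le u k i x : `|grad (excess u k) i x| <= `|grad u i x|.
Proof.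
rewrite /grad /excess.
have [BA|/ltW AB] := leP (u x) (u (x + unitv i)).
  have /andP[h1 h2] := max_sub_le k BA.
  by rewrite !ger0_norm // subr_ge0.
have /andP[h1 h2] := max_sub_le k AB.
by rewrite distrC [leRHS]distrC !ger0_norm // subr_ge0.
Qed.

Lemma edge_energy_mono (v w : lattice d -> R) B : (forall i x, `|grad v i x| <= `|grad w i x|) ->
  edge_energy v s B <= edge_energy w s B.
Proof.
move=> h; apply: ler_sum => x _; apply: ler_sum => i _; case: ifP => // _.
by apply: powRr_le => //; move: s1; lra.
Qed.

Lemma sum_sob_density (v : lattice d -> R) B r : 0 < r -> (forall x, 0 <= v x) ->
  \sum_(x <- B) sob_density s v B r x = edge_energy v s B + (r `^ s)^-1 * \sum_(x <- B) v x `^ s.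
Proof.
move=> r0 v0; rewrite big_split mulr_sumr; congr (_ + _); apply: eq_bigr => x _.
by rewrite powRM // ?invr_ge0 ?(ltW r0) // -powRN -powR_inv1 ?(ltW r0) // -powRrM mulN1r mulrC.
Qed.

(** Chebyshev: where u exceeds k, its excess over h is at least k - h. *)
Lemma count_excess (u : lattice d -> R) (h k : R) B : h < k ->
  (count (fun x => 0 < excess u k x)%R B)%:R <= ((k - h) `^ s)^-1 * \sum_(x <- B) excess u h x `^ s.
Proof.
move=> hk; have s0 : 0 < s by move: s1; lra.
have kh0 : 0 < k - h by rewrite subr_gt0.
rewrite mulrC ler_pdivlMr ?powR_gt0 // -sum1_count natr_sum mulr_suml big_mkcond.
apply: ler_sum => x _; case: ifP => [|_]; last exact: powR_ge0.
rewrite excess_gt0 mul1r => kx; apply: powRr_le; rewrite ?(ltW kh0) ?(ltW s0) //.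
by rewrite /excess le_max; apply/orP; left; lra.
Qed.

(** Poincaré's inequality bounds the Sobolev density of the excess by y, the normalised energy at
    level h. In [edge_hoelder] the conductance energy, of order y^(2/s) by [energy_step], is raised
    to the power s/2 and gives y; the count of {u > k} gives y^th and the power K^(- s th). *)
Lemma de_giorgi_step (M : R) : 0 < M -> exists2 C : R, 0 < C &
  forall (a : lattice d -> 'I_d -> R) (u : lattice d -> R) (h k K : R) (n j rho : nat),
  let sigma := (rho + 2 ^ j)%N in
  let r : R := 2 ^+ n in
  let be : R := 2 ^+ (n - j) in
  (forall x i, 0 < a x i) -> (j <= n)%N ->
  (2 ^ n <= rho)%N -> (sigma <= 2 * 2 ^ n)%N -> 0 < K -> k - h = K * (r / be) ->
  (forall x, (supnorm x < sigma)%N -> generator a u x = 0) ->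
  \sum_(x <- zball sigma) speed a x `^ p <= M * r ^+ d ->
  \sum_(x <- zball sigma) \sum_i a x i `^ (- q) <= M * r ^+ d ->
  (2 * count (fun x => 0 < excess u h x)%R (zball sigma) <= (2 ^ n) ^ d)%N ->
  edge_energy (excess u k) s (zball rho) / r ^+ d <=
  C * be `^ ((1 + p^-1 + 2 / s) * (s / 2) + s * th) * K `^ (- (s * th)) *
    (edge_energy (excess u h) s (zball sigma) / r ^+ d) `^ (1 + th).
Proof.
move=> M0.
have [CE CE0 HE] := energy_step d0 p1 s1 st tp al0.
have [CP CP0 HP] := @ball_poincare R d s s1.
have s0 : 0 < s by move: s1; lra.
have p0 : 0 < p by move: p1; lra.
pose C := CE `^ (s / 2) * (M `^ p^-1) `^ (s / 2) * (1 + CP) * M `^ (s / (2 * q)) * (2 * d%:R * CP) `^ th.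
have C0 : 0 <= C by rewrite !mulr_ge0 ?powR_ge0 ?addr_ge0.
exists (C + 1); first by rewrite ltr_wpDl.
move=> a u h k K n j rho sigma r be a0 jn rrho sig K0 hkK hu HM HQ Hc.
have r0 : 0 < r by rewrite exprn_gt0.
have be0 : 0 < be by rewrite exprn_gt0.
have rd0 : 0 < r ^+ d by rewrite exprn_gt0.
have kh0 : 0 < k - h by rewrite hkK mulr_gt0 // divr_gt0.
have hk : h <= k by rewrite ltW // -subr_gt0.
have rs : (rho <= sigma)%N by rewrite /sigma leq_addr.
have rhos : (2 ^ n <= sigma <= 2 * 2 ^ n)%N by rewrite (leq_trans rrho rs) sig.
set Y := edge_energy (excess u h) s (zball sigma).
set y := Y / r ^+ d.
have Y0 : 0 <= Y by exact: edge_energy_ge0.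
have y0 : 0 <= y by rewrite divr_ge0 // ltW.
have Yy : Y = y * r ^+ d by rewrite /y divfK ?gt_eqF.
clearbody y.
have Pn := HP _ _ _ (excess_ge0 u h) rhos Hc.
have B1 : \sum_(x <- zball sigma) sob_density s (excess u k) (zball sigma) r x <= (1 + CP) * y * r ^+ d.
  rewrite (sum_sob_density _ r0 (excess_ge0 _ _)) -mulrA -Yy mulrDl mul1r; apply: lerD.
    by apply: edge_energy_mono => i x; exact: grad_excess_mono.
  rewrite mulrC ler_pdivrMr ?powR_gt0 // mulrAC; apply: le_trans Pn.
  apply: ler_sum => x _; apply: powRr_le; rewrite ?excess_ge0 ?(ltW s0) //.
  exact: excess_mono.
have Bd0 : 0 <= (1 + CP) * y by rewrite mulr_ge0 // addr_ge0.
have := HE a u k M _ n j rho (fun x i => ltW (a0 x i)) (ltW M0) Bd0 jn rrho sig hu HM B1.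
rewrite -/be -/r -/(excess u k) => EE.
have := @edge_hoelder R d q s th q0 s0 th0 sq a (excess u k) (zball rho)
  (fun x i => (0 < excess u k x) || (0 < excess u k (x + unitv i))) a0 _.
have g0 x i : ~~ ((0 < excess u k x) || (0 < excess u k (x + unitv i))) -> grad (excess u k) i x = 0.
  rewrite negb_or -!leNgt => /andP[h1 h2]; rewrite /grad.
  have E z : excess u k z <= 0 -> excess u k z = 0.
    by move=> hz; apply/eqP; rewrite eq_le hz excess_ge0.
  by rewrite (E _ h1) (E _ h2) subrr.
move=> /(_ g0) H; rewrite ler_pdivrMr //; apply: le_trans H _.
(* Since k - h = K r / be, Chebyshev's factor is (be / K)^s r^(-s), and r^(-s) cancels the r^s of
   Poincaré's inequality. *)
have cnt : \sum_(x <- zball rho) \sum_i ((x + unitv i \in zball rho) &&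
     ((0 < excess u k x) || (0 < excess u k (x + unitv i))))%:R <=
     (2 * d%:R * CP) * (be `^ s * K `^ (- s) * y * r ^+ d).
  apply: le_trans (sum_edges_count (fun x => 0 < excess u k x) (uniq_zball rho)) _.
  rewrite -!(mulrA (2 * d%:R)) ler_wpM2l ?mulr_ge0 //.
  apply: (@le_trans _ _ ((count (fun x => 0 < excess u k x)%R (zball sigma))%:R)).
    rewrite ler_nat -!size_filter; apply: uniq_leq_size; first by rewrite filter_uniq // uniq_zball.
    by move=> x; rewrite !mem_filter !mem_zball => /andP[-> /leq_trans]; exact.
  have hk' : h < k by rewrite -subr_gt0.
  apply: le_trans (count_excess u (zball sigma) hk') _.
  rewrite mulrC ler_pdivrMr ?powR_gt0 //; apply: le_trans Pn _.
  rewrite hkK !powRM ?invr_ge0 ?mulr_ge0 ?invr_ge0 ?(ltW K0) ?(ltW r0) ?(ltW be0) // -/Y Yy.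
  rewrite -[be^-1]powR_inv1 ?(ltW be0) // -!powRrM mulN1r !powRN.
  by apply: eq_le_refl; field; rewrite !gt_eqF ?powR_gt0.
have HQ' : \sum_(x <- zball rho) \sum_i a x i `^ (- q) <= M * r ^+ d.
  apply: le_trans HQ; apply: sum_sub; first exact: uniq_zball.
    by move=> x; rewrite !mem_zball => /leq_trans; exact.
  by move=> x _; apply: sumr_ge0 => i _; exact: powR_ge0.
set e := _ * (s / 2) + s * th.
apply: (@le_trans _ _ (C * be `^ e * K `^ (- (s * th)) * y `^ (1 + th) * r ^+ d)); last first.
  by rewrite !ler_wpM2r ?powR_ge0 ?(ltW rd0) // lerDl.
have s20 : 0 < s / 2 by rewrite divr_gt0.
have sq0 : 0 < s / (2 * q) by rewrite divr_gt0 // mulr_gt0.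
apply: (@le_trans _ _ ((CE * be `^ (1 + p^-1 + 2 / s) * M `^ p^-1 * ((1 + CP) * y) `^ (2 / s) * r ^+ d) `^ (s / 2) *
   (M * r ^+ d) `^ (s / (2 * q)) * ((2 * d%:R * CP) * (be `^ s * K `^ (- s) * y * r ^+ d)) `^ th)).
  apply: ler_pM; rewrite ?mulr_ge0 ?powR_ge0 //.
    apply: ler_pM; rewrite ?powR_ge0 //; apply: powRr_le; rewrite ?(ltW s20) ?(ltW sq0) //.
      apply: sum_ge0 => x; apply: sumr_ge0 => i _; case: ifP => // _.
      by rewrite mulr_ge0 ?sqr_ge0 ?(ltW (a0 _ _)).
    by apply: sum_ge0 => x; apply: sumr_ge0 => i _; exact: powR_ge0.
  apply: powRr_le; rewrite ?(ltW th0) //.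
  by apply: sum_ge0 => x; apply: sumr_ge0 => i _.
have cp0 : 0 <= 1 + CP by rewrite addr_ge0.
have rd0' := ltW rd0.
have F1 (z : R) : 0 <= z ->
    (CE * be `^ (1 + p^-1 + 2 / s) * M `^ p^-1 * z `^ (2 / s) * r ^+ d) `^ (s / 2) =
    CE `^ (s / 2) * be `^ ((1 + p^-1 + 2 / s) * (s / 2)) * (M `^ p^-1) `^ (s / 2) * z * (r ^+ d) `^ (s / 2).
  move=> z0; rewrite !powRM ?mulr_ge0 ?powR_ge0 //. rewrite -!powRrM.
  have -> : 2 / s * (s / 2) = 1 by field; rewrite gt_eqF.
  by rewrite powRr1.
have F2 : (M * r ^+ d) `^ (s / (2 * q)) = M `^ (s / (2 * q)) * (r ^+ d) `^ (s / (2 * q)).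
  by rewrite powRM // ltW.
have F3 (z : R) : 0 <= z -> (z * (be `^ s * K `^ (- s) * y * r ^+ d)) `^ th =
    z `^ th * be `^ (s * th) * K `^ (- (s * th)) * y `^ th * (r ^+ d) `^ th.
  move=> z0; rewrite !powRM ?mulr_ge0 ?powR_ge0 // -!powRrM mulNr; ring.
rewrite F1 // F2 F3; last by rewrite !mulr_ge0 ?ler0n.
rewrite [in leRHS](_ : r ^+ d = (r ^+ d) `^ (s / 2) * (r ^+ d) `^ (s / (2 * q)) * (r ^+ d) `^ th); last first.
  by rewrite -!powRD ?(gt_eqF rd0) ?implybT // sq powRr1.
rewrite /e [be `^ (_ + _)]powRD ?(gt_eqF be0) ?implybT //.
have -> : y `^ (1 + th) = y * y `^ th.
  have [->|yn] := eqVneq y 0; first by rewrite mul0r powR0 // gt_eqF //; move: th0; lra.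
  by rewrite powRD ?yn ?implybT // powRr1.
by apply: eq_le_refl; rewrite /C; ring.
Qed.

End de_giorgi_step.

Lemma size_zball_le d n : (size (@zball d (2 * 2 ^ n)) <= 5 ^ d * (2 ^ n) ^ d)%N.
Proof.
rewrite size_zball -expnMn; case: d => // d; rewrite leq_exp2r //.
by have : (0 < 2 ^ n)%N by [rewrite expn_gt0]; lia.
Qed.

Section local_bound.
Context {R : realType} {d : nat}.
Hypothesis d0 : (0 < d)%N.
Variables (p q s t th : R).
Hypotheses (p1 : 1 < p) (q0 : 0 < q) (s1 : 1 < s) (st : s <= t)
  (tp : t * (1 - p^-1) = 2) (al0 : 0 < 1 + d.-1%:R / t - d.-1%:R / s)
  (th0 : 0 < th) (sq : s / 2 + s / (2 * q) + th = 1).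

Lemma edge_energy_bound (a : lattice d -> 'I_d -> R) (u : lattice d -> R) (B : seq (lattice d)) (X Y Z : R) :
  uniq B -> (forall x i, 0 < a x i) ->
  \sum_(x <- B) \sum_i a x i * (grad u i x) ^+ 2 <= X ->
  \sum_(x <- B) \sum_i a x i `^ (- q) <= Y -> (size B)%:R <= Z ->
  edge_energy u s B <= X `^ (s / 2) * Y `^ (s / (2 * q)) * (2 * d%:R * Z) `^ th.
Proof.
move=> uB a0 hX hY hZ; have s0 : 0 < s by move: s1; lra.
have s20 : 0 <= s / 2 by rewrite divr_ge0 // ltW.
have sq0 : 0 <= s / (2 * q) by rewrite divr_ge0 ?mulr_ge0 ?(ltW s0) ?(ltW q0).
have E0 x i : 0 <= a x i * (grad u i x) ^+ 2 by rewrite mulr_ge0 ?sqr_ge0 // ltW.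
apply: le_trans (@edge_hoelder R d q s th q0 s0 th0 sq a u B (fun _ _ => true) a0 _) _ => //.
apply: ler_pM; rewrite ?mulr_ge0 ?powR_ge0 //.
  apply: ler_pM; rewrite ?powR_ge0 //; apply: powRr_le => //.
  - by apply: sum_ge0 => x; apply: sumr_ge0 => i _; case: ifP.
  - apply: le_trans hX; apply: ler_sum => x _; apply: ler_sum => i _.
    by case: ifP.
  - by apply: sum_ge0 => x; apply: sumr_ge0 => i _; exact: powR_ge0.
apply: powRr_le; last exact: ltW.
  by apply: sum_ge0 => x; apply: sumr_ge0 => i _.
apply: le_trans (sum_edges_count (R := R) predT uB) _.
by rewrite count_predT ler_wpM2l ?mulr_ge0.
Qed.

(** The radii 2^n + 2^(n-i) decrease while the levels rise from k0 r towards (k0 + K) r. After n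
    steps the energy left is of order one, and this already bounds the excess at a single point by a
    multiple of r. *)
Theorem local_bound (M : R) : 0 < M -> exists2 K : R, 0 < K &
  forall (a : lattice d -> 'I_d -> R) (u : lattice d -> R) (n : nat),
  let r : R := 2 ^+ n in
  let B := zball (2 * 2 ^ n) in
  (forall x i, 0 < a x i) ->
  (forall x, (supnorm x < 2 * 2 ^ n)%N -> generator a u x = 0) ->
  \sum_(x <- B) speed a x `^ p <= M * r ^+ d ->
  \sum_(x <- B) \sum_i a x i `^ (- q) <= M * r ^+ d ->
  \sum_(x <- B) \sum_i a x i * (grad u i x) ^+ 2 <= M * r ^+ d ->
  \sum_(x <- B) `|u x| `^ s <= M * r `^ s * r ^+ d ->
  forall x, (supnorm x <= 2 ^ n)%N -> u x <= K * r.
Proof.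
move=> M0.
have s0 : 0 < s by move: s1; lra.
have p0 : 0 < p by move: p1; lra.
have [C C0 HC] := de_giorgi_step d0 p1 q0 s1 st tp al0 th0 sq M0.
have [CP CP0 HP] := @ball_poincare R d s s1.
pose e := (1 + p^-1 + 2 / s) * (s / 2) + s * th.
have e0 : 0 <= e.
  by rewrite !(addr_ge0, mulr_ge0) ?invr_ge0 ?(ltW s0) ?(ltW p0) ?(ltW th0).
(* By Chebyshev and the s-th moment of u, twice the number of points with u > k0 r is at most
   (2^n)^d, as Poincaré's inequality requires. *)
pose k0 := (2 * M) `^ s^-1.
have k00 : 0 < k0 by rewrite powR_gt0 // mulr_gt0.
have k0s : k0 `^ s = 2 * M by rewrite /k0 powRVK ?gt_eqF // mulr_ge0 // ltW.
pose M1 := M `^ (s / 2) * M `^ (s / (2 * q)) * (2 * d%:R * 5 ^+ d) `^ th.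
have M10 : 0 <= M1 by rewrite !mulr_ge0 ?powR_ge0.
have M1p : 0 < M1 + 1 by rewrite ltr_wpDl.
have b1 : 1 <= 2 `^ e :> R.
  by rewrite -[leLHS](powRr0 2) ler_powR // ler1n.
have C2 : 0 < C * 2 `^ e by rewrite mulr_gt0 // powR_gt0.
have sth : 0 < s * th by rewrite mulr_gt0.
(* A decay by 2^(-d) per step cancels, after n steps, the normalisation by r^d. *)
have hrho : 0 < (2^-1 ^+ d : R) <= 1.
  apply/andP; split; first by rewrite exprn_gt0 ?invr_gt0.
  apply: exprn_ile1; rewrite ?invr_ge0 //.
  by rewrite invf_le1 // ler1n.
have [K K1 HK] := geometric_decay M1p C2 b1 th0 sth hrho.
have K0 : 0 < K by lra.
exists (k0 + K + (CP * (M1 + 1)) `^ s^-1); first by rewrite ltr_wpDr ?powR_ge0 // addr_gt0.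
move=> a u n r B a0 hu H1 H2 H3 H4 x xn.
have r0 : 0 < r by rewrite exprn_gt0.
have rd0 : 0 < r ^+ d by rewrite exprn_gt0.
(* Step i shrinks the radius by 2^(n-i-1) and raises the level by K 2^(n-i-1), so that [be] in
   [de_giorgi_step] is 2^(i+1). *)
pose rho i := (2 ^ n + 2 ^ (n - i))%N.
pose k i := k0 * r + K * r * (1 - 2^-1 ^+ i).
pose y i := edge_energy (excess u (k i)) s (zball (rho i)) / r ^+ d.
have rhoB i : (2 ^ n <= rho i <= 2 * 2 ^ n)%N.
  by rewrite /rho leq_addr mul2n -addnn leq_add2l leq_exp2l // leq_subr.
have kpos i : k0 * r <= k i.
  rewrite /k lerDl !mulr_ge0 ?(ltW K0) ?(ltW r0) // subr_ge0.
  by apply: exprn_ile1; rewrite ?invr_ge0 // invf_le1 // ler1n.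
have cnt i m : (m <= 2 * 2 ^ n)%N ->
    (2 * count (fun x => 0 < excess u (k i) x)%R (zball m) <= (2 ^ n) ^ d)%N.
  move=> mn; rewrite -(ler_nat R) natrM natrX natrX -/r.
  apply: (@le_trans _ _ (2 * ((k0 * r) `^ s)^-1 * \sum_(x <- B) `|u x| `^ s)).
    rewrite -mulrA ler_wpM2l // mulrC ler_pdivlMr ?powR_gt0 ?mulr_gt0 //.
    apply: (@le_trans _ _ (\sum_(z <- zball m) `|u z| `^ s)).
      rewrite -sum1_count natr_sum mulr_suml big_mkcond; apply: ler_sum => z _.
      case: ifP => [|_]; last exact: powR_ge0.
      rewrite excess_gt0 mul1r => hz; apply: powRr_le; rewrite ?mulr_ge0 ?(ltW k00) ?(ltW r0) ?(ltW s0) //.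
      by apply: le_trans (ler_norm _); apply: le_trans (kpos i) _; exact: ltW.
    apply: sum_sub; first exact: uniq_zball.
      by move=> z; rewrite !mem_zball => /leq_trans; exact.
    by move=> z _; exact: powR_ge0.
  rewrite powRM ?(ltW k00) ?(ltW r0) // k0s.
  have rs0 : 0 < r `^ s by rewrite powR_gt0.
  rewrite mulrAC ler_pdivrMr ?mulr_gt0 //.
  rewrite [leRHS](_ : _ = 2 * (M * r `^ s * r ^+ d)); last by ring.
  by rewrite ler_wpM2l.
have y00 i : 0 <= y i by rewrite divr_ge0 ?edge_energy_ge0 // ltW.
have yM : y 0%N <= M1 + 1.
  have rho0 : rho 0%N = (2 * 2 ^ n)%N by rewrite /rho subn0 addnn mul2n.
  rewrite /y rho0 ler_pdivrMr //.
  apply: (@le_trans _ _ (M1 * r ^+ d)); last by rewrite ler_wpM2r ?(ltW rd0) // lerDl.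
  apply: (@le_trans _ _ (edge_energy u s B)).
    by apply: edge_energy_mono => // i z; exact: grad_excess_le.
  have sz : (size B)%:R <= 5 ^+ d * r ^+ d :> R.
    by have := size_zball_le d n; rewrite -(ler_nat R) natrM !natrX.
  apply: le_trans (edge_energy_bound (uniq_zball _) a0 H3 H2 sz) _.
  rewrite mulrA !(powRM _ _ (ltW rd0)) ?mulr_ge0 ?exprn_ge0 ?(ltW M0) //.
  have Er : r ^+ d = (r ^+ d) `^ (s / 2) * (r ^+ d) `^ (s / (2 * q)) * (r ^+ d) `^ th.
    by rewrite -!powRD ?(gt_eqF rd0) ?implybT // sq powRr1 // ltW.
  by apply: eq_le_refl; rewrite [X in _ = _ * X]Er /M1; ring.
have rec i : (i < n)%N -> y i.+1 <= C * 2 `^ e * (2 `^ e) ^+ i * K `^ (- (s * th)) * y i `^ (1 + th).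
  move=> lin.
  have E1 : (rho i.+1 + 2 ^ (n - i.+1) = rho i)%N.
    by rewrite /rho -addnA addnn -mul2n -expnS -subSn.
  have := HC a u (k i) (k i.+1) K n (n - i.+1)%N (rho i.+1).
  rewrite E1 subKn //.
  have [h1 h2] := andP (rhoB i); have [h3 _] := andP (rhoB i.+1).
  have sub (F : lattice d -> R) (X : R) : (forall z, 0 <= F z) -> \sum_(z <- B) F z <= X ->
      \sum_(z <- zball (rho i)) F z <= X.
    move=> F0; apply: le_trans; apply: sum_sub => //; first exact: uniq_zball.
    by move=> z; rewrite !mem_zball => /leq_trans; exact.
  move=> /(_ a0 (leq_subr _ _) h3 h2 K0).
  have -> : k i.+1 - k i = K * (2 ^+ n / 2 ^+ i.+1).
    have P0 : (2 ^+ i : R) != 0 by rewrite expf_neq0.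
    by rewrite /k -/r !exprVn exprS; move: (2 ^+ i) P0 => P P0; field.
  move=> /(_ erefl).
  have hu' z : (supnorm z < rho i)%N -> generator a u z = 0 by move=> hz; apply: hu; exact: leq_trans hz h2.
  move=> /(_ hu' (sub _ _ (fun z => powR_ge0 _ _) H1)).
  have q' z : 0 <= \sum_i a z i `^ (- q) by apply: sumr_ge0 => ? _; exact: powR_ge0.
  move=> /(_ (sub _ _ q' H2) (cnt i _ h2)); rewrite -/(y i.+1) -/(y i) -/e.
  have -> : (2 ^+ i.+1) `^ e = 2 `^ e * (2 `^ e) ^+ i :> R.
    by rewrite powRX // exprS.
  by rewrite mulrA.
have yn := HK y n y00 yM rec.
have Pn := HP _ n (rho n) (excess_ge0 u (k n)) (rhoB n) (cnt n _ (proj2 (andP (rhoB n)))).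
(* By [yn] the energy itself is at most M1 + 1; Poincaré's inequality bounds the whole sum of
   excesses, and one term of it is the value at x. *)
have vx : excess u (k n) x <= (CP * (M1 + 1)) `^ s^-1 * r.
  have -> : (CP * (M1 + 1)) `^ s^-1 * r = (CP * (M1 + 1) * r `^ s) `^ s^-1.
    by rewrite (@powRM _ (CP * (M1 + 1)) (r `^ s)) ?mulr_ge0 ?powR_ge0 ?(ltW M1p) // powRK ?(ltW r0) // gt_eqF.
  apply: powR_le_inv; rewrite ?excess_ge0 ?mulr_ge0 ?powR_ge0 ?(ltW M1p) //.
  apply: (@le_trans _ _ (\sum_(z <- zball (rho n)) excess u (k n) z `^ s)).
    rewrite (big_rem x) /=; last by rewrite mem_zball (leq_trans xn) // leq_addr.
    by rewrite lerDl; apply: sum_ge0 => z; exact: powR_ge0.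
  apply: le_trans Pn _; rewrite -/r [leLHS]mulrAC ler_wpM2r ?powR_ge0 // ler_wpM2l //.
  move: yn; rewrite /y ler_pdivrMr // -mulrA -exprM mulnC exprM -exprMn /r exprVn mulVf ?expf_neq0 //.
  by rewrite expr1n mulr1.
have : u x <= k n + excess u (k n) x by rewrite -lerBlDl /excess le_max lexx.
move=> h; apply: le_trans h _.
rewrite !mulrDl; apply: lerD => //; rewrite /k lerD2l ler_piMr ?mulr_ge0 ?(ltW K0) ?(ltW r0) //.
Qed.

End local_bound.

(** * A maximal ergodic theorem along dyadic windows *)

Section environment.
Context {d : nat} {R : realType}.
Implicit Types (w : env d R) (x y z : lattice d) (P : probability (env d R) R).

Lemma bond_shiftD x y (e : bond d) : bond_shift y (bond_shift x e) = bond_shift (x + y) e.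
Proof.
apply: val_inj; apply/fsetP => u /=; apply/imfsetP/imfsetP => /= -[v].
  by case/imfsetP => v' /= v'e -> ->; exists v' => //; rewrite addrA.
by move=> ve ->; exists (v + x); [apply/imfsetP; exists v|rewrite addrA].
Qed.

Lemma bond_shift0 (e : bond d) : bond_shift 0 e = e.
Proof.
apply: val_inj; apply/fsetP => u /=; apply/imfsetP/idP => /= [[v ve ->]|ue]; first by rewrite addr0.
by exists u => //; rewrite addr0.
Qed.

Lemma tauD x y w : tau x (tau y w) = tau (x + y) w.
Proof. by apply/funext => e; rewrite /tau bond_shiftD. Qed.

Lemma tau0 w : tau 0 w = w.
Proof. by apply/funext => e; rewrite /tau bond_shift0. Qed.

Lemma measurable_coordinate (e : bond d) :
  measurable_fun [set: env d R] (fun w => (w e)%:num).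
Proof.
move=> _ B mB; rewrite setTI; apply: sub_sigma_algebra; by exists e, B.
Qed.

Lemma measurable_tau x : measurable_fun [set: env d R] (tau x).
Proof.
apply: (@measurability _ _ (env d R) (env d R) setT (tau x) (@coordinate_events d R) erefl).
move=> _ [_ [e [B [mB ->]]] <-]; rewrite setTI; apply: sub_sigma_algebra.
by exists (bond_shift x e), B.
Qed.

Lemma integral_tau P (f : env d R -> \bar R) x : stationary P ->
  measurable_fun setT f -> (forall w, (0 <= f w)%E) ->
  (\int[P]_w f (tau x w) = \int[P]_w f w)%E.
Proof.
move=> sP mf f0.
have := @ge0_integral_pushforward _ _ _ _ R (tau x) (measurable_tau x) P setT f measurableT mf (fun w _ => f0 w).
rewrite preimage_setT => <-; apply: eq_measure_integral => [|mD A mA _].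
  exact: measurable_tau.
exact: sP.
Qed.

Lemma ae_forall_countable (I : countType) P (Q : I -> env d R -> Prop) :
  (forall i, {ae P, forall w, Q i w}) -> {ae P, forall w, forall i, Q i w}.
Proof.
move=> h.
have : {ae P, forall w, forall n, if @choice.unpickle I n is Some i then Q i w else True}.
  by apply: ae_foralln => n; case: (@choice.unpickle I n) => [i|]; [exact: h|exact: aeW].
by apply: filterS => w hw i; have := hw (choice.pickle i); rewrite choice.pickleK.
Qed.

Lemma ae_tau P (Q : env d R -> Prop) x : stationary P ->
  {ae P, forall w, Q w} -> {ae P, forall w, Q (tau x w)}.
Proof.
move=> sP [N [mN N0 QN]]; exists (tau x @^-1` N); split.
- by rewrite -[X in measurable X]setTI; exact: measurable_tau.
- by rewrite -[RHS]N0; exact: sP.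
- by move=> w /= h; apply: QN.
Qed.

End environment.

(** * Covering lemma and weak type inequality for windows off the base point *)

Section vitali.
Context {R : realType} {d : nat}.
(** The window of scale j at the base point x is the ball of radius rad j around x + c j. By [nbP],
    nb j contains the offsets of all base points whose window, of scale at most j, meets it; wt j
    plays the role of its volume. *)
Variables (c : nat -> lattice d) (rad : nat -> nat) (nb : nat -> seq (lattice d))
  (wt : nat -> R) (C : R).
Hypotheses (nbP : forall i j (x x' y : lattice d), (i <= j)%N ->
    (supnorm (y - x' - c i)%R <= rad i)%N -> (supnorm (y - x - c j)%R <= rad j)%N ->
    x' - x \in nb j)
  (size_nb : forall j, (size (nb j))%:R <= C * wt j) (C0 : 0 <= C).

(* Greedy selection, largest scale first: the points discarded because of x lie in x + nb (k x). *)
Lemma vitali_sum (g : lattice d -> R) (lam : R) (k : lattice d -> nat) :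
  (forall x, 0 <= g x) -> 0 <= lam ->
  forall X U : seq (lattice d), uniq X -> uniq U ->
  (forall x y, x \in X -> (supnorm (y - x - c (k x))%R <= rad (k x))%N -> y \in U) ->
  (forall x, x \in X -> lam * wt (k x) <= \sum_(z <- zball (rad (k x))) g (z + (x + c (k x)))) ->
  lam * (size X)%:R <= C * \sum_(u <- U) g u.
Proof.
move=> g0 lam0 X; have [n] := ubnP (size X); elim: n X => // n IH X szX U uX uU XU hX.
have SU0 : 0 <= C * \sum_(u <- U) g u by rewrite mulr_ge0 // sum_ge0.
have [->|[x [xX kx]]] : X = [::] \/ exists x, x \in X /\ (forall y, y \in X -> (k y <= k x)%N).
  case: X {szX XU hX uX} => [|x0 X']; [by left|right].
  have : x0 \in x0 :: X' by rewrite mem_head.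
  elim: X' x0 => [|x1 X' IH'] x0 _; first by exists x0; rewrite mem_head; split=> // y; rewrite inE => /eqP ->.
  have [x [xX hx]] := IH' x1 (mem_head _ _).
  have [h|h] := leqP (k x0) (k x).
    by exists x; split; [rewrite inE xX orbT|move=> y; rewrite inE => /predU1P[-> //|/hx]].
  exists x0; split; first exact: mem_head.
  by move=> y; rewrite inE => /predU1P[-> //|/hx/leq_trans]; apply; exact: ltnW.
  by rewrite mulr0.
pose X' := [seq x' <- X | x' - x \notin nb (k x)].
pose inQ y := (supnorm (y - x - c (k x))%R <= rad (k x))%N.
pose U' := [seq u <- U | ~~ inQ u].
have xQ : x - x \in nb (k x).
  have e : x + c (k x) - x - c (k x) = 0 by rewrite [x + _]addrC addrK subrr.
  by apply: (@nbP (k x) (k x) x x (x + c (k x))); rewrite ?e ?supnorm0.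
have sX' : (size X' < size X)%N.
  rewrite size_filter -(count_predC (fun x' => x' - x \notin nb (k x)) X) -[X in (X < _)%N]addn0 ltn_add2l.
  by rewrite -has_count; apply/hasP; exists x => //=; rewrite negbK.
have IHX : lam * (size X')%:R <= C * \sum_(u <- U') g u.
  apply: IH; rewrite ?filter_uniq //.
  - exact: leq_trans sX' szX.
  - move=> x' y; rewrite mem_filter => /andP[x'n x'X] hy.
    rewrite mem_filter (XU x' y) // andbT; apply: contra x'n => hq.
    exact: (@nbP (k x') (k x) x x' y (kx _ x'X) hy hq).
  - by move=> x'; rewrite mem_filter => /andP[_ /hX].
have cX : (size X)%:R <= (size X')%:R + (size (nb (k x)))%:R :> R.
  rewrite -natrD ler_nat /X' size_filter -(count_predC (fun x' => x' - x \notin nb (k x)) X) leq_add2l.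
  rewrite -size_filter -(size_map (fun x' => x' - x)); apply: uniq_leq_size.
    by rewrite map_inj_uniq ?filter_uniq // => u v /addIr.
  by move=> _ /mapP[u + ->]; rewrite mem_filter /= negbK => /andP[].
(* The discarded base points are paid for by the mass of the window of x, whose points are withheld
   from the remaining selection. *)
have Q1 : lam * (size (nb (k x)))%:R <= C * \sum_(u <- U | inQ u) g u.
  apply: (@le_trans _ _ (C * (lam * wt (k x)))).
    by rewrite mulrCA ler_wpM2l.
  rewrite ler_wpM2l //; apply: le_trans (hX x xX) _.
  rewrite -(big_map (fun z => z + (x + c (k x))) xpredT g) -[leRHS]big_filter; apply: sum_sub => //.
    by rewrite map_inj_uniq ?uniq_zball // => u v /addIr.
  move=> _ /mapP[z + ->]; rewrite mem_zball mem_filter => hz.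
  have hq : inQ (z + (x + c (k x))) by rewrite /inQ -addrA -opprD addrK.
  by rewrite hq (XU x).
apply: le_trans (ler_wpM2l lam0 cX) _.
rewrite (bigID inQ) /= !mulrDr addrC; apply: lerD => //.
by move: IHX; rewrite big_filter.
Qed.

End vitali.

Lemma leq_exp2r_weak (m n k : nat) : (m <= n)%N -> (m ^ k <= n ^ k)%N.
Proof. by move=> mn; case: k => // k; rewrite leq_exp2r. Qed.

Section weak_type.
Context {d : nat} {R : realType}.
Variable P : probability (env d R) R.
Hypothesis sP : stationary P.
Variables (c : nat -> lattice d) (rad : nat -> nat) (nb : nat -> seq (lattice d))
  (wt : nat -> R) (C : R).
Hypotheses (nbP : forall i j (x x' y : lattice d), (i <= j)%N ->
    (supnorm (y - x' - c i)%R <= rad i)%N -> (supnorm (y - x - c j)%R <= rad j)%N ->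
    x' - x \in nb j)
  (size_nb : forall j, (size (nb j))%:R <= C * wt j) (C0 : 0 <= C).
Variable f : env d R -> R.
Hypotheses (mf : measurable_fun setT f) (f0 : forall w, 0 <= f w)
  (fint : (\int[P]_w (f w)%:E < +oo)%E).

Definition window_sum (r : nat) (z : lattice d) (w : env d R) : R :=
  \sum_(y <- zball r) f (tau (y + z) w).

Lemma measurable_tau_comp x : measurable_fun setT (fun w : env d R => f (tau x w)).
Proof. exact: measurableT_comp mf (measurable_tau x). Qed.

Lemma measurable_window_sum r z : measurable_fun setT (window_sum r z).
Proof. by apply: measurable_sum => y; exact: measurable_tau_comp. Qed.

Lemma window_sum_tau r z x w : window_sum r z (tau x w) = window_sum r (z + x) w.
Proof. by apply: eq_bigr => y _; rewrite tauD addrA. Qed.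

Lemma measurable_window_gt r z (m : R) : measurable [set w | m < window_sum r z w].
Proof.
rewrite (_ : [set w | _] = setT `&` window_sum r z @^-1` `]m, +oo[).
  by apply: measurable_window_sum => //; exact: measurable_itv.
by rewrite setTI; apply/seteqP; split => w /=; rewrite in_itv /= andbT.
Qed.

Lemma integral_sum_tau (h : env d R -> R) (l I : R) (s : seq (lattice d)) :
  measurable_fun setT h -> (forall w, 0 <= h w) -> 0 <= l ->
  (\int[P]_w (h w)%:E = I%:E)%E ->
  (\int[P]_w (l * \sum_(x <- s) h (tau x w))%:E = (l * ((size s)%:R * I))%:E)%E.
Proof.
move=> mh h0 l0 hI.
have mht x : measurable_fun setT (fun w : env d R => (h (tau x w))%:E).
  by apply/measurable_EFinP; exact: (measurableT_comp mh (measurable_tau x)).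
transitivity (\int[P]_w (l%:E * \sum_(x <- s) (h (tau x w))%:E))%E.
  by apply: eq_integral => w _; rewrite sumEFin EFinM.
rewrite ge0_integralZl_EFin //; last 2 first.
- by move=> w _; rewrite sumEFin lee_fin; apply: sum_ge0 => x.
- by apply: emeasurable_sum => x; exact: mht.
rewrite ge0_integral_sum //; last by move=> x w _; rewrite lee_fin.
rewrite (eq_bigr (fun=> I%:E)); last first.
  move=> x _; rewrite -hI; apply: (integral_tau x sP (f := fun w => (h w)%:E)) => //.
  exact/measurable_EFinP.
by rewrite sumEFin sum_const EFinM.
Qed.

(** By stationarity the probability is the expected fraction of base points in the ball of radius H
    at which the event occurs, and [vitali_sum] bounds this fraction pathwise. H dominates the reach
    of all windows up to scale J, so they stay in the ball of radius 2 H; the ratio of volumes gives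
    2^d. *)
Lemma weak_type (lam : R) (J : nat) : 0 <= lam ->
  lam * fine (P [set w | exists2 j, (j <= J)%N & lam * wt j < window_sum (rad j) (c j) w]) <=
  2 ^+ d * C * fine (\int[P]_w (f w)%:E)%E.
Proof.
move=> lam0; set D := [set w | _].
have mD : measurable D.
  rewrite (_ : D = \bigcup_(j in [set j | (j <= J)%N]) [set w | lam * wt j < window_sum (rad j) (c j) w]).
    by apply: bigcup_measurable => j _; exact: measurable_window_gt.
  by apply/seteqP; split => w [j h1 h2]; exists j.
pose H : nat := \sum_(j < J.+1) (supnorm (c j) + rad j)%N.
have HJ j : (j <= J)%N -> (supnorm (c j) + rad j <= H)%N.
  by move=> jJ; rewrite /H (bigD1 (Ordinal (jJ : (j < J.+1)%N))) //= leq_addr.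
have point w : lam * \sum_(x <- zball H) \1_D (tau x w) <= C * \sum_(y <- zball (2 * H)) f (tau y w).
  pose X := [seq x <- @zball d H | `[< D (tau x w) >]].
  pose S x := [set j | (j <= J)%N /\ lam * wt j < window_sum (rad j) (c j) (tau x w)].
  (* The default 0 does not matter: for x in X a suitable scale exists. *)
  pose k x := xget 0%N (S x).
  have kP x : x \in X -> S x (k x).
    rewrite mem_filter => /andP[/asboolP[j jJ h] _]; apply: xgetPex; by exists j.
  have -> : \sum_(x <- zball H) \1_D (tau x w) = (size X)%:R :> R.
    rewrite -sum1_size natr_sum big_filter [RHS]big_mkcond; apply: eq_bigr => x _.
    rewrite indicE; case: asboolP => h; first by rewrite mem_set.
    by rewrite memNset.
  apply: (@vitali_sum R d c rad nb wt C nbP size_nb C0 (fun y => f (tau y w)) lam k) => //.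
  - by rewrite filter_uniq // uniq_zball.
  - exact: uniq_zball.
  - move=> x y xX hy; have [kJ _] := kP x xX.
    rewrite mem_zball mul2n -addnn.
    have xH : (supnorm x <= H)%N by move: xX; rewrite mem_filter mem_zball => /andP[].
    have -> : y = (y - x - c (k x)) + c (k x) + x by rewrite subrK subrK.
    rewrite (leq_trans (supnormD _ _)) // leq_add // (leq_trans (supnormD _ _)) //.
    by rewrite addnC (leq_trans _ (HJ _ kJ)) // leq_add2l.
  - move=> x xX; have [_ h] := kP x xX; apply/ltW/(lt_le_trans h).
    by rewrite window_sum_tau /window_sum [c _ + x]addrC.
have fin : P D \is a fin_num by exact: fin_num_measure.
have mD1 : measurable_fun setT (\1_D : env d R -> R) by exact: measurable_indic.
have ID : (\int[P]_w (\1_D w)%:E = (fine (P D))%:E)%E.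
  by rewrite integral_indic // setIT fineK.
have If : (\int[P]_w (f w)%:E = (fine (\int[P]_w (f w)%:E))%:E)%E.
  by rewrite fineK // ge0_fin_numE //; apply: integral_ge0 => w _; rewrite lee_fin; exact: f0.
have indic0 w : 0 <= (\1_D w : R) by rewrite indicE.
have mt (h : env d R -> R) (l : R) n : measurable_fun setT h ->
    measurable_fun setT (fun w : env d R => (l * \sum_(x <- zball n) h (tau x w))%:E).
  move=> mh; apply/measurable_EFinP; apply: measurable_funM; first exact: measurable_cst.
  by apply: measurable_sum => x; exact: (measurableT_comp mh (measurable_tau x)).
have : (\int[P]_w (lam * \sum_(x <- zball H) \1_D (tau x w))%:E <=
        \int[P]_w (C * \sum_(y <- zball (2 * H)) f (tau y w))%:E)%E.
  apply: ge0_le_integral => //.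
  - by move=> w _; rewrite lee_fin mulr_ge0 // sum_ge0.
  - exact: (mt (\1_D) lam H mD1).
  - exact: (mt f C (2 * H)%N mf).
  - by move=> w _; rewrite lee_fin.
rewrite (integral_sum_tau _ mD1 indic0 lam0 ID) (integral_sum_tau _ mf f0 C0 If) lee_fin.
set pd := fine (P D); set e := fine _ => h.
have e0 : 0 <= e by apply: fine_ge0; apply: integral_ge0 => w _; rewrite lee_fin; exact: f0.
have s0 : 0 < (size (@zball d H))%:R :> R by rewrite ltr0n size_zball expn_gt0.
have s2 : (size (@zball d (2 * H)))%:R <= 2 ^+ d * (size (@zball d H))%:R :> R.
  rewrite -natrX -natrM ler_nat !size_zball -expnMn; apply: leq_exp2r_weak.
  by lia.
rewrite -(ler_pM2l s0) mulrCA; apply: le_trans h _.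
apply: (@le_trans _ _ (C * (2 ^+ d * (size (@zball d H))%:R * e))).
  by rewrite ler_wpM2l // ler_wpM2r.
by apply: eq_le_refl; ring.
Qed.

End weak_type.

Lemma supnorm_mulrn d (x : lattice d) n : (supnorm (x *+ n)%R <= n * supnorm x)%N.
Proof.
elim: n => [|n IH]; first by rewrite mulr0n supnorm0.
by rewrite mulrSr mulSnr (leq_trans (supnormD _ _)) // leq_add2r.
Qed.

(* Along the scales 2^(b + m j) with |z| <= 2^m the centres z 2^(b + m i) of all smaller
   windows lie within one current scale of the base point, so that the conflicting base
   points form two balls: this is the covering hypothesis of the weak type bound. *)
Section sparse_scales.
Context {d : nat} {R : realType}.
Variables (z : lattice d) (A m b : nat).
Hypotheses (A0 : (0 < A)%N) (m0 : (0 < m)%N) (zm : (supnorm z <= 2 ^ m)%N).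

Definition scale (j : nat) : nat := (2 ^ (b + m * j))%N.

Definition sparse_nb (j : nat) : seq (lattice d) :=
  zball (6 * A * scale j) ++ [seq x + z *+ scale j | x <- zball (6 * A * scale j)].

Lemma scale_gt0 j : (0 < scale j)%N. Proof. by rewrite expn_gt0. Qed.

Lemma scale_leq i j : (i <= j)%N -> (scale i <= scale j)%N.
Proof. by move=> ij; rewrite leq_exp2l // leq_add2l leq_mul2l ij orbT. Qed.

Lemma scale_sparse i j : (i < j)%N -> (scale i * 2 ^ m <= scale j)%N.
Proof.
by move=> ij; rewrite -expnD leq_exp2l // -addnA -mulnSr leq_add2l leq_mul2l ij orbT.
Qed.

Lemma sparse_nbP i j (x x' y : lattice d) : (i <= j)%N ->
  (supnorm (y - x' - z *+ scale i)%R <= 2 * A * scale i)%N ->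
  (supnorm (y - x - z *+ scale j)%R <= 2 * A * scale j)%N ->
  x' - x \in sparse_nb j.
Proof.
move=> ij; set a := y - x' - _; set b' := y - x - _ => ha hb.
have si := scale_leq ij.
have Asi : (A * scale i <= A * scale j)%N by rewrite leq_mul2l si orbT.
have sj0 := scale_gt0 j.
have sA : (scale j <= A * scale j)%N by rewrite leq_pmull.
rewrite mem_cat; move: ij; rewrite leq_eqVlt => /orP[/eqP e|ij].
  apply/orP; left; rewrite mem_zball.
  have -> : x' - x = b' - a.
    by rewrite /a /b' e; apply: latticeP => k; rewrite !latticeB; ring.
  apply: leq_trans (supnormD _ _) _; rewrite supnormN.
  by rewrite -!mulnA in ha hb *; lia.
(* For a strictly larger scale j the shift z scale j remains and is the centre of the second ball,
   while z scale i is at most scale j by sparsity. *)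
apply/orP; right; apply/mapP; exists (b' - a - z *+ scale i); last first.
  by rewrite /a /b'; apply: latticeP => k; rewrite !(latticeB, latticeD); ring.
rewrite mem_zball; apply: leq_trans (supnormD _ _) _; rewrite supnormN.
have h1 := supnormD b' (- a); rewrite supnormN in h1.
have h2 := supnorm_mulrn z (scale i).
have h3 : (scale i * supnorm z <= scale j)%N.
  by apply: leq_trans (scale_sparse ij); rewrite leq_mul2l zm orbT.
by rewrite -!mulnA in ha hb *; lia.
Qed.

Lemma size_sparse_nb j :
  (size (sparse_nb j))%:R <= (2 * (13 * A) ^ d)%:R * (scale j ^ d)%:R :> R.
Proof.
rewrite -natrM ler_nat /sparse_nb size_cat (size_map (fun x => x + z *+ scale j)).
rewrite addnn -mul2n -[X in (_ <= X)%N]mulnA leq_mul2l /=.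
rewrite size_zball -expnMn; apply: leq_exp2r_weak.
have sj0 := scale_gt0 j.
have sA : (scale j <= A * scale j)%N by rewrite leq_pmull.
by rewrite -!mulnA; lia.
Qed.

Variable P : probability (env d R) R.
Hypotheses (sP : stationary P) (eP : ergodic P).
Variable f : env d R -> R.
Hypotheses (mf : measurable_fun setT f) (f0 : forall w, 0 <= f w)
  (fint : (\int[P]_w (f w)%:E < +oo)%E).

Lemma window_sum_mono r r' (x y : lattice d) w : (r + supnorm (x - y) <= r')%N ->
  window_sum f r x w <= window_sum f r' y w.
Proof.
move=> h; rewrite /window_sum.
have -> : \sum_(u <- zball r) f (tau (u + x) w) = \sum_(u <- [seq u + (x - y) | u <- zball r]) f (tau (u + y) w).
  by rewrite [RHS]big_map; apply: eq_bigr => u _; rewrite -addrA subrK.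
apply: sum_sub => //; first by rewrite map_inj_uniq ?uniq_zball // => u v /addIr.
move=> _ /mapP[u + ->]; rewrite !mem_zball => hu.
by rewrite (leq_trans (supnormD _ _)) // (leq_trans _ h) // leq_add2r.
Qed.

(* The event that some translate of the window exceeds lam infinitely often is invariant;
   windows of twice the radius absorb the translation, and the weak type bound then
   excludes probability 1. *)
Lemma ergodic_bound_sparse (lam : R) :
  2 ^+ d * (2 * (13 * A) ^ d)%:R * fine (\int[P]_w (f w)%:E)%E < lam ->
  {ae P, forall w, exists n, forall j, (n <= j)%N ->
     window_sum f (A * scale j) (z *+ scale j) w <= lam * (scale j ^ d)%:R}.
Proof.
move=> hlam; set e := fine _ in hlam.
have e0 : 0 <= e by apply: fine_ge0; apply: integral_ge0 => w _; rewrite lee_fin; exact: f0.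
have lam0 : 0 < lam by apply: le_lt_trans hlam; rewrite !mulr_ge0.
pose wt j : R := (scale j ^ d)%:R.
pose E (y : lattice d) j := [set w : env d R | lam * wt j < window_sum f (A * scale j) (z *+ scale j + y) w].
pose I := [set w : env d R | exists y : lattice d, forall n, exists2 j, (n <= j)%N & E y j w].
have mE y j : measurable (E y j) by exact: measurable_window_gt.
have mI : measurable I.
  have -> : I = \bigcup_(y : lattice d) \bigcap_n \bigcup_(j in [set j | (n <= j)%N]) E y j.
    apply/seteqP; split => w.
      by move=> [y hy]; exists y => // n _; have [j nj h] := hy n; exists j.
    by move=> [y _ hy]; exists y => n; have [j nj h] := hy n Logic.I; exists j.
  apply: countable_bigcupT_measurable => [|y]; first exact: countableP.
  apply: bigcapT_measurable => n; apply: bigcup_measurable => j _; exact: mE.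
have invI x w : I w -> I (tau x w).
  move=> [y hy]; exists (y - x) => n; have [j nj h] := hy n; exists j => //.
  by rewrite /E /= window_sum_tau -addrA subrK.
have tI x : tau x @` I = I.
  apply/seteqP; split => [_ [w Iw <-]|w Iw]; first exact: invI.
  by exists (tau (- x) w); [exact: invI|rewrite tauD subrr tau0].
pose D J := [set w : env d R | exists2 j, (j <= J)%N &
  lam * wt j < window_sum f (2 * A * scale j) (z *+ scale j) w].
have wD J := @weak_type d R P sP (fun j => z *+ scale j) (fun j => 2 * A * scale j)%N sparse_nb wt
  (2 * (13 * A) ^ d)%:R sparse_nbP size_sparse_nb (ler0n _ _) f mf f0 fint lam J (ltW lam0).
have mD J : measurable (D J).
  rewrite (_ : D J = \bigcup_(j in [set j | (j <= J)%N])
      [set w | lam * wt j < window_sum f (2 * A * scale j) (z *+ scale j) w]).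
    by apply: bigcup_measurable => j _; exact: measurable_window_gt.
  by apply/seteqP; split => w [j h1 h2]; exists j.
have ID : I `<=` \bigcup_J D J.
  move=> w [y hy]; have [j nj h] := hy (supnorm y).
  exists j => //; exists j => //; apply: (lt_le_trans h); apply: window_sum_mono.
  rewrite addrAC subrr add0r -mulnA mul2n -addnn leq_add2l.
  apply: leq_trans nj _; apply: leq_trans (leq_pmull _ A0).
  by rewrite /scale (leq_trans _ (ltnW (ltn_expl _ _))) // (leq_trans _ (leq_addl _ _)) // leq_pmull.
have [PI|PI] := eP mI tI.
  exists I; split => // w /= h; apply: contrapT => nI; apply: h.
  apply: contrapT => hn; apply: nI; exists 0 => n; apply: contrapT => hj; apply: hn; exists n => j nj.
  by rewrite leNgt; apply/negP => hE; apply: hj; exists j => //; rewrite /E /= addr0.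
exfalso.
(* Continuity from below carries the weak type bound, which is below 1 by the choice of lam, to the
   union that contains I; this contradicts P I = 1. *)
have cv : P (D n) @[n --> \oo] --> P (\bigcup_J D J).
  apply: nondecreasing_cvg_mu => //; first exact: bigcupT_measurable.
  move=> J J' JJ'; apply/subsetPset => w [j jJ h]; exists j => //; exact: leq_trans JJ'.
have ub J : (P (D J) <= (2 ^+ d * (2 * (13 * A) ^ d)%:R * e / lam)%:E)%E.
  have fin : P (D J) \is a fin_num by exact: fin_num_measure.
  by rewrite -(fineK fin) lee_fin ler_pdivlMr // mulrC; exact: wD.
have lim : (P (\bigcup_J D J) <= (2 ^+ d * (2 * (13 * A) ^ d)%:R * e / lam)%:E)%E.
  rewrite -(cvg_lim _ cv) //; apply: lime_le; first by apply/cvg_ex; eexists; exact: cv.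
  by apply: nearW => J; exact: ub.
have : (1 <= (2 ^+ d * (2 * (13 * A) ^ d)%:R * e / lam)%:E)%E.
  apply: le_trans lim; rewrite -PI; apply: le_measure; rewrite ?inE //.
  exact: bigcupT_measurable.
by rewrite lee_fin ler_pdivlMr // mul1r leNgt hlam.
Qed.

End sparse_scales.

(** For fixed z the scales 2^i are split according to i modulo m = |z| + 1; each class is sparse for
    z because |z| <= 2^m. The bound lam does not depend on z, only the threshold n does. *)
Theorem ergodic_bound (d : nat) (R : realType) (A : nat)
  (P : probability (env d R) R) (f : env d R -> R) (lam : R) :
  (0 < A)%N -> stationary P -> ergodic P ->
  measurable_fun setT f -> (forall w, 0 <= f w) ->
  (\int[P]_w (f w)%:E < +oo)%E ->
  2 ^+ d * (2 * (13 * A) ^ d)%:R * fine (\int[P]_w (f w)%:E)%E < lam ->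
  {ae P, forall w, forall z : lattice d, exists n, forall i, (n <= i)%N ->
     window_sum f (A * 2 ^ i) (z *+ 2 ^ i) w <= lam * (2 ^+ i) ^+ d}.
Proof.
move=> A0 sP eP mf f0 fint hlam; apply: ae_forall_countable => z.
pose m := (supnorm z).+1.
have zm : (supnorm z <= 2 ^ m)%N by rewrite ltnW // (leq_trans (ltnSn _)) // ltnW // ltn_expl.
have : {ae P, forall w, forall b, exists n, forall j, (n <= j)%N ->
     window_sum f (A * scale m b j) (z *+ scale m b j) w <= lam * (scale m b j ^ d)%:R}.
  by apply: ae_forall_countable => b; exact: ergodic_bound_sparse.
apply: filterS => w /choice[n hn].
exists (\sum_(b < m) (b + m * n b))%N => i hi.
have im : (i %% m < m)%N by rewrite ltn_pmod.
have iE : (i %% m + m * (i %/ m))%N = i by rewrite mulnC addnC -divn_eq.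
have := hn (i %% m)%N (i %/ m)%N; rewrite /scale iE natrX natrX; apply.
have : (i %% m + m * n (i %% m) <= i)%N.
  by apply: leq_trans hi; rewrite (bigD1 (Ordinal im)) //= leq_addr.
by rewrite -[X in (_ <= X)%N -> _]iE leq_add2l leq_pmul2l.
Qed.

(** * Potential and solenoidal fields *)

Section neighbours.
Context {d : nat}.
Implicit Types (x y z : lattice d).

Lemma nearest_neighboursC x y : nearest_neighbours x y = nearest_neighbours y x.
Proof.
by congr (_ == _); apply: eq_bigr => i _; rewrite !latticeB -[in LHS]opprB sqrrN.
Qed.

Lemma nearest_neighboursD x y z : nearest_neighbours (x + z) (y + z) = nearest_neighbours x y.
Proof. by rewrite /nearest_neighbours opprD addrACA subrr addr0. Qed.

Lemma nearest_neighboursxx x : nearest_neighbours x x = false.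
Proof.
rewrite /nearest_neighbours big1 // => i _; by rewrite subrr mxE expr0n.
Qed.

Lemma nearest_neighbours0P x :
  reflect (exists i, x = unitv i \/ x = - unitv i) (nearest_neighbours 0 x).
Proof.
rewrite nearest_neighboursC /nearest_neighbours subr0; apply: (iffP eqP).
- move=> h.
  have [i xi] : exists i, x 0 i != 0.
    apply: contrapT => hn; move: h; rewrite big1 // => i _.
    have [->|xi] := eqVneq (x 0 i) 0; first by rewrite expr0n.
    by case: hn; exists i.
  move: h; rewrite (bigD1 i) //= => h.
  have r0 : 0 <= \sum_(j < d | j != i) x 0 j ^+ 2 by apply: sumr_ge0 => j _; exact: sqr_ge0.
  have xi1 : 1 <= x 0 i ^+ 2.
    rewrite -real_normK ?num_real // exprn_ege1 //.
    by move: (x 0 i) xi => z zn; lia.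
  have aux (u v : int) : u + v = 1 -> 1 <= u -> 0 <= v -> u = 1 /\ v = 0 by lia.
  have [e1 e0] := aux _ _ h xi1 r0.
  have xj j : j != i -> x 0 j = 0.
    move=> ji; apply/eqP; rewrite -sqrf_eq0; apply/eqP.
    apply: (psumr_eq0P (P := fun j => j != i) (F := fun j => x 0 j ^+ 2)) => // k _; exact: sqr_ge0.
  exists i; move: e1 => /eqP; rewrite sqrf_eq1 => /orP[]/eqP e; [left|right]; apply: latticeP => j;
    rewrite ?mxE ?unitvE; have [<-|ij] := eqVneq i j; rewrite ?e ?eqxx // xj // 1?eq_sym //.
- have sq i : \sum_(j < d) unitv i 0 j ^+ 2 = 1 :> int.
    rewrite (bigD1 i) //= unitvE eqxx big1 ?addr0 // => j ji.
    by rewrite unitvE eq_sym (negbTE ji) expr0n.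
  by move=> [i [->|->]] //; under eq_bigr do rewrite mxE sqrrN.
Qed.

Lemma nearest_neighbours_unitv x i : nearest_neighbours x (x + unitv i).
Proof.
rewrite -[X in nearest_neighbours X _]add0r [x + unitv i]addrC nearest_neighboursD.
by apply/nearest_neighbours0P; exists i; left.
Qed.

Lemma is_bondP x y : is_bond [fset x; y]%fset = nearest_neighbours x y.
Proof.
apply/asboolP/idP => [[x' [y' [nn e]]]|nn]; last by exists x, y.
have x'y' : x' != y' by apply: contraTneq nn => ->; rewrite nearest_neighboursxx.
have : (x' \in [fset x; y])%fset by rewrite e !inE eqxx.
have : (y' \in [fset x; y])%fset by rewrite e !inE eqxx orbT.
rewrite !inE => /orP[]/eqP Ey /orP[]/eqP Ex; move: nn x'y'; rewrite ?Ex ?Ey ?eqxx //.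
by rewrite nearest_neighboursC.
Qed.

Lemma unitv_inj : injective (@unitv d).
Proof.
move=> i j e; apply/eqP; have : unitv i 0 i = unitv j 0 i by rewrite e.
by rewrite !unitvE eqxx eq_sym; case: eqP.
Qed.

Lemma unitv_neqN i j : unitv i != - unitv j :> lattice d.
Proof.
apply/eqP => e; have : unitv i 0 i = (- unitv j) 0 i by rewrite e.
by rewrite [RHS]mxE !unitvE eqxx; case: eqP.
Qed.

End neighbours.

Section conductances.
Context {d : nat} {R : realType}.
Implicit Types (w : env d R) (x y z : lattice d).

Lemma conductanceE x y : nearest_neighbours x y ->
  exists2 e : bond d, val e = [fset x; y]%fset & forall w, conductance w x y = (w e)%:num.
Proof.
move=> nn; have h : is_bond [fset x; y]%fset by rewrite is_bondP.
exists (Sub [fset x; y]%fset h) => //= w.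
by rewrite /conductance insubT.
Qed.

Lemma conductance_eq0 w x y : ~~ nearest_neighbours x y -> conductance w x y = 0.
Proof. by move=> nn; rewrite /conductance insubF // is_bondP; exact/negbTE. Qed.

Lemma conductance_gt0 w x y : nearest_neighbours x y -> 0 < conductance w x y.
Proof. by move=> /conductanceE[e _ ->]. Qed.

Lemma conductance_ge0 w x y : 0 <= conductance w x y.
Proof.
by have [/(conductance_gt0 w)/ltW//|/(conductance_eq0 w)->] := boolP (nearest_neighbours x y).
Qed.

Lemma conductanceC w x y : conductance w x y = conductance w y x.
Proof. by rewrite /conductance fsetUC. Qed.

Lemma conductance_tau w x y z : conductance (tau z w) x y = conductance w (x + z) (y + z).
Proof.
have [nn|nn] := boolP (nearest_neighbours x y); last first.
  by rewrite !conductance_eq0 // nearest_neighboursD.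
have [e ve ->] := conductanceE nn.
have nn' : nearest_neighbours (x + z) (y + z) by rewrite nearest_neighboursD.
have [e' ve' ->] := conductanceE nn'.
rewrite /tau; congr ((w _)%:num); apply: val_inj; rewrite ve' /= ve.
apply/fsetP => u; rewrite !inE; apply/imfsetP/orP => /= [[v]|].
  by rewrite !inE => /orP[]/eqP -> ->; [left|right].
by case=> /eqP ->; [exists x|exists y]; rewrite ?inE ?eqxx ?orbT.
Qed.

Lemma measurable_conductance x y : measurable_fun [set: env d R] (fun w => conductance w x y).
Proof.
have [nn|nn] := boolP (nearest_neighbours x y).
  have [e _ E] := conductanceE nn.
  by rewrite (_ : (fun w => _) = fun w : env d R => (w e)%:num); [exact: measurable_coordinate|apply/funext].
rewrite (_ : (fun w => _) = cst 0); first exact: measurable_cst.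
by apply/funext => w; exact: conductance_eq0.
Qed.

Lemma fsbig_neighbours w (F : lattice d -> R) :
  \sum_(x \in [set: lattice d]) conductance w 0 x * F x =
  \sum_i (conductance w 0 (unitv i) * F (unitv i) + conductance w 0 (- unitv i) * F (- unitv i)).
Proof.
pose s : seq (lattice d) := [seq unitv i | i <- index_enum 'I_d] ++ [seq - unitv i | i <- index_enum 'I_d].
have us : uniq s.
  rewrite cat_uniq !map_inj_uniq ?index_enum_uniq ?andbT //=; last exact: unitv_inj.
    by apply/hasPn => _ /mapP[i _ ->]; apply/mapP => -[j _] /eqP; rewrite eq_sym; exact/negP/unitv_neqN.
  by move=> i j /oppr_inj; exact: unitv_inj.
rewrite -(@fsbig_widen _ _ _ _ [set` s] setT) //; last first.
  move=> x [_ /= /negP xs]; rewrite conductance_eq0 ?mul0r //.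
  apply: contra xs => /nearest_neighbours0P[i [->|->]]; rewrite mem_cat; apply/orP; [left|right];
    by apply/mapP; exists i; rewrite ?mem_index_enum.
by rewrite -fsbig_seq // big_cat !big_map big_split.
Qed.

End conductances.

(** * Integration in a stationary environment *)

Section integrability.
Context {d : nat} {R : realType}.
Variable P : probability (env d R) R.
Implicit Types (f g : env d R -> R) (x : lattice d).

Definition summable_rv f : Prop := P.-integrable setT (EFin \o f).

Lemma summable_rv_measurable f : summable_rv f -> measurable_fun setT f.
Proof. by move=> /integrableP[/measurable_EFinP]. Qed.

Lemma summable_rv_le f g : measurable_fun setT f -> (forall w, `|f w| <= g w) ->
  summable_rv g -> summable_rv f.
Proof.
move=> mf fg; apply: le_integrable => //; first exact/measurable_EFinP.
by move=> w _ /=; rewrite lee_fin (le_trans (fg w)) // ler_norm.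
Qed.

Lemma summable_rv_ge0 f : measurable_fun setT f -> (forall w, 0 <= f w) ->
  (\int[P]_w (f w)%:E < +oo)%E -> summable_rv f.
Proof.
move=> mf f0 fo; apply/integrableP; split; first exact/measurable_EFinP.
by under eq_integral do rewrite /= ger0_norm //.
Qed.

Lemma summable_rv_lty f : (forall w, 0 <= f w) -> summable_rv f -> (\int[P]_w (f w)%:E < +oo)%E.
Proof.
move=> f0 /integrableP[_]; apply: le_lt_trans; apply: eq_le_refl.
by apply: eq_integral => w _ /=; rewrite ger0_norm.
Qed.

Lemma summable_rvD f g : summable_rv f -> summable_rv g -> summable_rv (fun w => f w + g w).
Proof. by move=> hf hg; exact: (integrableD measurableT hf hg). Qed.

Lemma summable_rvN f : summable_rv f -> summable_rv (fun w => - f w).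
Proof. by move=> hf; exact: (integrableN hf). Qed.

Lemma summable_rvZ (r : R) f : summable_rv f -> summable_rv (fun w => r * f w).
Proof. by move=> hf; exact: (integrableZl measurableT r hf). Qed.

Lemma summable_rv_sum (I : Type) (s : seq I) (h : I -> env d R -> R) :
  (forall i, summable_rv (h i)) -> summable_rv (fun w => \sum_(i <- s) h i w).
Proof.
move=> hh; have := @integrable_sum _ _ _ P setT measurableT I s xpredT (fun i w => (h i w)%:E) (fun i _ => hh i).
by rewrite /summable_rv; congr (integrable _ _ _); apply/funext => w /=; rewrite sumEFin.
Qed.

Lemma summable_rv_cst (r : R) : summable_rv (fun=> r).
Proof. by apply: finite_measure_integrable_cst. Qed.

Lemma Rintegral_sum (I : Type) (s : seq I) (h : I -> env d R -> R) :
  (forall i, summable_rv (h i)) ->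
  Rintegral P setT (fun w => \sum_(i <- s) h i w) = \sum_(i <- s) Rintegral P setT (h i).
Proof.
move=> hh; elim: s => [|i s IH].
  rewrite big_nil; under eq_Rintegral do rewrite big_nil.
  by rewrite Rintegral_cst // mul0r.
rewrite big_cons -IH -RintegralD; [|exact: measurableT|exact: hh|exact: summable_rv_sum].
by apply: eq_Rintegral => w _; rewrite big_cons.
Qed.

Hypothesis sP : stationary P.

Lemma summable_rv_tau f x : summable_rv f -> summable_rv (fun w => f (tau x w)).
Proof.
move=> /integrableP[mf fo]; apply/integrableP; split.
  exact: (measurableT_comp mf (measurable_tau x)).
rewrite (integral_tau x sP (f := fun w => `|(f w)%:E|%E)) //.
exact: measurableT_comp mf.
Qed.

Lemma Rintegral_tau f x : summable_rv f ->
  Rintegral P setT (fun w => f (tau x w)) = Rintegral P setT f.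
Proof.
move=> hf; rewrite /Rintegral; congr fine; rewrite integralE [RHS]integralE.
have /integrableP[mf _] := hf.
congr (_ - _)%E.
  transitivity (\int[P]_w (EFin \o f)^\+ (tau x w))%E.
    by apply: eq_integral => w _; rewrite !funeposE.
  by apply: (integral_tau x sP) => //; exact: measurable_funepos.
transitivity (\int[P]_w (EFin \o f)^\- (tau x w))%E.
  by apply: eq_integral => w _; rewrite !funenegE.
by apply: (integral_tau x sP) => //; exact: measurable_funeneg.
Qed.

Lemma Rintegral_ae_eq f g : measurable_fun setT f -> measurable_fun setT g ->
  {ae P, forall w, f w = g w} -> Rintegral P setT f = Rintegral P setT g.
Proof.
move=> mf mg fg; rewrite /Rintegral; congr fine; apply: ae_eq_integral => //.
- exact/measurable_EFinP.
- exact/measurable_EFinP.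
- by apply: filterS fg => w e _; rewrite e.
Qed.

End integrability.

Section energy_density.
Context {d : nat} {R : realType}.
Variable P : probability (env d R) R.
Implicit Types Psi Phi : @rfield d R.

Definition nbr_sum (F : lattice d -> R) (w : env d R) : R :=
  \sum_i (conductance w 0 (unitv i) * F (unitv i) + conductance w 0 (- unitv i) * F (- unitv i)).

Lemma cov_sqnormE Psi :
  cov_sqnorm P Psi = (\int[P]_w (nbr_sum (fun x => Psi w x ^+ 2) w)%:E)%E.
Proof.
rewrite /cov_sqnorm unlock; apply: eq_integral => w _.
by rewrite (fsbig_neighbours w (fun x => Psi w x ^+ 2)).
Qed.

Lemma cov_innerE Psi Phi :
  cov_inner P Psi Phi = (\int[P]_w (nbr_sum (fun x => Psi w x * Phi w x) w)%:E)%E.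
Proof.
rewrite /cov_inner unlock; apply: eq_integral => w _.
congr (_%:E); apply: etrans (fsbig_neighbours w (fun x => Psi w x * Phi w x)).
by apply: eq_fsbigr => x _; rewrite mulrA.
Qed.

Lemma nbr_sum_ge0 F w : (forall x, 0 <= F x) -> 0 <= nbr_sum F w.
Proof.
by move=> F0; apply: sumr_ge0 => i _; rewrite addr_ge0 ?mulr_ge0 ?conductance_ge0.
Qed.

Lemma measurable_nbr_sum (F : env d R -> lattice d -> R) :
  (forall x, measurable_fun setT (F ^~ x)) ->
  measurable_fun setT (fun w => nbr_sum (F w) w).
Proof.
move=> mF; apply: measurable_sum => i.
by apply: measurable_funD; apply: measurable_funM => //; exact: measurable_conductance.
Qed.

Lemma summable_sqnorm Psi : L2cov P Psi -> summable_rv P (fun w => nbr_sum (fun x => Psi w x ^+ 2) w).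
Proof.
move=> [mPsi _]; rewrite cov_sqnormE => fo; apply: summable_rv_ge0 => //.
  by apply: measurable_nbr_sum => x; exact: measurable_funX.
by move=> w; apply: nbr_sum_ge0 => x; exact: sqr_ge0.
Qed.

Lemma nbr_term_le F w x : (forall x, 0 <= F x) -> nearest_neighbours 0 x ->
  conductance w 0 x * F x <= nbr_sum F w.
Proof.
move=> F0 /nearest_neighbours0P[i hx].
have t0 y : 0 <= conductance w 0 y * F y by rewrite mulr_ge0 ?conductance_ge0.
rewrite /nbr_sum (bigD1 i) //= ler_wpDr //.
  by apply: sumr_ge0 => k _; rewrite addr_ge0.
by case: hx => ->; rewrite ?lerDl ?lerDr.
Qed.

End energy_density.

Section solenoidal.
Context {d : nat} {R : realType}.
Variable P : probability (env d R) R.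
Hypotheses (sP : stationary P) (hc : forall x, summable_rv P (fun w => conductance w 0 x)).
Implicit Types Psi : @rfield d R.

Definition flux Psi (x : lattice d) (w : env d R) : R := conductance w 0 x * Psi w x.

Definition divergence Psi (w : env d R) : R :=
  \sum_i (flux Psi (unitv i) w + flux Psi (- unitv i) w).

Lemma measurable_flux Psi x : (forall x, measurable_fun setT (Psi ^~ x)) ->
  measurable_fun setT (flux Psi x).
Proof. by move=> mPsi; apply: measurable_funM => //; exact: measurable_conductance. Qed.

(** From |t| <= 1 + t^2 the flux is dominated by the conductance plus the energy density. *)
Lemma summable_flux Psi x : L2cov P Psi -> summable_rv P (flux Psi x).
Proof.
move=> L; have [mPsi _ _] := L; have S := summable_sqnorm L.
apply: summable_rv_le (summable_rvD (hc x) S); first exact: measurable_flux.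
move=> w; rewrite /flux; have c0 := conductance_ge0 w 0 x.
have n0 : 0 <= nbr_sum (fun x => Psi w x ^+ 2) w by apply: nbr_sum_ge0 => y; exact: sqr_ge0.
have [nn|nn] := boolP (nearest_neighbours 0 x); last first.
  by rewrite conductance_eq0 // mul0r normr0 add0r.
apply: (@le_trans _ _ (conductance w 0 x + conductance w 0 x * Psi w x ^+ 2)).
  rewrite normrM ger0_norm // -[X in _ <= X + _]mulr1 -mulrDr ler_wpM2l //.
  have := sqr_ge0 (`|Psi w x| - 1); rewrite sqrrB expr1n mulr1 real_normK ?num_real //.
  by have := normr_ge0 (Psi w x); lra.
rewrite lerD2l; apply: (nbr_term_le (F := fun y => Psi w y ^+ 2)) => // y; exact: sqr_ge0.
Qed.

Lemma summable_rv_bounded (f phi : env d R -> R) : summable_rv P f -> measurable_fun setT phi ->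
  (forall w, `|phi w| <= 1) -> summable_rv P (fun w => f w * phi w).
Proof.
move=> sf mphi h1; have mf := summable_rv_measurable sf.
apply: (summable_rv_le (g := fun w => `|f w|)).
- exact: measurable_funM.
- by move=> w; rewrite normrM ler_piMr.
- exact: (integrable_abse sf).
Qed.

Lemma cocycle0 Psi : cocycle P Psi -> {ae P, forall w, Psi w 0 = 0}.
Proof.
apply: filterS => w /(_ 0 0); rewrite subrr tau0 subrr => h; exact: h.
Qed.

(* Stationarity turns the edge (0, x) seen from x into the edge (0, -x) seen from 0. *)
Lemma Rintegral_flux_tau Psi (phi : env d R -> R) x : L2cov P Psi -> measurable_fun setT phi ->
  (forall w, `|phi w| <= 1) ->
  Rintegral P setT (fun w => flux Psi x w * phi (tau x w)) =
  - Rintegral P setT (fun w => flux Psi (- x) w * phi w).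
Proof.
move=> L mphi h1; have [mPsi cPsi _] := L.
have sg : summable_rv P (fun w => flux Psi (- x) w * phi w).
  by apply: summable_rv_bounded => //; exact: summable_flux.
have mphit : measurable_fun setT (fun w : env d R => phi (tau x w)).
  exact: (measurableT_comp mphi (measurable_tau x)).
rewrite -(Rintegral_tau sP x sg) -mulN1r -RintegralZl //; last exact: (summable_rv_tau sP x sg).
apply: Rintegral_ae_eq.
- by apply: measurable_funM => //; exact: measurable_flux.
- apply: measurable_funM => //; exact: (summable_rv_measurable (summable_rv_tau sP x sg)).
have := cocycle0 cPsi; move: cPsi; apply: filterS2 => w hw h0.
rewrite /flux conductance_tau add0r addNr conductanceC.
have := hw x 0; rewrite sub0r h0 sub0r => ->.
by rewrite mulN1r mulrN mulNr opprK.
Qed.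

Lemma L2cov_hderiv (phi : env d R -> R) (b : R) : measurable_fun setT phi -> (forall w, `|phi w| <= b) ->
  L2cov P (hderiv phi).
Proof.
move=> mphi hb; have mh x : measurable_fun setT (@hderiv d R phi ^~ x).
  by apply: measurable_funB => //; exact: (measurableT_comp mphi (measurable_tau x)).
split => //.
  by apply: aeW => w x y; rewrite /hderiv tauD subrK; ring.
rewrite cov_sqnormE; apply: summable_rv_lty.
  by move=> w; apply: nbr_sum_ge0 => x; exact: sqr_ge0.
apply: (summable_rv_le (g := fun w => (2 * b) ^+ 2 * nbr_sum (fun=> 1) w)).
- by apply: measurable_nbr_sum => x; exact: measurable_funX.
- move=> w; rewrite ger0_norm; last by apply: nbr_sum_ge0 => x; exact: sqr_ge0.
  rewrite /nbr_sum mulr_sumr; apply: ler_sum => i _; rewrite mulrDr.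
  have sq x : hderiv phi w x ^+ 2 <= (2 * b) ^+ 2.
    rewrite -real_normK ?num_real // ler_sqr ?nnegrE ?mulr_ge0 //.
      by rewrite (le_trans (ler_normB _ _)) // mulrDl mul1r lerD.
    exact: le_trans (hb w).
  by apply: lerD; rewrite mulr1 mulrC ler_wpM2r ?conductance_ge0.
- apply: summable_rvZ; apply: summable_rv_sum => i.
  by apply: summable_rvD; under eq_fun do rewrite mulr1; exact: hc.
Qed.

Lemma L2pot_hderiv (phi : env d R -> R) (b : R) : measurable_fun setT phi -> is_local phi ->
  (forall w, `|phi w| <= b) -> L2pot P (hderiv phi).
Proof.
move=> mphi lphi hb; have L := L2cov_hderiv mphi hb; split=> // eps e0.
exists phi; split=> //; rewrite cov_sqnormE.
rewrite (_ : (fun w => _) = cst 0%E); first by rewrite integral0 lte_fin exprn_gt0.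
by apply/funext => w; rewrite /nbr_sum big1 // => i _; rewrite !subrr expr0n mulr0 mulr0 addr0.
Qed.

Lemma summable_divergence Psi : L2cov P Psi -> summable_rv P (divergence Psi).
Proof.
by move=> L; apply: summable_rv_sum => i; apply: summable_rvD; exact: summable_flux.
Qed.

(** Orthogonality to the gradient of phi involves the terms flux * phi(tau x w) and flux * phi(w).
    [Rintegral_flux_tau] turns the former into minus the latter at the opposite neighbour, so the
    inner product is -2 times the integral sought. *)
Lemma Rintegral_divergence_local Psi (phi : env d R -> R) : L2sol P Psi ->
  measurable_fun setT phi -> is_local phi -> (forall w, `|phi w| <= 1) ->
  Rintegral P setT (fun w => divergence Psi w * phi w) = 0.
Proof.
move=> [L hPsi] mphi lphi h1.
have := hPsi _ (L2pot_hderiv mphi lphi h1); rewrite cov_innerE => /(congr1 fine) /= h.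
pose k x w := flux Psi x w * phi (tau x w).
pose l x w := flux Psi x w * phi w.
have mphit x : measurable_fun setT (fun w : env d R => phi (tau x w)).
  exact: (measurableT_comp mphi (measurable_tau x)).
have sk x : summable_rv P (k x) by apply: summable_rv_bounded => //; exact: summable_flux.
have sl x : summable_rv P (l x) by apply: summable_rv_bounded => //; exact: summable_flux.
have kl x : Rintegral P setT (k x) = - Rintegral P setT (l (- x)) by exact: Rintegral_flux_tau.
have E1 : Rintegral P setT (fun w =>
    \sum_i ((k (unitv i) w - l (unitv i) w) + (k (- unitv i) w - l (- unitv i) w))) = 0.
  rewrite -[RHS]h; congr fine; apply: eq_integral => w _; congr (_%:E); apply: eq_bigr => i _.
  by rewrite /k /l /flux /hderiv; ring.
rewrite Rintegral_sum in E1; last first.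
  by move=> i; apply: summable_rvD; apply: summable_rvD => //; exact: summable_rvN.
have E2 : Rintegral P setT (fun w => divergence Psi w * phi w) =
    \sum_i (Rintegral P setT (l (unitv i)) + Rintegral P setT (l (- unitv i))).
  transitivity (Rintegral P setT (fun w => \sum_i (l (unitv i) w + l (- unitv i) w))).
    by apply: eq_Rintegral => w _; rewrite /divergence mulr_suml; apply: eq_bigr => i _; rewrite mulrDl.
  rewrite Rintegral_sum; last by move=> i; exact: summable_rvD.
  apply: eq_bigr => i _; rewrite RintegralD; [by []|exact: measurableT|exact: sl|exact: sl].
have E3 : \sum_i (- 2 * (Rintegral P setT (l (unitv i)) + Rintegral P setT (l (- unitv i)))) = 0.
  rewrite -[RHS]E1; apply: eq_bigr => i _.
  have skl x : summable_rv P (fun w => k x w - l x w) by apply: summable_rvD => //; exact: summable_rvN.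
  rewrite RintegralD; [|exact: measurableT|exact: skl|exact: skl].
  have klB x : Rintegral P setT (fun w => k x w - l x w) = Rintegral P setT (k x) - Rintegral P setT (l x).
    by rewrite RintegralB; [by []|exact: measurableT|exact: sk|exact: sl].
  by rewrite !klB !kl opprK; ring.
by move: E3; rewrite -mulr_sumr -E2 => /eqP; rewrite mulf_eq0 oppr_eq0 pnatr_eq0 /= => /eqP.
Qed.

(* Orthogonality to the gradients of indicators of local events, which form a pi-system
   generating the sigma-algebra. *)
Lemma divergence_ae0 Psi : L2sol P Psi -> {ae P, forall w, divergence Psi w = 0}.
Proof.
move=> S; have L : L2cov P Psi by case: S.
have sH := summable_divergence L.
pose G := [set A : set (env d R) | measurable A /\ exists s : seq (bond d),
  forall w w' : env d R, {in s, w =1 w'} -> A w -> A w'].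
have GA A : G A -> Rintegral P setT (fun w => divergence Psi w * \1_A w) = 0.
  move=> [mA [s hs]]; apply: Rintegral_divergence_local S _ _ _.
  - exact: measurable_indic.
  - exists s => w w' ww'; rewrite !indicE; congr (_%:R); congr (nat_of_bool _).
    have ww'' : {in s, w' =1 w} by move=> e es; rewrite ww'.
    by apply/idP/idP; rewrite !inE; exact: hs.
  - by move=> w; rewrite indicE; case: (_ \in _); rewrite ?normr1 ?normr0.
pose Q (A : set (env d R)) := (\int[P]_(w in A) (divergence Psi w)%:E = 0)%E.
have QA A : measurable A -> Rintegral P setT (fun w => divergence Psi w * \1_A w) = 0 -> Q A.
  move=> mA h; rewrite /Q integral_mkcond.
  have sA : summable_rv P (fun w => divergence Psi w * \1_A w).
    apply: (summable_rv_bounded sH); first exact: measurable_indic.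
    by move=> w; rewrite indicE; case: (_ \in _); rewrite ?normr1 ?normr0.
  transitivity (\int[P]_w (divergence Psi w * \1_A w)%:E)%E.
    apply: eq_integral => w _; rewrite /patch indicE.
    by case: (w \in A); rewrite ?mulr1 ?mulr0.
  by rewrite -[LHS]fineK ?(integrable_fin_num measurableT sA) //; congr (_%:E).
have EG : @measurable _ (env d R) = <<s G >>.
  apply/seteqP; split.
    apply: smallest_sub; first exact: smallest_sigma_algebra.
    move=> _ [e [B [mB ->]]]; apply: sub_sigma_algebra; split.
      by rewrite -[X in measurable X]setTI; exact: measurable_coordinate.
    by exists [:: e] => w w' ww' /=; rewrite (ww' e) ?mem_head.
  by apply: smallest_sub; [exact: sigma_algebra_measurable|move=> A []].
have main : forall A, <<s G >> A -> Q A.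
  have GI : setI_closed G.
    move=> A B [mA [s1 h1]] [mB [s2 h2]]; split; first exact: measurableI.
    exists (s1 ++ s2) => w w' ww' [Aw Bw]; split; [apply: h1 Aw|apply: h2 Bw] => e es;
      by apply: ww'; rewrite mem_cat es ?orbT.
  have QT : Q setT.
    apply: QA; first exact: measurableT.
    by apply: GA; split; [exact: measurableT|exists [::]].
  apply: (@dynkin_induction _ (env d R) G Q EG GI QT).
  - by move=> A hA; apply: QA; [case: hA|exact: GA].
  - move=> A mA hA; rewrite /Q -setTD.
    have U : (\int[P]_(w in setT) (divergence Psi w)%:E =
        \int[P]_(w in A) (divergence Psi w)%:E +
        \int[P]_(w in setT `\` A) (divergence Psi w)%:E)%E.
      rewrite -integral_setU //; first by rewrite setDUK.
      - exact: measurableD.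
      - rewrite setDUK //; apply/measurable_EFinP; exact: (summable_rv_measurable sH).
      - by rewrite disj_set2E setDIK.
    by move: U; rewrite hA add0e => <-.
  - move=> F mF tF hF; rewrite /Q integral_bigcup //; last first.
      by apply: integrableS sH => //; exact: bigcupT_measurable.
    by apply: eseries0 => i _ _; exact: hF.
have : ae_eq P setT (EFin \o divergence Psi) (cst 0%E).
  apply: integral_ae_eq => //.
  by move=> E _ mE; rewrite integral0; apply: main; rewrite -EG.
by apply: filterS => w /(_ Logic.I) [].
Qed.

End solenoidal.

(** * Approximation of potential fields by gradients of bounded functions *)

Section truncation.
Context {R : realType}.

Definition truncate (M t : R) : R := Num.max (- M) (Num.min t M).

Lemma truncate_le M t : 0 <= M -> `|truncate M t| <= M.
Proof.
move=> M0; rewrite ler_norml /truncate le_max lexx /= ge_max ge_min lexx orbT andbT; lra.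
Qed.

Lemma truncate_id M t : `|t| <= M -> truncate M t = t.
Proof.
by rewrite ler_norml => /andP[h1 h2]; rewrite /truncate (min_idPl h2) (max_idPr h1).
Qed.

Lemma truncate_lip M t u : 0 <= M -> `|truncate M t - truncate M u| <= `|t - u|.
Proof.
move=> M0; wlog tu : t u / u <= t.
  by move=> h; have [/h//|/ltW/h] := leP u t; rewrite distrC [leRHS]distrC.
have mon : truncate M u <= truncate M t.
  by rewrite /truncate ge_max !le_max lexx /= le_min !ge_min tu lexx !orbT.
rewrite !ger0_norm ?subr_ge0 // /truncate.
have [h1|h1] := leP t M; have [h2|h2] := leP u M; have [h3|h3] := leP (- M) t;
  have [h4|h4] := leP (- M) u; have [h5|h5] := leP (- M) M; lra.
Qed.

End truncation.

Section potential.
Context {d : nat} {R : realType}.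
Variable P : probability (env d R) R.
Implicit Types Psi : @rfield d R.

(** Dominated convergence, without integrability of phi itself: truncation is 1-Lipschitz, so 4
    times the energy density of phi dominates, and for each w the error is zero once n exceeds the
    finitely many values of phi involved. *)
Lemma L2cov_truncate (phi : env d R -> R) : measurable_fun setT phi -> L2cov P (hderiv phi) ->
  forall e : R, 0 < e -> exists n : nat,
  (cov_sqnorm P (fun w x => (hderiv phi w x - hderiv (fun w => truncate n%:R (phi w)) w x)%R) < e%:E)%E.
Proof.
move=> mphi L e e0.
pose psi n (w : env d R) := truncate n%:R (phi w).
have mpsi n : measurable_fun setT (psi n).
  by apply: measurable_maxr => //; apply: measurable_minr.
have mh (f : env d R -> R) x : measurable_fun setT f -> measurable_fun setT (@hderiv d R f ^~ x).
  by move=> mf; apply: measurable_funB => //; exact: (measurableT_comp mf (measurable_tau x)).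
pose g n w := nbr_sum (fun x => (hderiv phi w x - hderiv (psi n) w x) ^+ 2) w.
have mg n : measurable_fun setT (g n).
  by apply: measurable_nbr_sum => x; apply: measurable_funX; apply: measurable_funB; exact: mh.
have g0 n w : 0 <= g n w by apply: nbr_sum_ge0 => x; exact: sqr_ge0.
pose G w := 4 * nbr_sum (fun x => hderiv phi w x ^+ 2) w.
have sG : summable_rv P G by apply: summable_rvZ; exact: summable_sqnorm.
have gG n w : g n w <= G w.
  rewrite /G /nbr_sum mulr_sumr; apply: ler_sum => i _; rewrite mulrDr.
  have sq x : (hderiv phi w x - hderiv (psi n) w x) ^+ 2 <= 4 * hderiv phi w x ^+ 2.
    have h : `|hderiv (psi n) w x| <= `|hderiv phi w x| by exact: truncate_lip.
    have h2 : hderiv (psi n) w x ^+ 2 <= hderiv phi w x ^+ 2.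
      by rewrite -real_normK ?num_real // -[leRHS]real_normK ?num_real // ler_sqr ?nnegrE.
    move: h2; set A := hderiv phi w x; set B := hderiv (psi n) w x => h2.
    by have := sqr_ge0 (A + B); nra.
  by apply: lerD; rewrite [leRHS]mulrCA ler_wpM2l ?conductance_ge0.
have lim0 w : (g n w)%:E @[n --> \oo] --> (0 : \bar R)%E.
  pose M := \sum_i (`|phi (tau (unitv i) w)| + `|phi (tau (- unitv i) w)|) + `|phi w|.
  apply: cvg_near_cst; exists (Num.truncn M).+1 => // n /= Nn; congr (_%:E).
  have Mn : M <= n%:R.
    by apply/ltW/(lt_le_trans (real_truncnS_gt (num_real M))); rewrite ler_nat.
  have w0 : `|phi w| <= n%:R by apply: le_trans Mn; rewrite lerDr; apply: sumr_ge0 => i _; rewrite addr_ge0.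
  have h i : `|phi (tau (unitv i) w)| <= n%:R /\ `|phi (tau (- unitv i) w)| <= n%:R.
    have hs : `|phi (tau (unitv i) w)| + `|phi (tau (- unitv i) w)| <= n%:R.
      apply: le_trans Mn; rewrite /M (bigD1 i) //= -addrA lerDl addr_ge0 //.
      by apply: sumr_ge0 => j _; rewrite addr_ge0.
    by split; apply: le_trans hs; rewrite ?lerDl ?lerDr.
  rewrite /g /nbr_sum big1 // => i _; have [h1 h2] := h i.
  by rewrite /hderiv /psi !truncate_id // !subrr expr0n !mulr0 addr0.
have bd w n : (`|(g n w)%:E| <= (EFin \o G) w)%E by rewrite /= lee_fin ger0_norm.
have mgE n : measurable_fun setT (fun w => (g n w)%:E) by apply/measurable_EFinP; exact: mg.
have [_ _ cv] := @dominated_convergence _ _ _ P setT measurableT (fun n w => (g n w)%:E) (cst 0%E) (EFin \o G)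
  mgE (measurable_cst _) (aeW _ (fun w _ => lim0 w)) sG (aeW _ (fun w n _ => bd w n)).
apply: contrapT => hn.
have : (e%:E <= limn (fun n => \int[P]_w (g n w)%:E))%E.
  apply: lime_ge; first by apply/cvg_ex; eexists; exact: cv.
  apply: nearW => n; rewrite leNgt; apply/negP => h; apply: hn; exists n.
  by rewrite cov_sqnormE.
by rewrite (cvg_lim _ cv) // integral0 lee_fin leNgt e0.
Qed.

(* Truncation is a contraction, so it does not enlarge gradients. *)
Lemma L2pot_bounded_approx Psi (e : R) : L2pot P Psi -> 0 < e ->
  exists (psi : env d R -> R) (b : R), [/\ measurable_fun setT psi, 0 <= b, forall w, `|psi w| <= b &
   (\int[P]_w (nbr_sum (fun x => (Psi w x - hderiv psi w x) ^+ 2) w)%:E < e%:E)%E].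
Proof.
move=> [L hP] e0.
have e40 : 0 < e / 4 by rewrite divr_gt0.
have [phi [mphi _ Lphi]] := hP (Num.sqrt (e / 4)) (etrans (sqrtr_gt0 _) e40).
rewrite sqr_sqrtr ?(ltW e40) // cov_sqnormE => h1.
have [n] := L2cov_truncate mphi Lphi e40; rewrite cov_sqnormE => h2.
pose psi (w : env d R) := truncate n%:R (phi w).
have mpsi : measurable_fun setT psi by apply: measurable_maxr => //; apply: measurable_minr.
exists psi, n%:R; split=> // [w|]; first exact: truncate_le.
have mh (f : env d R -> R) x : measurable_fun setT f -> measurable_fun setT (@hderiv d R f ^~ x).
  by move=> mf; apply: measurable_funB => //; exact: (measurableT_comp mf (measurable_tau x)).
have mPsi x : measurable_fun setT (Psi ^~ x) by case: L.
pose g1 w := nbr_sum (fun x => (Psi w x - hderiv phi w x) ^+ 2) w.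
pose g2 w := nbr_sum (fun x => (hderiv phi w x - hderiv psi w x) ^+ 2) w.
have mg1 : measurable_fun setT g1.
  by apply: measurable_nbr_sum => x; apply: measurable_funX; apply: measurable_funB => //; exact: mh.
have mg2 : measurable_fun setT g2.
  by apply: measurable_nbr_sum => x; apply: measurable_funX; apply: measurable_funB; exact: mh.
have g10 w : 0 <= g1 w by apply: nbr_sum_ge0 => x; exact: sqr_ge0.
have g20 w : 0 <= g2 w by apply: nbr_sum_ge0 => x; exact: sqr_ge0.
have le12 : (\int[P]_w (nbr_sum (fun x => (Psi w x - hderiv psi w x) ^+ 2) w)%:E <=
    \int[P]_w (2%:E * ((g1 w)%:E + (g2 w)%:E)))%E.
  apply: ge0_le_integral => //.
  - by move=> w _; rewrite lee_fin; apply: nbr_sum_ge0 => x; exact: sqr_ge0.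
  - apply/measurable_EFinP; apply: measurable_nbr_sum => x; apply: measurable_funX.
    by apply: measurable_funB => //; exact: mh.
  - apply/measurable_EFinP; apply: measurable_funM => //; exact: measurable_funD.
  - move=> w _; rewrite -EFinD -EFinM lee_fin /g1 /g2 /nbr_sum -big_split mulr_sumr /=.
    apply: ler_sum => i _.
    have sq (A B C : R) : (A - C) ^+ 2 <= 2 * ((A - B) ^+ 2 + (B - C) ^+ 2).
      by have := sqr_ge0 ((A - B) - (B - C)); nra.
    have K (c c' X X' A A' B B' : R) : 0 <= c -> 0 <= c' -> X <= 2 * (A + B) -> X' <= 2 * (A' + B') ->
        c * X + c' * X' <= 2 * ((c * A + c' * A') + (c * B + c' * B')).
      by move=> c0 c'0 hX hX'; have := ler_wpM2l c0 hX; have := ler_wpM2l c'0 hX'; lra.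
    by apply: K; rewrite ?conductance_ge0 ?sq.
apply: le_lt_trans le12 _; rewrite ge0_integralZl_EFin //; last 2 first.
- by move=> w _; rewrite -EFinD lee_fin addr_ge0.
- by apply: emeasurable_funD; apply/measurable_EFinP.
rewrite ge0_integralD //; try (by move=> w _; rewrite lee_fin); try (by apply/measurable_EFinP).
apply: (@lt_le_trans _ _ (2%:E * ((e / 4)%:E + (e / 4)%:E))%E).
  by rewrite lte_pmul2l // lteD.
by rewrite -EFinD -EFinM lee_fin; lra.
Qed.

End potential.

(** * Choice of the exponents *)

Section moments.
Context {R : realType}.

Definition inve_real (p : \bar R) : R := if p is r%:E then r^-1 else 0.

Lemma inve_realE p : (1 < p)%E -> (p^-1 = (inve_real p)%:E)%E.
Proof.
case: p => [r r1|_|]; last 2 first.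
- by rewrite invey.
- by [].
by rewrite inver gt_eqF //; move: r1; rewrite lte_fin; lra.
Qed.

(** An infinite exponent is replaced by a large finite one at the price e in its inverse, which the
    strict inequality between the exponents can afford. *)
Lemma finite_exponent (p : \bar R) (e : R) : (1 < p)%E -> 0 < e ->
  exists r : R, [/\ 1 < r, r^-1 <= inve_real p + e &
   forall (d : nat) (P : probability (env d R) R) (X : env d R -> R),
     measurable_fun setT X -> (forall w, 0 <= X w) -> has_moment P p X ->
     summable_rv P (fun w => X w `^ r)].
Proof.
case: p => [r| |] //= p1 e0.
  exists r; split => //; first by rewrite lerDl ltW.
  move=> d P X mX X0; rewrite unlock => h; apply: summable_rv_ge0 => //.
    exact: (measurableT_comp (measurable_powR r) mX).
  by move=> w; exact: powR_ge0.
pose r := Num.max 2 e^-1.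
have r2 : 2 <= r by rewrite le_max lexx.
have r0 : 0 < r by lra.
exists r; split; first by lra.
  by rewrite add0r invf_ple ?posrE // le_max lexx orbT.
move=> d P X mX X0 [M hM]; apply: summable_rv_ge0.
- exact: (measurableT_comp (measurable_powR r) mX).
- by move=> w; exact: powR_ge0.
apply: (@le_lt_trans _ _ (\int[P]_w (M `^ r)%:E)%E); last first.
  rewrite integral_cst; last exact: measurableT.
  by rewrite ltey_eq fin_numM // fin_num_measure.
apply: ae_ge0_le_integral => //.
- by move=> w _; rewrite lee_fin powR_ge0.
- by apply/measurable_EFinP; exact: (measurableT_comp (measurable_powR r) mX).
- by move=> w _; rewrite lee_fin powR_ge0.
apply: filterS hM => w hw _; rewrite lee_fin; apply: powRr_le => //; last exact: ltW.
by move: hw; rewrite ger0_norm.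
Qed.

(** With 1/s = 1/2 + 1/(2q') + ep, 1/t = (1 - 1/p')/2 and m = d - 1, the Sobolev exponent equals m
    (1/m - (1/p' + 1/q')/2 - ep), positive for small ep by the assumption on p and q. The Hölder
    weights then leave th = s ep. *)
Lemma exponents (d : nat) (p q : \bar R) : (3 <= d)%N -> (1 < p)%E -> (1 < q)%E ->
  (p^-1 + q^-1 < (2 / (d%:R - 1))%:E)%E ->
  exists p' q' s t th : R,
  [/\ [/\ 1 < p', 0 < q', 1 < s, s <= t & t * (1 - p'^-1) = 2],
     0 < 1 + d.-1%:R / t - d.-1%:R / s, 0 < th & s / 2 + s / (2 * q') + th = 1] /\
   forall (P : probability (env d R) R) (X : env d R -> R),
     measurable_fun setT X -> (forall w, 0 <= X w) ->
     (has_moment P p X -> summable_rv P (fun w => X w `^ p')) /\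
     (has_moment P q X -> summable_rv P (fun w => X w `^ q')).
Proof.
move=> hd p1 q1; rewrite (inve_realE p1) (inve_realE q1) -EFinD lte_fin => hpq.
have dm : d%:R - 1 = d.-1%:R :> R by rewrite -(ltn_predK hd) /= -natr1 addrK.
rewrite dm in hpq; pose m : R := d.-1%:R; rewrite -/m in hpq *.
have m0 : 0 < m by rewrite ltr0n; case: (d) hd => [|[]].
(* A quarter of the gap: two exponents may each lose e and half of the gap remains. *)
pose e := (2 / m - (inve_real p + inve_real q)) / 4.
have e0 : 0 < e by rewrite divr_gt0 // subr_gt0.
have [p' [p'1 hp' mp]] := finite_exponent p1 e0.
have [q' [q'1 hq' mq]] := finite_exponent q1 e0.
have hPQ : p'^-1 + q'^-1 < 2 / m by rewrite /e in hp' hq' e0; lra.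
have p'0 : 0 < p' by lra.
have q'0 : 0 < q' by lra.
have P1 : 0 < p'^-1 < 1 by rewrite invr_gt0 p'0 invf_lt1.
have Q1 : 0 < q'^-1 < 1 by rewrite invr_gt0 q'0 invf_lt1.
move: (P1) (Q1) => /andP[P0 P1'] /andP[Q0 Q1'].
have hm : 2 / m = 2 * m^-1 by [].
(* The first bound ensures s > 1, the second a positive Sobolev exponent; halving makes both
   strict. *)
pose ep := Num.min (2^-1 - q'^-1 / 2) (m^-1 - (p'^-1 + q'^-1) / 2) / 2.
have ep0 : 0 < ep by rewrite divr_gt0 // lt_min; apply/andP; split; lra.
have ep1 : ep < 2^-1 - q'^-1 / 2.
  have : ep * 2 <= 2^-1 - q'^-1 / 2 by rewrite /ep divfK // ge_min lexx.
  by lra.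
have ep2 : ep < m^-1 - (p'^-1 + q'^-1) / 2.
  have : ep * 2 <= m^-1 - (p'^-1 + q'^-1) / 2 by rewrite /ep divfK // ge_min lexx orbT.
  by lra.
pose sg := 2^-1 + q'^-1 / 2 + ep.
have sg0 : 0 < sg by rewrite /sg; lra.
have sg1 : sg < 1 by rewrite /sg; lra.
have sgh : 2^-1 < sg by rewrite /sg; lra.
pose s := sg^-1; pose t := 2 / (1 - p'^-1).
have pp : 0 < 1 - p'^-1 by lra.
have s0 : 0 < s by rewrite invr_gt0.
have s1 : 1 < s by rewrite /s invf_gt1.
have s2 : s < 2 by rewrite /s invf_plt ?posrE.
have t2 : 2 <= t by rewrite /t ler_pdivlMr //; lra.
exists p', q', s, t, (s * ep); split; last first.
  by move=> P X mX X0; split => h; [exact: mp|exact: mq].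
split.
- by split => //; [lra|rewrite /t divfK // gt_eqF].
- rewrite /t /s invrK invf_div.
  have -> : 1 + m * ((1 - p'^-1) / 2) - m * sg = m * (m^-1 - (p'^-1 + q'^-1) / 2 - ep).
    by rewrite /sg; field; rewrite gt_eqF // !gt_eqF.
  by rewrite mulr_gt0 //; lra.
- by rewrite mulr_gt0.
- have e1 : s * sg = 1 by rewrite /s mulVf // gt_eqF.
  have E (x : R) : x / 2 + x / (2 * q') + x * ep = x * sg by rewrite /sg; field; rewrite gt_eqF.
  by rewrite E e1.
Qed.

End moments.

(** * Sublinearity of the corrector *)

Section edge_weights.
Context {d : nat} {R : realType}.
Implicit Types (w : env d R) (x z : lattice d) (Psi : @rfield d R).

Definition edge_weight w x (i : 'I_d) : R := conductance w x (x + unitv i).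

Lemma edge_weight_gt0 w x i : 0 < edge_weight w x i.
Proof. by apply: conductance_gt0; exact: nearest_neighbours_unitv. Qed.

Lemma edge_weight_tau w x z i : edge_weight (tau z w) x i = edge_weight w (x + z) i.
Proof. by rewrite /edge_weight conductance_tau addrAC. Qed.

Lemma speed_tau w x z : speed (edge_weight (tau z w)) x = speed (edge_weight w) (x + z).
Proof. by apply: eq_bigr => i _; rewrite !edge_weight_tau addrAC. Qed.

Definition cocycle_at Psi w : Prop :=
  forall x y, Psi (tau x w) (y - x) = Psi w y - Psi w x.

Lemma cocycle_at_tau Psi w z : cocycle_at Psi w -> cocycle_at Psi (tau z w).
Proof.
move=> h x y; rewrite tauD.
have h2 u : Psi (tau z w) u = Psi w (u + z) - Psi w z by rewrite -h addrK.
have := h (x + z) (y + z); rewrite opprD addrACA subrr addr0 => ->.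
by rewrite !h2; ring.
Qed.

Lemma grad_cocycle Psi w x i : cocycle_at Psi w -> grad (Psi w) i x = Psi (tau x w) (unitv i).
Proof. by move=> h; rewrite /grad -h addrAC subrr add0r. Qed.

Lemma energy_window Psi w r : cocycle_at Psi w ->
  \sum_(x <- zball r) \sum_i edge_weight w x i * (grad (Psi w) i x) ^+ 2 <=
  window_sum (fun w => nbr_sum (fun x => Psi w x ^+ 2) w) r 0 w.
Proof.
move=> h; apply: ler_sum => x _; apply: ler_sum => i _.
rewrite addr0 (grad_cocycle _ _ h) -[X in edge_weight w X _]add0r -edge_weight_tau.
by rewrite /edge_weight add0r lerDl mulr_ge0 ?conductance_ge0 ?sqr_ge0.
Qed.

Lemma sum_window (f : env d R -> R) w r :
  \sum_(x <- zball r) f (tau x w) = window_sum f r 0 w.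
Proof. by apply: eq_bigr => x _; rewrite addr0. Qed.

Lemma measurable_edge_weight x i : measurable_fun setT (fun w : env d R => edge_weight w x i).
Proof. exact: measurable_conductance. Qed.

End edge_weights.

(** Sobolev's inequality is available on dyadic boxes and the averages on balls; this nearly centred
    box lies between two balls of comparable radii. *)
Definition dyadic_box (d n : nat) : seq (lattice d) :=
  rect (\row_i (- (2 ^ n)%N%:Z)) (dyadic_sides [set: 'I_d]%SET n.+1).

Lemma dyadic_box_sub d n k : {subset dyadic_box d (n + k) <= zball (2 ^ k * 2 ^ n)}.
Proof.
move=> x /mem_rectP hx; rewrite mem_zball; apply/supnorm_leP => i; have := hx i.
rewrite /dyadic_sides inE mxE expnS -expnD [(k + n)%N]addnC.
by move: (x 0 i) (2 ^ (n + k))%N => u v; lia.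
Qed.

Lemma sub_dyadic_box d A n k : (A < 2 ^ k)%N -> {subset zball (A * 2 ^ n) <= dyadic_box d (n + k)}.
Proof.
move=> Ak x; rewrite mem_zball => /supnorm_leP hx; apply/mem_rectP => i; have := hx i.
have : (A * 2 ^ n < 2 ^ (n + k))%N by rewrite [(n + k)%N]addnC expnD ltn_pmul2r // expn_gt0.
rewrite /dyadic_sides inE mxE expnS.
by move: (x 0 i) (2 ^ (n + k))%N (A * 2 ^ n)%N => u v y; lia.
Qed.

(* Hoelder trades the conductance-weighted L^2 norm of the gradient for its L^s norm,
   s < 2, at the price of the inverse moment. *)
Lemma osc_bound (R : realType) (d : nat) (q s th : R) (k : nat) (La : R) :
  0 < q -> 1 < s -> 0 < th -> s / 2 + s / (2 * q) + th = 1 -> 0 <= La ->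
  exists2 C : R, 0 <= C &
  forall (a : lattice d -> 'I_d -> R) (v : lattice d -> R) (n : nat) (la : R),
  let D := dyadic_box d (n + k) in
  let r : R := 2 ^+ n in
  (forall x i, 0 < a x i) -> 0 <= la ->
  \sum_(x <- D) \sum_i a x i * (grad v i x) ^+ 2 <= la * r ^+ d ->
  \sum_(x <- D) \sum_i a x i `^ (- q) <= La * r ^+ d ->
  exists c, \sum_(x <- D) `|v x - c| `^ s <= C * la `^ (s / 2) * r `^ s * r ^+ d.
Proof.
move=> q0 s1 th0 sq La0.
have s0 : 0 < s by lra.
have al : 1 + d%:R / s - d%:R / s = 1 by rewrite addrK.
have [|C0 C00 HC] := @sobolev_dyadic R d d s s (ltW s1) (lexx _) s1; first by rewrite al.
pose N : R := 2 ^+ k.+1.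
exists (C0 `^ s * N `^ s * La `^ (s / (2 * q)) * (2 * d%:R * N ^+ d) `^ th).
  by rewrite !mulr_ge0 ?powR_ge0.
move=> a v n la D r a0 la0 HE HQ.
have r0 : 0 < r by rewrite exprn_gt0.
have N0 : 0 < N by rewrite exprn_gt0.
have rd0 : 0 < r ^+ d by rewrite exprn_gt0.
have cJ : #|[set: 'I_d]%SET| = d by rewrite cardsT card_ord.
have rN : 2 ^+ (n + k).+1 = r * N :> R by rewrite -exprD addnS.
have sD : (size D)%:R <= N ^+ d * r ^+ d :> R.
  by rewrite size_rect prod_dyadic_sides cJ natrX exprM rN exprMn mulrC.
exists (mean v D).
apply: le_trans (HC v _ _ _ cJ) _; rewrite -/D al powRr1 ?exprn_ge0 // rN.
rewrite powRM ?mulr_ge0 ?powR_ge0 ?(ltW r0) ?(ltW N0) // powRVK ?edge_energy_ge0 ?gt_eqF //.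
have := edge_energy_bound q0 s1 th0 sq (uniq_rect _ _) a0 HE HQ sD; rewrite -/D => hE.
apply: le_trans (ler_wpM2l (powR_ge0 _ _) hE) _.
rewrite !(powRM _ _ (ltW rd0)) ?(ltW N0) //.
have Er : r ^+ d = (r ^+ d) `^ (s / 2) * (r ^+ d) `^ (s / (2 * q)) * (r ^+ d) `^ th.
  by rewrite -!powRD ?(gt_eqF rd0) ?implybT // sq powRr1 // ltW.
have -> : (2 * d%:R * (N ^+ d * r ^+ d)) `^ th = (2 * d%:R * N ^+ d) `^ th * (r ^+ d) `^ th.
  by rewrite mulrA powRM ?mulr_ge0 ?exprn_ge0 ?(ltW N0) ?(ltW r0).
have -> : (C0 * (r * N)) `^ s = C0 `^ s * r `^ s * N `^ s.
  by rewrite !powRM ?mulr_ge0 ?(ltW N0) ?(ltW r0) // mulrA.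
by apply: eq_le_refl; rewrite [X in _ = _ * X]Er; ring.
Qed.

Section average_sublinearity.
Context {d : nat} {R : realType}.
Variable P : probability (env d R) R.
Hypotheses (sP : stationary P) (eP : ergodic P).
Variables (q s th : R).
Hypotheses (q0 : 0 < q) (s1 : 1 < s) (th0 : 0 < th) (sq : s / 2 + s / (2 * q) + th = 1)
  (hq : summable_rv P (fun w => \sum_i edge_weight w 0 i `^ (- q))).

Lemma ergodic_window (A : nat) (f : env d R -> R) : (0 < A)%N -> summable_rv P f -> (forall w, 0 <= f w) ->
  exists2 C : R, 0 < C & forall la : R, C * Rintegral P setT f < la ->
  {ae P, forall w, forall z : lattice d, exists n, forall i, (n <= i)%N ->
     window_sum f (A * 2 ^ i) 0 (tau (z *+ 2 ^ i) w) <= la * (2 ^+ i) ^+ d}.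
Proof.
move=> A0 sf f0; have mf := summable_rv_measurable sf.
exists (2 ^+ d * (2 * (13 * A) ^ d)%:R).
  by rewrite mulr_gt0 ?exprn_gt0 // ltr0n muln_gt0 /= expn_gt0 muln_gt0 A0.
move=> la hla; have := ergodic_bound A0 sP eP mf f0 (summable_rv_lty f0 sf) hla.
apply: filterS => w h z; have [n hn] := h z; exists n => i /hn.
by rewrite window_sum_tau add0r.
Qed.

(* chi minus the gradient of a bounded function psi has small energy, hence small
   oscillation, while the gradient of psi contributes only O(1) to chi. *)
Lemma average_sublinear (chi : @rfield d R) (A : nat) : L2pot P chi ->
  {ae P, forall w, forall K : nat, exists n0, forall n, (n0 <= n)%N -> exists c,
     \sum_(x <- zball (A * 2 ^ n)) `|chi w x - c| `^ s <=
     K.+1%:R^-1 * ((2 ^+ n) `^ s * (2 ^+ n) ^+ d)}.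
Proof.
move=> Lchi; apply: ae_forall_countable => K.
have s0 : 0 < s by move: s1; lra.
pose k := A; have Ak : (A < 2 ^ k)%N by rewrite ltn_expl.
have k0 : (0 < 2 ^ k)%N by rewrite expn_gt0.
pose de : R := K.+1%:R^-1; have de0 : 0 < de by rewrite invr_gt0.
pose f2 (w : env d R) := \sum_i edge_weight w 0 i `^ (- q).
have f20 w : 0 <= f2 w by apply: sumr_ge0 => i _; exact: powR_ge0.
have [C2 C20 H2] := ergodic_window k0 hq f20.
pose La := C2 * Rintegral P setT f2 + 1.
have I20 : 0 <= Rintegral P setT f2 by apply: Rintegral_ge0 => w _; exact: f20.
have La0 : 0 <= La by rewrite addr_ge0 // mulr_ge0 // ltW.
have hLa := H2 La _.
have [C C0 HC] := osc_bound d k q0 s1 th0 sq La0.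
have tw0 : 0 < 2 `^ s :> R by rewrite powR_gt0.
(* The energy level at which [osc_bound] gives half of the tolerance de; the factor 2^s is the loss
   in splitting chi into two parts. *)
pose la := (de / (2 * (2 `^ s * (C + 1)))) `^ (2 / s).
have arg0 : 0 < de / (2 * (2 `^ s * (C + 1))) by rewrite divr_gt0 // !mulr_gt0 // ltr_wpDl.
have la0 : 0 < la by rewrite powR_gt0.
have hla : 2 `^ s * (C * la `^ (s / 2)) <= de / 2.
  rewrite /la -powRrM (_ : 2 / s * (s / 2) = 1); last by field; rewrite gt_eqF.
  rewrite powRr1 ?(ltW arg0) //.
  have C1 : 0 < C + 1 by rewrite ltr_wpDl.
  rewrite (_ : 2 `^ s * (C * _) = de / 2 * (C / (C + 1))); last by field; rewrite !gt_eqF.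
  by rewrite ler_piMr ?divr_ge0 ?(ltW de0) // ler_pdivrMr // mul1r lerDl.
pose CE : R := 2 ^+ d * (2 * (13 * 2 ^ k) ^ d)%:R.
have CE0 : 0 <= CE by rewrite mulr_ge0.
have CE1 : 0 < CE + 1 by rewrite ltr_wpDl.
(* The accuracy compensates the constant CE of the maximal inequality, so that the energy averages
   of eta are eventually at most la. *)
have [psi [b [mpsi b0 hb hE]]] := L2pot_bounded_approx Lchi (divr_gt0 la0 CE1).
pose eta : @rfield d R := fun w x => chi w x - hderiv psi w x.
pose f1 w := nbr_sum (fun x => eta w x ^+ 2) w.
have f10 w : 0 <= f1 w by apply: nbr_sum_ge0 => x; exact: sqr_ge0.
have mchi x : measurable_fun setT (chi ^~ x) by case: Lchi => -[].
have mf1 : measurable_fun setT f1.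
  apply: measurable_nbr_sum => x; apply: measurable_funX; apply: measurable_funB => //.
  by apply: measurable_funB => //; exact: (measurableT_comp mpsi (measurable_tau x)).
have f1fin : (\int[P]_w (f1 w)%:E < +oo)%E by apply: lt_trans hE _; exact: ltry.
have hf1 : CE * fine (\int[P]_w (f1 w)%:E)%E < la.
  have I10 : (0 <= \int[P]_w (f1 w)%:E)%E by apply: integral_ge0 => w _; rewrite lee_fin.
  have fE : (\int[P]_w (f1 w)%:E = (fine (\int[P]_w (f1 w)%:E))%:E)%E.
    by rewrite fineK // ge0_fin_numE.
  have fI : 0 <= fine (\int[P]_w (f1 w)%:E)%E by exact: fine_ge0.
  have : (\int[P]_w (f1 w)%:E < (la / (CE + 1))%:E)%E by exact: hE.
  rewrite fE lte_fin ltr_pdivlMr // => hE'.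
  by apply: le_lt_trans hE'; rewrite mulrC ler_wpM2l // lerDl.
have E1 := ergodic_bound k0 sP eP mf1 f10 f1fin hf1.
have E2 : {ae P, forall w, forall z : lattice d, exists n, forall i, (n <= i)%N ->
     window_sum f2 (2 ^ k * 2 ^ i) 0 (tau (z *+ 2 ^ i) w) <= La * (2 ^+ i) ^+ d}.
  by apply: H2; rewrite /La ltrDl.
have cchi : cocycle P chi by case: Lchi => -[].
move: cchi E1 E2; apply: filterS3 => w cw h1 h2.
have [n1 hn1] := h1 0; have [n2 hn2] := h2 0.
(* The contribution of psi, divided by r^d. It does not grow with n, so it falls below half of de
   r^s once r >= B / (de / 2). *)
pose B : R := 2 `^ s * ((2 * b) `^ s * (2 ^+ k.+1) ^+ d).
have B0 : 0 <= B by rewrite !mulr_ge0 ?powR_ge0 ?exprn_ge0.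
pose n3 := (Num.truncn (B / (de / 2))).+1.
exists (maxn n1 (maxn n2 n3)) => n; rewrite !geq_max => /andP[N1 /andP[N2 N3]].
set r : R := 2 ^+ n.
have r0 : 0 < r by rewrite exprn_gt0.
have rd0 : 0 < r ^+ d by rewrite exprn_gt0.
have Bn : B <= de / 2 * r `^ s.
  rewrite mulrC -ler_pdivrMr ?divr_gt0 //.
  have r1 : 1 <= r by rewrite exprn_ege1 // ler1n.
  apply: (@le_trans _ _ r); last by apply: le1r_powR => //; exact: ltW.
  apply/ltW/(lt_le_trans (real_truncnS_gt (num_real _))).
  by rewrite /r -natrX ler_nat (leq_trans N3) // ltnW // ltn_expl.
pose D := dyadic_box d (n + k).
have DB : {subset D <= zball (2 ^ k * 2 ^ n)} by exact: dyadic_box_sub.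
have BD : {subset zball (A * 2 ^ n) <= D} by exact: sub_dyadic_box.
have ceta : cocycle_at eta w.
  by move=> x y; rewrite /eta (cw x y) /hderiv tauD subrK; ring.
have sumD (F : lattice d -> R) : (forall x, 0 <= F x) ->
    \sum_(x <- D) F x <= \sum_(x <- zball (2 ^ k * 2 ^ n)) F x.
  by move=> F0; apply: sum_sub => //; exact: uniq_rect.
have [||c hc'] := HC (edge_weight w) (eta w) n la (edge_weight_gt0 w) (ltW la0).
- apply: le_trans (sumD _ _) _.
    by move=> x; apply: sumr_ge0 => i _; rewrite mulr_ge0 ?sqr_ge0 ?(ltW (edge_weight_gt0 _ _ _)).
  apply: le_trans (energy_window _ ceta) _.
  by have := hn1 n N1; rewrite mul0rn.
- apply: le_trans (sumD _ _) _; first by move=> x; apply: sumr_ge0 => i _; exact: powR_ge0.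
  have := hn2 n N2; rewrite mul0rn tau0; apply: le_trans.
  rewrite -sum_window; apply: ler_sum => x _; apply: ler_sum => i _.
  by rewrite edge_weight_tau add0r.
exists c.
apply: (@le_trans _ _ (\sum_(x <- D) 2 `^ s * (`|eta w x - c| `^ s + (2 * b) `^ s))).
  apply: (@le_trans _ _ (\sum_(x <- D) `|chi w x - c| `^ s)).
    apply: sum_sub; [exact: uniq_zball|exact: BD|move=> x _; exact: powR_ge0].
  apply: ler_sum => x _; apply: le_trans (powRD_le (ltW s0) (normr_ge0 _) _); last by rewrite mulr_ge0.
  apply: powRr_le; rewrite ?(ltW s0) //.
  rewrite (_ : chi w x - c = (eta w x - c) + hderiv psi w x); last by rewrite /eta; ring.
  apply: le_trans (ler_normD _ _) _; rewrite lerD2l (le_trans (ler_normB _ _)) //.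
  by rewrite mulrDl mul1r lerD.
rewrite -mulr_sumr big_split sum_const /= mulrDr.
have sD : (size D)%:R = (2 ^+ k.+1) ^+ d * r ^+ d :> R.
  rewrite size_rect prod_dyadic_sides cardsT card_ord natrX exprM -exprMn; congr (_ ^+ d).
  by rewrite -exprD addSn [(k + n)%N]addnC.
apply: (@le_trans _ _ (de / 2 * (r `^ s * r ^+ d) + de / 2 * (r `^ s * r ^+ d))); last by rewrite -mulrDl -splitr.
apply: lerD.
  apply: (@le_trans _ _ (2 `^ s * (C * la `^ (s / 2)) * (r `^ s * r ^+ d))).
    by rewrite -!mulrA ler_wpM2l ?powR_ge0 // !mulrA.
  by rewrite ler_wpM2r ?mulr_ge0 ?powR_ge0 // ltW.
rewrite sD mulrA -[leLHS](_ : B * r ^+ d = _); last by rewrite /B; ring.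
by rewrite mulrA ler_wpM2r // ltW.
Qed.

End average_sublinearity.

Section edge_moments.
Context {d : nat} {R : realType}.
Variable P : probability (env d R) R.
Hypothesis sP : stationary P.
Variables (p q : R).
Hypotheses (p1 : 1 < p)
  (hp : forall x, nearest_neighbours 0 x -> summable_rv P (fun w => conductance w 0 x `^ p))
  (hq : forall x, nearest_neighbours 0 x -> summable_rv P (fun w => conductance w 0 x `^ (- q))).

Lemma summable_conductance x : summable_rv P (fun w => conductance w 0 x).
Proof.
have [nn|/conductance_eq0 E] := boolP (nearest_neighbours 0 x).
  apply: summable_rv_le (summable_rvD (summable_rv_cst P 1) (hp nn)) => [|w].
    exact: measurable_conductance.
  rewrite ger0_norm ?conductance_ge0 //.
  have [c1|c1] := leP 1 (conductance w 0 x).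
    by rewrite (le_trans (le1r_powR c1 (ltW p1))) // lerDr.
  by rewrite (le_trans (ltW c1)) // lerDl powR_ge0.
by rewrite (_ : (fun w => _) = cst 0); [exact: summable_rv_cst|apply/funext => w; rewrite E].
Qed.

Lemma nearest_neighbours0_unitv (i : 'I_d) : nearest_neighbours 0 (unitv i).
Proof. by rewrite -[unitv i]add0r; exact: nearest_neighbours_unitv. Qed.

Lemma summable_speed : summable_rv P (fun w => speed (edge_weight w) 0 `^ p).
Proof.
have p0 : 0 <= p by move: p1; lra.
pose h (i : 'I_d) (w : env d R) :=
  2 `^ p * (edge_weight w 0 i `^ p + edge_weight w (0 - unitv i) i `^ p).
have sh i : summable_rv P (h i).
  apply: summable_rvZ; apply: summable_rvD.
    by rewrite /edge_weight add0r; apply: hp; exact: nearest_neighbours0_unitv.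
  have := summable_rv_tau sP (- unitv i) (hp (nearest_neighbours0_unitv i)).
  congr (summable_rv P); apply/funext => w.
  by rewrite conductance_tau /edge_weight subrr sub0r addNr.
have mw x i : measurable_fun setT (fun w : env d R => edge_weight w x i) by exact: measurable_edge_weight.
have := summable_rvZ ((size (index_enum 'I_d))%:R `^ (p - 1)) (summable_rv_sum (index_enum _) sh).
apply: summable_rv_le => [|w].
  apply: (measurableT_comp (measurable_powR p)).
  by apply: measurable_sum => i; apply: measurable_funD.
rewrite ger0_norm ?powR_ge0 //.
have E0 x i : 0 <= edge_weight w x i by exact/ltW/edge_weight_gt0.
apply: le_trans (jensen_sum _ (ltW p1) _) _ => [i|]; first by rewrite addr_ge0.
by rewrite ler_wpM2l ?powR_ge0 //; apply: ler_sum => i _; exact: powRD_le.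
Qed.

Lemma summable_inv_weights : summable_rv P (fun w => \sum_i edge_weight w 0 i `^ (- q)).
Proof.
apply: summable_rv_sum => i; rewrite /edge_weight add0r.
by apply: hq; exact: nearest_neighbours0_unitv.
Qed.

End edge_moments.

Lemma moment_exponents (R : realType) (d : nat) (p q : \bar R) (P : probability (env d R) R) :
  (3 <= d)%N -> (1 < p)%E -> (1 < q)%E -> (p^-1 + q^-1 < (2 / (d%:R - 1))%:E)%E ->
  moment_condition P p q ->
  exists p' q' s t th : R,
    [/\ [/\ 1 < p', 0 < q', 1 < s, s <= t & t * (1 - p'^-1) = 2],
        0 < 1 + d.-1%:R / t - d.-1%:R / s, 0 < th & s / 2 + s / (2 * q') + th = 1] /\
    forall x, nearest_neighbours 0 x ->
      summable_rv P (fun w => conductance w 0 x `^ p') /\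
      summable_rv P (fun w => conductance w 0 x `^ (- q')).
Proof.
move=> d3 p1 q1 pq mc; have [p' [q' [s [t [th [h1 h2]]]]]] := exponents d3 p1 q1 pq.
exists p', q', s, t, th; split=> // x nn; have [e _ ce] := @conductanceE d R _ _ nn; have [mp mq] := mc e.
have me : measurable_fun setT (fun w : env d R => (w e)%:num) by exact: measurable_coordinate.
split.
  rewrite (_ : (fun w => _) = fun w : env d R => (w e)%:num `^ p'); last by apply/funext => w; rewrite ce.
  by have [|h _] := h2 P (fun w => (w e)%:num) me; [move=> w|exact: h].
rewrite (_ : (fun w => _) = fun w : env d R => ((w e)%:num)^-1 `^ q'); last first.
  by apply/funext => w; rewrite ce -powR_inv1 // -powRrM mulN1r.
have [|w|_ h] := h2 P (fun w => ((w e)%:num)^-1).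
- have := measurableT_comp (measurable_powR (-1)) me; apply: eq_measurable_fun => w _.
  by rewrite /= powR_inv1.
- by [].
- exact: h.
Qed.

(** * From harmonic coordinates to pathwise bounds *)

Section harmonic_coordinates.
Context {d : nat} {R : realType}.
Implicit Types (w : env d R) (Phi : @rfield d R) (u : lattice d -> R).

(** By the cocycle property, the divergence at the origin of the environment seen from x is the
    generator at x. *)
Lemma generator_cocycle Phi w : cocycle_at Phi w ->
  (forall x, divergence Phi (tau x w) = 0) ->
  forall x, generator (edge_weight w) (Phi w) x = 0.
Proof.
move=> h H x; rewrite -[RHS](H x); apply: eq_bigr => i _.
have hx y : Phi (tau x w) y = Phi w (x + y) - Phi w x by rewrite -h addrAC subrr add0r.
rewrite /flux !conductance_tau !hx /grad /edge_weight subrK !add0r.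
rewrite [unitv i + x]addrC [- unitv i + x]addrC [conductance w (x - unitv i) x]conductanceC.
by ring.
Qed.

Lemma generator_affine (a : lattice d -> 'I_d -> R) u (e c : R) x :
  generator a (fun y => e * (u y + c)) x = e * generator a u x.
Proof. by rewrite /generator mulr_sumr; apply: eq_bigr => i _; rewrite /grad; ring. Qed.

Hypothesis d0 : (0 < d)%N.
Variables (p q s t th : R).
Hypotheses (p1 : 1 < p) (q0 : 0 < q) (s1 : 1 < s) (st : s <= t)
  (tp : t * (1 - p^-1) = 2) (al0 : 0 < 1 + d.-1%:R / t - d.-1%:R / s)
  (th0 : 0 < th) (sq : s / 2 + s / (2 * q) + th = 1).

(** [local_bound] is one-sided; it is applied to u + c and to its negative, which have the same
    energy and the same moments. *)
Lemma harmonic_bound (M : R) : 0 < M -> exists2 K : R, 0 < K &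
  forall (a : lattice d -> 'I_d -> R) u (c : R) (n : nat),
  let r : R := 2 ^+ n in
  let B := zball (2 * 2 ^ n) in
  (forall x i, 0 < a x i) -> (forall x, generator a u x = 0) ->
  \sum_(x <- B) speed a x `^ p <= M * r ^+ d ->
  \sum_(x <- B) \sum_i a x i `^ (- q) <= M * r ^+ d ->
  \sum_(x <- B) \sum_i a x i * (grad u i x) ^+ 2 <= M * r ^+ d ->
  \sum_(x <- B) `|u x + c| `^ s <= M * r `^ s * r ^+ d ->
  forall x, (supnorm x <= 2 ^ n)%N -> `|u x + c| <= K * r.
Proof.
move=> M0; have [K K0 HK] := local_bound d0 p1 q0 s1 st tp al0 th0 sq M0.
exists K => // a u c n r B a0 hu h1 h2 h3 h4 x xn.
have side (e : R) : `|e| = 1 -> e * (u x + c) <= K * r.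
  move=> e1; apply: (HK a (fun y => e * (u y + c))) => //.
  - by move=> y _; rewrite generator_affine hu mulr0.
  - rewrite (eq_bigr (fun y => \sum_i a y i * (grad u i y) ^+ 2)) // => y _.
    apply: eq_bigr => i _; congr (_ * _).
    rewrite (_ : grad _ i y = e * grad u i y); last by rewrite /grad; ring.
    by rewrite exprMn -[e ^+ 2]real_normK ?num_real // e1 expr1n mul1r.
  - by rewrite (eq_bigr (fun y => `|u y + c| `^ s)) // => y _; rewrite normrM e1 mul1r.
rewrite ler_norml; apply/andP; split.
  by rewrite lerNl -mulN1r; apply: side; rewrite normrN1.
by rewrite -[leLHS]mul1r; apply: side; rewrite normr1.
Qed.

Definition corrected_position (chi : @rfield d R) (j : 'I_d) : @rfield d R :=
  fun w x => position j w x - chi w x.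

Lemma cocycle_at_position (j : 'I_d) w : cocycle_at (position j) w.
Proof. by move=> x y; rewrite /position !mxE rmorphB. Qed.

Lemma corrector_local_bound (j : 'I_d) (M : R) : 0 < M -> exists2 K : R, 0 < K &
  forall (chi : @rfield d R) w (c : R) (n : nat),
  let Phi := corrected_position chi j in
  let r : R := 2 ^+ n in
  let W f := window_sum f (2 * 2 ^ n) 0 w in
  cocycle_at chi w -> (forall x, divergence Phi (tau x w) = 0) ->
  W (fun w => speed (edge_weight w) 0 `^ p) <= M * r ^+ d ->
  W (fun w => \sum_i edge_weight w 0 i `^ (- q)) <= M * r ^+ d ->
  W (fun w => nbr_sum (fun x => Phi w x ^+ 2) w) <= M * r ^+ d ->
  \sum_(x <- zball (2 * 2 ^ n)) `|chi w x - c| `^ s <= r `^ s * r ^+ d ->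
  forall x, (supnorm x <= 2 ^ n)%N -> `|chi w x - c| <= K * r.
Proof.
move=> M0; have s0 : 0 < s by move: s1; lra.
(* For the s-th moment of Phi + c: the position is at most 2 r at no more than 5^d r^d points, and
   chi - c contributes the summand 1. *)
pose M1 := 2 `^ s * (2 `^ s * 5 ^+ d + 1).
have M10 : 0 <= M1 by rewrite mulr_ge0 ?powR_ge0 // addr_ge0 // mulr_ge0 ?powR_ge0.
have [K K0 HK] := harmonic_bound (ltr_wpDr M10 M0).
exists (K + 1) => [|chi w c n Phi r W cw Hd h1 h2 h3 h4 x xn]; first by rewrite addr_gt0.
have r0 : 0 < r by rewrite exprn_gt0.
have rd0 : 0 < r ^+ d by rewrite exprn_gt0.
have ME (X Y : R) : 0 <= Y -> X <= M * Y -> X <= (M + M1) * Y.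
  by move=> Y0 /le_trans -> //; rewrite ler_wpM2r // lerDl.
have cPhi : cocycle_at Phi w.
  by move=> y z; rewrite /Phi /corrected_position (cocycle_at_position j) cw; ring.
have hpos k y : (supnorm y <= k)%N -> `|position j w y| <= k%:R.
  move=> /supnorm_leP/(_ j) hy.
  by rewrite /position -intr_norm -[k%:R]/(k%:Z%:~R) ler_int.
have hx : `|Phi w x + c| <= K * r.
  apply: (HK _ _ c n (edge_weight_gt0 w) (generator_cocycle cPhi Hd)) => //.
  - apply: ME; rewrite ?(ltW rd0) //; apply: le_trans h1; rewrite /W -sum_window.
    by apply: ler_sum => y _; rewrite speed_tau add0r.
  - apply: ME; rewrite ?(ltW rd0) //; apply: le_trans h2; rewrite /W -sum_window.
    by apply: ler_sum => y _; apply: ler_sum => i _; rewrite edge_weight_tau add0r.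
  - by apply: ME; rewrite ?(ltW rd0) //; apply: le_trans h3; exact: energy_window.
  apply: (@le_trans _ _ (\sum_(y <- zball (2 * 2 ^ n)) 2 `^ s * ((2 * r) `^ s + `|chi w y - c| `^ s))).
    rewrite big_seq [leRHS]big_seq; apply: ler_sum => y; rewrite mem_zball => /hpos hy.
    rewrite natrM natrX -/r in hy.
    apply: le_trans (powRD_le (ltW s0) _ (normr_ge0 _)); last by rewrite mulr_ge0 // ltW.
    apply: powRr_le; rewrite ?(ltW s0) //.
    rewrite (_ : Phi w y + c = position j w y - (chi w y - c)).
      by apply: le_trans (ler_normB _ _) _; rewrite lerD2r.
    by rewrite /Phi /corrected_position; ring.
  rewrite -mulr_sumr big_split sum_const /=.
  have sz : (size (@zball d (2 * 2 ^ n)))%:R <= 5 ^+ d * r ^+ d.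
    by rewrite /r -!natrX -natrM ler_nat size_zball_le.
  apply: (@le_trans _ _ (M1 * r `^ s * r ^+ d)); last first.
    by rewrite -[leLHS]mulrA -[leRHS]mulrA ler_wpM2r ?mulr_ge0 ?powR_ge0 ?(ltW rd0) // lerDr ltW.
  rewrite /M1 powRM ?(ltW r0) // -!mulrA ler_wpM2l ?powR_ge0 //.
  apply: (@le_trans _ _ (5 ^+ d * r ^+ d * (2 `^ s * r `^ s) + r `^ s * r ^+ d)).
    by rewrite lerD // ler_wpM2r // mulr_ge0 ?powR_ge0.
  by apply: eq_le_refl; ring.
rewrite (_ : chi w x - c = position j w x - (Phi w x + c)); last first.
  by rewrite /Phi /corrected_position; ring.
apply: le_trans (ler_normB _ _) _; rewrite mulrDl mul1r addrC lerD //.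
by have := hpos _ _ xn; rewrite natrX.
Qed.

End harmonic_coordinates.

Lemma eventually_seq (T : eqType) (s : seq T) (Q : T -> nat -> Prop) :
  (forall x, exists n, forall i, (n <= i)%N -> Q x i) ->
  exists n, forall i, (n <= i)%N -> forall x, x \in s -> Q x i.
Proof.
move=> H; elim: s => [|x s [n IH]]; first by exists 0%N.
have [m hm] := H x; exists (maxn m n) => i; rewrite geq_max => /andP[mi ni] y.
by rewrite inE => /predU1P[->|ys]; [exact: hm|exact: IH].
Qed.

(** Euclidean division in each coordinate. With k = 2^n the points z k are the window centres of the
    maximal theorem, and finitely many z serve the whole large ball. *)
Lemma lattice_divE (d k A : nat) (y : lattice d) : (0 < k)%N -> (supnorm y <= A * k)%N ->
  exists x z, [/\ y = x + z *+ k, (supnorm x <= k)%N & (supnorm z <= A)%N].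
Proof.
move=> k0 /supnorm_leP hy.
have k0' : k%:Z != 0 by case: k k0 {hy}.
exists (\row_i (y 0%R i %% k%:Z)%Z), (\row_i (y 0%R i %/ k%:Z)%Z); split.
- by apply/rowP => i; rewrite !mxE mulmxnE mxE {1}(divz_eq (y 0 i) k) addrC -mulr_natr natz.
- apply/supnorm_leP => i; rewrite mxE ger0_norm ?modz_ge0 //.
  by rewrite ltW // ltz_pmod.
- apply/supnorm_leP => i; rewrite mxE; have := hy i.
  have := modz_ge0 (y 0 i) k0'; have : (y 0%R i %% k < k)%Z by rewrite ltz_pmod.
  have := divz_eq (y 0 i) k.
  move: (y 0 i) (y 0%R i %% k)%Z (y 0%R i %/ k)%Z => v u w -> u1 u0; rewrite PoszM.
  rewrite !ler_norml => /andP[h1 h2]; apply/andP; split; rewrite leNgt; apply/negP => h; nia.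
Qed.

Lemma ae_and (d : nat) (R : realType) (P : probability (env d R) R) (Q1 Q2 : env d R -> Prop) :
  {ae P, forall w, Q1 w} -> {ae P, forall w, Q2 w} -> {ae P, forall w, Q1 w /\ Q2 w}.
Proof. by apply: filterS2 => w. Qed.

Section pathwise_bound.
Context {d : nat} {R : realType}.
Variable P : probability (env d R) R.
Hypotheses (sP : stationary P) (eP : ergodic P) (d0 : (0 < d)%N).
Variables (p q s t th : R).
Hypotheses (p1 : 1 < p) (q0 : 0 < q) (s1 : 1 < s) (st : s <= t)
  (tp : t * (1 - p^-1) = 2) (al0 : 0 < 1 + d.-1%:R / t - d.-1%:R / s)
  (th0 : 0 < th) (sq : s / 2 + s / (2 * q) + th = 1)
  (hp : forall x, nearest_neighbours 0 x -> summable_rv P (fun w => conductance w 0 x `^ p))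
  (hq : forall x, nearest_neighbours 0 x -> summable_rv P (fun w => conductance w 0 x `^ (- q))).

(* C does not depend on A: on the ball of radius A 2^n one uses the local bound on cells
   of side 2^n, and A is later taken large to make 2^n small against the radius. *)
Lemma corrector_bound (chi : @rfield d R) (j : 'I_d) :
  L2pot P chi -> L2sol P (corrected_position chi j) ->
  exists2 C : R, 0 < C & forall A : nat,
  {ae P, forall w, exists n0, forall n, (n0 <= n)%N ->
    forall y, (supnorm y <= A * 2 ^ n)%N -> `|chi w y| <= C * 2 ^+ n}.
Proof.
move=> Lchi LPhi; pose Phi := corrected_position chi j.
pose f1 (w : env d R) := speed (edge_weight w) 0 `^ p.
pose f2 (w : env d R) := \sum_i edge_weight w 0 i `^ (- q).
pose f3 (w : env d R) := nbr_sum (fun x => Phi w x ^+ 2) w.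
have f10 w : 0 <= f1 w by exact: powR_ge0.
have f20 w : 0 <= f2 w by apply: sumr_ge0 => i _; exact: powR_ge0.
have f30 w : 0 <= f3 w by apply: nbr_sum_ge0 => x; exact: sqr_ge0.
have sf1 : summable_rv P f1 by exact: summable_speed.
have sf2 : summable_rv P f2 by exact: summable_inv_weights.
have sf3 : summable_rv P f3 by case: LPhi => /summable_sqnorm.
have hc := summable_conductance p1 hp.
have [C1 C10 H1] := @ergodic_window _ _ _ sP eP 2 _ isT sf1 f10.
have [C2 C20 H2] := @ergodic_window _ _ _ sP eP 2 _ isT sf2 f20.
have [C3 C30 H3] := @ergodic_window _ _ _ sP eP 2 _ isT sf3 f30.
pose m1 := C1 * Rintegral P setT f1.
pose m2 := C2 * Rintegral P setT f2.
pose m3 := C3 * Rintegral P setT f3.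
have m10 : 0 <= m1 by apply: mulr_ge0; [exact: ltW|apply: Rintegral_ge0 => w _; exact: f10].
have m20 : 0 <= m2 by apply: mulr_ge0; [exact: ltW|apply: Rintegral_ge0 => w _; exact: f20].
have m30 : 0 <= m3 by apply: mulr_ge0; [exact: ltW|apply: Rintegral_ge0 => w _; exact: f30].
(* M, and hence K, is fixed before A: windows of radius 2 2^n have the same constants around every
   centre. *)
have [M [M0 M1 M2 M3]] : exists M, [/\ 0 < M, m1 < M, m2 < M & m3 < M].
  by exists (m1 + m2 + m3 + 1); split; move: m10 m20 m30; clearbody m1 m2 m3; lra.
have [K K0 HK] := corrector_local_bound d0 p1 q0 s1 st tp al0 th0 sq j M0.
exists (2 * K) => [|A]; first by rewrite mulr_gt0.
have div0 : {ae P, forall w, forall x, divergence Phi (tau x w) = 0}.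
  by apply: ae_forall_countable => x; exact: ae_tau sP (divergence_ae0 sP hc LPhi).
have cchi : cocycle P chi by case: Lchi => -[].
(* The windows of radius 2 2^n around the centres z 2^n with |z| <= A lie in the ball of radius (A +
   2) 2^n. *)
have avg := average_sublinear sP eP q0 s1 th0 sq sf2 (A + 2) Lchi.
have E1 := ae_and (ae_and (H1 _ M1) (H2 _ M2)) (H3 _ M3).
have E2 := ae_and cchi (cocycle0 cchi).
move: E1 E2 (ae_and avg div0); apply: filterS3 => w [[w1 w2] w3] [cw chi0] [wavg wdiv].
have [n1 hn1] := eventually_seq (zball A) w1.
have [n2 hn2] := eventually_seq (zball A) w2.
have [n3 hn3] := eventually_seq (zball A) w3.
(* Tolerance 1 is enough, since [corrector_local_bound] expects the average of |chi - c|^s to be at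
   most r^s. *)
have [n4 hn4] := wavg 0%N.
exists (maxn (maxn n1 n2) (maxn n3 n4)) => n.
rewrite !geq_max => /andP[/andP[N1 N2] /andP[N3 /hn4[c hc']]].
have bd y : (supnorm y <= A * 2 ^ n)%N -> `|chi w y - c| <= K * 2 ^+ n.
  move=> yn; have [|x [z [yE xn zA]]] := lattice_divE _ yn; first by rewrite expn_gt0.
  have zA' : z \in zball A by rewrite mem_zball.
  set z' := z *+ 2 ^ n in yE.
  (* Seen from z' the corrector is shifted by its value there, so the constant c has to become c -
     chi(z'). *)
  have chiz v : chi (tau z' w) v = chi w (v + z') - chi w z'.
    by rewrite -(cw z' (v + z')) addrK.
  rewrite (_ : chi w y - c = chi (tau z' w) x - (c - chi w z')); last by rewrite chiz yE; ring.
  apply: HK => //.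
  - exact: cocycle_at_tau.
  - by move=> v; rewrite tauD; exact: wdiv.
  - exact: hn1.
  - exact: hn2.
  - exact: hn3.
  rewrite (eq_bigr (fun v => `|chi w (v + z') - c| `^ s)); last first.
    by move=> v _; rewrite chiz; congr (`| _ | `^ _); ring.
  rewrite -[leLHS](big_map (fun v => v + z') xpredT (fun v => `|chi w v - c| `^ s)).
  apply: le_trans (le_trans hc' _); last by rewrite invr1 mul1r.
  apply: sum_sub => [|v /mapP[v' v'B ->]|v _]; last exact: powR_ge0.
    by rewrite map_inj_uniq ?uniq_zball //; exact: addIr.
  move: v'B; rewrite !mem_zball => v'B; apply: leq_trans (supnormD _ _) _.
  rewrite mulnDl addnC leq_add // (leq_trans (supnorm_mulrn _ _)) //.
  by rewrite mulnC leq_mul2r zA orbT.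
move=> y /bd hy; have h0 : `|chi w 0 - c| <= K * 2 ^+ n by apply: bd; rewrite supnorm0.
rewrite (_ : chi w y = (chi w y - c) - (chi w 0 - c)); last by rewrite chi0; ring.
by rewrite -mulrA mulr_natl mulr2n (le_trans (ler_normB _ _)) // lerD.
Qed.

End pathwise_bound.

Lemma box_supnorm (d n : nat) (x : lattice d) : box n x -> (supnorm x <= n)%N.
Proof. by move=> h; apply/supnorm_leP. Qed.

Lemma fsbigmax_box (R : realType) (d n : nat) (F : lattice d -> R) (b : R) :
  0 <= b -> (forall x, 0 <= F x) -> (forall x, (supnorm x <= n)%N -> F x <= b) ->
  0 <= \big[Num.max/0]_(x \in box n) F x <= b.
Proof.
move=> b0 F0 Fb; have fin : finite_set (@box d n).
  by apply: sub_finite_set (finite_seq (zball n)) => x /box_supnorm; rewrite /= mem_zball.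
rewrite big_seq; apply: (big_ind (fun m => 0 <= m <= b)).
- by rewrite lexx.
- move=> u v /andP[u0 ub] /andP[v0 vb].
  by rewrite le_max u0 ge_max ub vb.
- move=> x; rewrite in_finite_support; last exact: finite_setIl.
  by rewrite inE F0 => -[/box_supnorm/Fb].
Qed.

(** Take m with C <= e 2^m and apply the hypothesis at the scale 2^k, where k is the binary
    logarithm of n minus m, with A = L 2^(m+1). Then L n <= A 2^k, while C 2^k <= e 2^(k+m) <= e n.
    This works because C does not depend on A. *)
Lemma cvg_box_max (R : realType) (d L : nat) (F : lattice d -> R) (C : R) :
  0 <= C -> (forall x, 0 <= F x) ->
  (forall A : nat, exists n0, forall n, (n0 <= n)%N ->
     forall y, (supnorm y <= A * 2 ^ n)%N -> F y <= C * 2 ^+ n) ->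
  (fun n : nat => n%:R^-1 * \big[Num.max/0]_(x \in box (L * n)%N) F x) @ \oo --> (0 : R).
Proof.
move=> C0 F0 H; apply/cvgrPdist_le => e e0.
pose m := (Num.truncn (C / e)).+1.
have Cm : C <= e * 2 ^+ m.
  rewrite mulrC -ler_pdivrMr // (le_trans (ltW (real_truncnS_gt (num_real _)))) //.
  by rewrite -natrX ler_nat ltnW // ltn_expl.
have [n0 hn0] := H (L * 2 ^ m.+1)%N.
exists (2 ^ (n0 + m))%N => // n /= hn.
have n_gt0 : (0 < n)%N by apply: leq_trans hn; rewrite expn_gt0.
have hN : (n0 + m <= trunc_log 2 n)%N by exact: trunc_log_max.
have nlt : (n < 2 ^ (trunc_log 2 n).+1)%N by exact: trunc_log_ltn.
have nge : (2 ^ trunc_log 2 n <= n)%N by exact: trunc_logP.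
have mN : (m <= trunc_log 2 n)%N by rewrite (leq_trans _ hN) // leq_addl.
pose k := (trunc_log 2 n - m)%N; have kE : trunc_log 2 n = (k + m)%N by rewrite subnK.
have k0 : (n0 <= k)%N by move: hN; rewrite kE leq_add2r.
have /andP[B0 Bn] : 0 <= \big[Num.max/0]_(x \in box (L * n)%N) F x <= e * n%:R.
  apply: fsbigmax_box => // [|x xn]; first by rewrite mulr_ge0 // ltW.
  apply: le_trans (hn0 k k0 x _) _.
    apply: leq_trans xn _; rewrite -mulnA leq_mul2l -expnD addSn addnC -kE.
    by rewrite (ltnW nlt) orbT.
  apply: le_trans (ler_wpM2r _ Cm) _; first by rewrite exprn_ge0.
  by rewrite -mulrA ler_wpM2l ?(ltW e0) // -exprD addnC -kE -natrX ler_nat.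
rewrite sub0r normrN ger0_norm ?mulr_ge0 ?invr_ge0 // mulrC.
by rewrite ler_pdivrMr ?ltr0n.
Qed.

Theorem proposition2 (R : realType) (d : nat) (hd : (3 <= d)%N)
  (P : probability (env d R) R)
  (Pstat : stationary P) (Perg : ergodic P)
  (p q : \bar R) (hp : (1 < p)%E) (hq : (1 < q)%E)
  (hpq : (p^-1 + q^-1 < (2 / (d%:R - 1))%:E)%E)
  (hmom : moment_condition P p q)
  (chi : env d R -> lattice d -> 'rV[R]_d) (hchi : is_corrector P chi)
  (L : nat) (hL : (0 < L)%N) (j : 'I_d) :
  {ae P, forall w : env d R,
    (fun n : nat =>
       n%:R^-1 * \big[Num.max/0]_(x \in box (L * n)%N) `|chi w x 0 j|)
      @ \oo --> (0 : R)}.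
Proof.
have [p' [q' [s [t [th [[[p1 q0 s1 st tp] al0 th0 sq] hm]]]]]] := moment_exponents hd hp hq hpq hmom.
have d0 : (0 < d)%N by apply: leq_trans hd.
have [Lpot Lsol] := hchi j.
have [C C0 HC] := corrector_bound Pstat Perg d0 p1 q0 s1 st tp al0 th0 sq
  (fun x nn => (hm x nn).1) (fun x nn => (hm x nn).2) Lpot Lsol.
apply: filterS (ae_forall_countable HC) => w hw.
by apply: cvg_box_max (ltW C0) _ hw => x; exact: normr_ge0.
Qed.
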